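(* Let $\epsilon>0$ be a constant and let $p=p(n)$ satisfy $n^{-2/3+\epsilon}<p\le 1$. Then the independence number $\alpha(G_{n,p})$ is concentrated on two values; that is, there is a function $f(n)$ such that $$\lim_{n\to\infty}\mathbb{P}\left(\alpha(G_{n,p})\in\{f(n),f(n)+1\}\right)=1.$$
   Context: $G_{n,p}$ is the binomial random graph on a vertex set of cardinality $n$, each potential edge appearing independently with probability $p=p(n)$. An independent set is a set of vertices containing no edge, and $\alpha(G)$ is the maximum number of vertices in an independent set of $G$. An integer-valued random variable $X$ defined on $G_{n,p}$ is concentrated on $k=k(n)$ values if there is a function $f(n)$ such that $\lim_{n\to\infty}\mathbb{P}(X\in\{f(n),\dots,f(n)+k-1\})=1$. *)

(* Defs.v *)
From HB Require Import structures.
From mathcomp Require Import all_boot all_order all_algebra.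
From mathcomp Require Import all_classical all_reals all_analysis.

Set Implicit Arguments.
Unset Strict Implicit.
Unset Printing Implicit Defensive.

Import Order.TTheory GRing.Theory Num.Theory.
Import numFieldNormedType.Exports.

Local Open Scope ring_scope.
Local Open Scope classical_set_scope.

Definition edge (n : nat) : finType := {e : {set 'I_n} | #|e| == 2%N}.

(* A simple graph on the vertex set 'I_n, given by its set of edges. *)
Definition graph (n : nat) : finType := {set edge n}.

Definition independent (n : nat) (G : graph n) (S : {set 'I_n}) : bool :=
  [forall e in G, ~~ (val e \subset S)].

Definition indep_number (n : nat) (G : graph n) : nat :=
  \max_(S : {set 'I_n} | independent G S) #|S|.

(* The law of G_{n,p}: the product over all potential edges of the Bernoulli
   law with parameter p. It is a probability when 0 <= p <= 1. *)
Definition gnp_mass (R : realType) (n : nat) (p : R) (G : graph n) : R :=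
  \prod_(e : edge n) (if e \in G then p else 1 - p).

Definition gnp_prob (R : realType) (n : nat) (p : R) (A : pred (graph n)) : R :=
  \sum_(G : graph n | A G) gnp_mass p G.

(* The event reads X \in {f n, ..., f n + k n - 1}, an interval of integers. *)
Definition concentrated_on (R : realType) (k : nat -> nat) (p : nat -> R)
    (X : forall n : nat, graph n -> int) : Prop :=
  exists f : nat -> int,
    gnp_prob (p n) (fun G : graph n => f n <= X n G <= f n + (k n)%:Z - 1)
      @[n --> \oo] --> (1 : R).

(* Main.v *)
(** Let q = 1 - p and let S range over k-sets of vertices.  When p is at least a
    small negative power of n, the plain second moment method for independent
    k-sets works.  When p is smaller, independent sets come in clusters: exchanging
    a vertex u of S for an outside vertex whose only neighbour in S is u gives
    another independent set.  The vertex labels break these ties: a maximum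
    independent set of minimal label sum is "weak", i.e. every outside vertex has
    a neighbour in S, and if it has a single one then that one has a smaller label.
    Hence P(alpha = k) is at most the expected number of weak k-sets, which drops
    by a power of n when k increases by one.

    For the lower bound, call S "strong" if moreover no vertex of S is the only
    neighbour in S of two outside vertices; this costs a factor 1 - o(1).  If S and T
    are strong and j = |S \ T| = |T \ S|, the bipartite graph between S \ T and
    T \ S has minimum degree at least 1, no component that is a single edge (the
    label condition for S and the one for T would contradict each other), and at
    most one leaf at each vertex, so it has at least 3j/2 edges.  The expected
    number of such T is therefore about (n p^(3/2))^(-j) up to logarithms, which
    is small exactly when p is much larger than n^(-2/3).  Nearly disjoint pairs
    are asymptotically independent, and the remaining pairs are handled by the
    first moment alone. *)

Require Import Defs.
From HB Require Import structures.
From mathcomp Require Import all_boot all_order all_algebra.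
From mathcomp Require Import all_classical all_reals all_analysis.
From mathcomp Require Import zify ring lra.
From mathcomp Require Import fintype finset.

Set Implicit Arguments.
Unset Strict Implicit.
Unset Printing Implicit Defensive.

Import Order.TTheory GRing.Theory Num.Theory.
Import numFieldNormedType.Exports.

Local Open Scope ring_scope.

(** * The product measure on graphs *)

(** Nothing before the last theorem is asymptotic. Errors are measured in powers of lam = n^(1/(30
    T)) with T of order 1/eps, and the bound 1 - 64/lam is proved for each n and p separately, so
    p(n) may behave irregularly. The first value f is the largest k, in a suitable range, whose
    expected number of weak k-sets (independent k-sets in the dense regime) is at least lam. That
    expectation is large enough for Chebyshev at f; at f + 1 it may be of constant order, which is
    the reason for two values; at f + 2 it is at most about 1/lam. The exponent 3/2 fits as follows.
    At the independence number q^k is (np)^-2 and k is 1/p, up to logarithms. Swapping one vertex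
    offers about k n choices, costs q^k for the new non-edges and p^(3/2) for the edges forced by
    strength: k n q^k p^(3/2) is about 1 / (n p^(3/2)). Without the forced edges the factor would be
    about 1 / (n p^3), which is not small for small p. Half-integer exponents are avoided by
    comparing squares, and fractional powers of n by natural powers of lam. *)

Section Gnp.
Variables (R : realType) (n : nat) (p : R).
Hypotheses (p0 : 0 <= p) (p1 : p <= 1).
Implicit Types (A B C : pred (graph n)) (F : {set edge n}).

Let q := 1 - p.
Let q0 : 0 <= q. Proof. by rewrite subr_ge0. Qed.

Local Notation Pr := (@gnp_prob R n p).

Lemma gnp_mass_ge0 (G : graph n) : 0 <= gnp_mass p G.
Proof. by apply: prodr_ge0 => e _; case: ifP. Qed.

Lemma Pr_ge0 A : 0 <= Pr A.
Proof. by apply: sumr_ge0 => G _; exact: gnp_mass_ge0. Qed.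

Lemma Pr_sumE A : Pr A = \sum_(G : graph n) (A G)%:R * gnp_mass p G.
Proof.
rewrite /gnp_prob big_mkcond; apply: eq_bigr => G _.
by case: (A G); rewrite (mul1r, mul0r).
Qed.

Lemma eq_Pr A B : A =1 B -> Pr A = Pr B.
Proof. by move=> AB; apply: eq_bigl. Qed.

Lemma le_Pr A B : (forall G, A G -> B G) -> Pr A <= Pr B.
Proof.
move=> AB; rewrite !Pr_sumE; apply: ler_sum => G _.
apply: ler_wpM2r; first exact: gnp_mass_ge0.
by rewrite ler_nat; case: (A G) (AB G) => // ->.
Qed.

Lemma Pr_cylinder (X Y : {set edge n}) : [disjoint X & Y] ->
  Pr (fun G => (X \subset G) && [disjoint Y & G]) = p ^+ #|X| * q ^+ #|Y|.
Proof.
move=> XY; rewrite Pr_sumE.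
(* An edge weighs [f] when present and [g] when absent, a violated requirement weighing 0; the sum
   over all graphs then factors into the product of f + g over the edges. *)
pose f e : R := if e \in Y then 0 else p.
pose g e : R := if e \in X then 0 else q.
rewrite (eq_bigr (fun G : graph n => \prod_e (if e \in G then f e else g e))).
  rewrite -(bigA_distr _ _) -[p ^+ _]prodr_const -[q ^+ _]prodr_const.
  rewrite [X in _ = X * _]big_mkcond [X in _ = _ * X]big_mkcond -big_split /=.
  apply: eq_bigr => e _; rewrite /f /g.
  case: (boolP (e \in X)) => eX; case: (boolP (e \in Y)) => eY.
  - by have := disjointFr XY eX; rewrite eY.
  - by rewrite addr0 mulr1.
  - by rewrite add0r mul1r.
  - by rewrite /q addrC subrK mulr1.
move=> G _; case: (boolP (X \subset G)) => XG; last first.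
  rewrite mul0r; case/subsetPn: XG => e eX eG.
  by rewrite (bigD1 e) //= (negPf eG) /g eX mul0r.
case: (boolP [disjoint Y & G]) => YG; last first.
  rewrite mul0r; move: YG; rewrite -setI_eq0 => /set0Pn[e].
  by rewrite inE => /andP[eY eG]; rewrite (bigD1 e) //= eG /f eY mul0r.
rewrite mul1r /gnp_mass; apply: eq_bigr => e _; rewrite /f /g.
case: (boolP (e \in G)) => eG; first by rewrite (disjointFl YG eG).
by case: (boolP (e \in X)) => // /(subsetP XG); rewrite (negPf eG).
Qed.

Lemma Pr_avoid F : Pr (fun G => [disjoint F & G]) = q ^+ #|F|.
Proof.
rewrite -[RHS]mul1r -(expr0 p) -(cards0 (edge n)) -Pr_cylinder ?disjoints_subset ?sub0set //.
by apply: eq_Pr => G; rewrite sub0set.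
Qed.

Lemma Pr_contain F : Pr (fun G => F \subset G) = p ^+ #|F|.
Proof.
rewrite -[RHS]mulr1 -(expr0 q) -(cards0 (edge n)) -Pr_cylinder.
  by apply: eq_Pr => G; rewrite disjoints_subset sub0set andbT.
by rewrite disjoint_sym disjoints_subset sub0set.
Qed.

Lemma Pr_true : Pr predT = 1.
Proof.
rewrite -(expr0 p) -(cards0 (edge n)) -Pr_contain.
by apply: eq_Pr => G; rewrite sub0set.
Qed.

Lemma Pr_compl A : Pr (fun G => ~~ A G) = 1 - Pr A.
Proof.
suff <- : Pr A + Pr (fun G => ~~ A G) = 1 by rewrite addrC addKr.
by rewrite -[RHS]Pr_true /gnp_prob [RHS](bigID A).
Qed.

Lemma Pr_le1 A : Pr A <= 1.
Proof. by rewrite -Pr_true; apply: le_Pr. Qed.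

Lemma Pr_exists (I : finType) (D : pred I) (A : I -> pred (graph n)) :
  Pr (fun G => [exists i in D, A i G]) <= \sum_(i in D) Pr (A i).
Proof.
rewrite Pr_sumE (eq_bigr _ (fun i _ => Pr_sumE (A i))) exchange_big /=.
apply: ler_sum => G _; rewrite -mulr_suml; apply: ler_wpM2r.
  exact: gnp_mass_ge0.
case: existsP => [[i /andP[iD AiG]]|_]; last by apply: sumr_ge0.
by rewrite (bigD1 i) //= AiG lerDl; apply: sumr_ge0.
Qed.

Lemma Pr_exists_uniq (I : finType) (D : pred I) (A : I -> pred (graph n)) :
  (forall G i j, i \in D -> j \in D -> A i G -> A j G -> i = j) ->
  Pr (fun G => [exists i in D, A i G]) = \sum_(i in D) Pr (A i).
Proof.
move=> Auniq.
rewrite Pr_sumE (eq_bigr _ (fun i _ => Pr_sumE (A i))) exchange_big /=.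
apply: eq_bigr => G _; rewrite -mulr_suml; congr (_ * _).
case: existsP => [[i /andP[iD AiG]]|nA].
  rewrite (bigD1 i) //= AiG big1 ?addr0 // => j /andP[jD ji].
  by case: (boolP (A j G)) => // AjG; rewrite (Auniq G _ _ iD jD AiG AjG) eqxx in ji.
rewrite big1 // => i iD; case: (boolP (A i G)) => // AiG.
by case: nA; exists i; rewrite iD.
Qed.

Lemma Pr_or A B : Pr (fun G => A G || B G) <= Pr A + Pr B.
Proof.
rewrite !Pr_sumE -big_split /=; apply: ler_sum => G _; rewrite -mulrDl.
apply: ler_wpM2r; first exact: gnp_mass_ge0.
by case: (A G); case: (B G); rewrite ?addr0 ?add0r // lerDl.
Qed.

Lemma Pr_or_disj A B : (forall G, A G -> ~~ B G) ->
  Pr (fun G => A G || B G) = Pr A + Pr B.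
Proof.
move=> AB; rewrite !Pr_sumE -big_split /=; apply: eq_bigr => G _; rewrite -mulrDl.
congr (_ * _); case: (A G) (AB G); case: (B G) => //= ABG;
  by rewrite ?addr0 ?add0r //; have := ABG isT.
Qed.

Definition depends_on F A := forall G, A (G :&: F) = A G.

Lemma sub_depends_on F F' A : F \subset F' -> depends_on F A -> depends_on F' A.
Proof.
move=> FF' dA G; rewrite -(dA (G :&: F')) -setIA.
by move/setIidPr: FF' => ->; rewrite dA.
Qed.

Lemma depends_on_and F A B : depends_on F A -> depends_on F B ->
  depends_on F (fun G => A G && B G).
Proof. by move=> dA dB G; rewrite dA dB. Qed.

Lemma gnp_mass_split F (X Y : graph n) : X \subset F -> Y \subset ~: F ->
  gnp_mass p (X :|: Y) =
  (\prod_(e in F) (if e \in X then p else q)) *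
  (\prod_(e in ~: F) (if e \in Y then p else q)).
Proof.
move=> XF YF; rewrite /gnp_mass (bigID (mem F)) /=; congr (_ * _).
  apply: eq_bigr => e eF; rewrite inE.
  have /negPf -> : e \notin Y; last by rewrite orbF.
  by apply/negP => /(subsetP YF); rewrite inE eF.
rewrite (eq_bigl (fun e => e \in ~: F)) => [|e]; last by rewrite !inE.
apply: eq_bigr => e eF; rewrite inE.
have /negPf -> : e \notin X; last by [].
by apply/negP => /(subsetP XF) eF'; move: eF; rewrite in_setC eF'.
Qed.

Lemma Pr_indep_compl F A B : depends_on F A -> depends_on (~: F) B ->
  Pr (fun G => A G && B G) = Pr A * Pr B.
Proof.
move=> dA dB.
pose wF (X : graph n) : R := \prod_(e in F) (if e \in X then p else q).
pose wC (X : graph n) : R := \prod_(e in ~: F) (if e \in X then p else q).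
(* The weights on [F] and on its complement are not normalised beforehand: [key] is also used with
   [predT] in one or both places, which gives c * d = 1, Pr A = a * d and Pr B = c * b. *)
have key (A' B' : pred (graph n)) : depends_on F A' -> depends_on (~: F) B' ->
  Pr (fun G => A' G && B' G) =
    (\sum_(X : graph n | X \subset F) (A' X)%:R * wF X) *
    (\sum_(Y : graph n | Y \subset ~: F) (B' Y)%:R * wC Y).
  move=> dA' dB'; rewrite Pr_sumE mulr_suml.
  rewrite (eq_bigr _ (fun X _ => mulr_sumr _ _ _ _)) pair_big /=.
  rewrite (reindex_onto (fun u : graph n * graph n => u.1 :|: u.2)
     (fun G => (G :&: F, G :&: ~: F))) /=; last first.
    by move=> G _; rewrite -setIUr setUCr setIT.
  have ok (u : graph n * graph n) :
    (((u.1 :|: u.2) :&: F, (u.1 :|: u.2) :&: ~: F) == u) =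
    (u.1 \subset F) && (u.2 \subset ~: F).
    case: u => X Y /=; apply/eqP/andP => [[<- <-]|[XF YF]].
      by rewrite !subsetIr.
    rewrite !setIUl (setIidPl XF) (setIidPl YF).
    have -> : Y :&: F = set0 by apply/disjoint_setI0; rewrite disjoints_subset.
    have -> : X :&: ~: F = set0.
      by apply/disjoint_setI0; rewrite disjoints_subset setCK.
    by rewrite setU0 set0U.
  rewrite (eq_bigl _ _ ok); apply: eq_bigr => -[X Y] /= /andP[XF YF].
  rewrite (gnp_mass_split XF YF) -/(wF X) -/(wC Y).
  rewrite -(dA' (X :|: Y)) -(dB' (X :|: Y)).
  have /eqP[-> ->] : ((X :|: Y) :&: F, (X :|: Y) :&: ~: F) == (X, Y).
    by rewrite (ok (X, Y)) /= XF YF.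
  by rewrite -mulnb natrM mulrACA.
have dT F' : depends_on F' predT by [].
set a := \sum_(X : graph n | X \subset F) (A X)%:R * wF X.
set b := \sum_(X : graph n | X \subset ~: F) (B X)%:R * wC X.
set c := \sum_(X : graph n | X \subset F) 1%:R * wF X.
set d := \sum_(X : graph n | X \subset ~: F) 1%:R * wC X.
have cd : c * d = 1 by rewrite -(key predT predT) // -[RHS]Pr_true.
have PA : Pr A = a * d.
  by rewrite -(key A predT) //; apply: eq_Pr => G; rewrite andbT.
have PB : Pr B = c * b by rewrite -(key predT B).
by rewrite (key A B) // PA PB -/a -/b mulrA -[a * d * c]mulrA [d * c]mulrC cd mulr1.
Qed.

Lemma Pr_indep F F' A B : [disjoint F & F'] -> depends_on F A ->
  depends_on F' B -> Pr (fun G => A G && B G) = Pr A * Pr B.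
Proof.
move=> FF' dA dB; apply: (Pr_indep_compl dA); apply: sub_depends_on dB.
by rewrite -disjoints_subset disjoint_sym.
Qed.

Lemma depends_on_all (I : eqType) (r : seq I) F (A : I -> pred (graph n)) :
  {in r, forall i, depends_on F (A i)} ->
  depends_on F (fun G => all (fun i => A i G) r).
Proof. by move=> dA G; apply: eq_in_all => i /dA. Qed.

Lemma Pr_indep_all (I : eqType) (r : seq I) (F : I -> {set edge n})
    (A : I -> pred (graph n)) : uniq r ->
  {in r &, forall i j, i != j -> [disjoint F i & F j]} ->
  {in r, forall i, depends_on (F i) (A i)} ->
  Pr (fun G => all (fun i => A i G) r) = \prod_(i <- r) Pr (A i).
Proof.
elim: r => [|i r IH] /=; first by move=> _ _ _; rewrite big_nil -[RHS]Pr_true.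
case/andP=> ir ur dF dA; rewrite big_cons -IH //; first last.
- by move=> j jr; apply: dA; rewrite inE jr orbT.
- by move=> j k jr kr; apply: dF; rewrite inE ?jr ?kr orbT.
apply: (@Pr_indep_compl (F i)); first by apply: dA; rewrite inE eqxx.
apply: depends_on_all => j jr.
apply: (@sub_depends_on (F j)); last by apply: dA; rewrite inE jr orbT.
rewrite -disjoints_subset dF ?inE ?eqxx ?jr ?orbT //.
by apply: contraNneq ir => <-.
Qed.

Lemma Pr_indep_forall (I : finType) (D : {set I}) F0 (F : I -> {set edge n})
    A0 (A : I -> pred (graph n)) :
  {in D &, forall i j, i != j -> [disjoint F i & F j]} ->
  {in D, forall i, [disjoint F0 & F i]} ->
  depends_on F0 A0 -> {in D, forall i, depends_on (F i) (A i)} ->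
  Pr (fun G => A0 G && [forall i in D, A i G]) =
  Pr A0 * \prod_(i in D) Pr (A i).
Proof.
move=> dF dF0 dA0 dA.
have inD i : i \in enum D -> i \in D by rewrite mem_enum.
rewrite -big_enum -(Pr_indep_all (F := F)) ?enum_uniq //; first last.
- by move=> i /inD; exact: dA.
- by move=> i j /inD iD /inD jD; exact: dF.
have -> : Pr (fun G => A0 G && [forall i in D, A i G]) =
    Pr (fun G => A0 G && all (fun i => A i G) (enum D)).
  apply: eq_Pr => G; congr (_ && _); apply/forall_inP/allP => AG i.
    by move/inD; exact: AG.
  by rewrite -mem_enum; exact: AG.
apply: (Pr_indep_compl dA0); apply: depends_on_all => i /inD iD.
apply: sub_depends_on (dA i iD).
by rewrite -disjoints_subset disjoint_sym dF0.
Qed.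

(** Chebyshev's inequality for the number [Z] of events that hold, cleared of denominators: where Z
    = 0, the squared deviation equals mu^2. *)
Lemma Pr_second_moment (I : finType) (A : I -> pred (graph n)) :
  Pr (fun G => ~~ [exists i, A i G]) * (\sum_i Pr (A i)) ^+ 2 <=
  \sum_i \sum_j Pr (fun G => A i G && A j G) - (\sum_i Pr (A i)) ^+ 2.
Proof.
set mu := \sum_i Pr (A i).
pose Z (G : graph n) : R := \sum_i (A i G)%:R.
have EZ : mu = \sum_G Z G * gnp_mass p G.
  rewrite /mu (eq_bigr _ (fun i _ => Pr_sumE (A i))) exchange_big.
  by apply: eq_bigr => G _; rewrite mulr_suml.
have EZ2 : \sum_i \sum_j Pr (fun G => A i G && A j G) =
    \sum_G Z G ^+ 2 * gnp_mass p G.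
  under eq_bigr do rewrite (eq_bigr _ (fun j _ => Pr_sumE _)) exchange_big.
  rewrite exchange_big /=; apply: eq_bigr => G _.
  rewrite expr2 !mulr_suml; apply: eq_bigr => i _.
  rewrite mulr_sumr mulr_suml; apply: eq_bigr => j _.
  by rewrite -mulnb natrM.
have -> : \sum_i \sum_j Pr (fun G => A i G && A j G) - mu ^+ 2 =
    \sum_G (Z G - mu) ^+ 2 * gnp_mass p G.
  have tot : \sum_(G : graph n) gnp_mass p G = 1 by exact: Pr_true.
  transitivity (\sum_G (Z G ^+ 2 * gnp_mass p G
      - mu *+ 2 * (Z G * gnp_mass p G) + mu ^+ 2 * gnp_mass p G)); last first.
    by apply: eq_bigr => G _; ring.
  by rewrite big_split sumrB /= -!mulr_sumr -EZ tot EZ2; ring.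
rewrite Pr_sumE mulr_suml; apply: ler_sum => G _.
rewrite mulrAC; apply: ler_wpM2r; first exact: gnp_mass_ge0.
case: existsP => [_|nA]; rewrite ?mul0r ?sqr_ge0 // mul1r.
rewrite /Z big1 ?sub0r ?sqrrN // => i _.
by case: (boolP (A i G)) => // AiG; case: nA; exists i.
Qed.

End Gnp.

(** With [D] and [D'] the leaves in [B] and in [B'], the degree sums over the two sides are at least
    2|B| - |D| and 2|B'| - |D'|. Adding them and using |D| + |D'| <= |B| gives the claim. Two leaves
    at a common vertex are forbidden on one side only. *)
Lemma bipartite_double_edge_count (V : finType) (r : rel V) (B B' : {set V}) :
  #|B| = #|B'| ->
  {in B, forall u, exists2 v, v \in B' & r u v} ->
  {in B', forall v, exists2 u, u \in B & r u v} ->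
  (forall u v, u \in B -> v \in B' -> r u v ->
    {in B', forall w, r u w -> w = v} -> {in B, forall w, r w v -> w = u} ->
    False) ->
  (forall u v1 v2, u \in B -> v1 \in B' -> v2 \in B' -> r u v1 -> r u v2 ->
    {in B, forall w, r w v1 -> w = u} -> {in B, forall w, r w v2 -> w = u} ->
    v1 = v2) ->
  (3 * #|B| <= 2 * #|[set x in setX B B' | r x.1 x.2]|)%N.
Proof.
move=> cBB' nB nB' noedge nocherry.
pose d u := #|[set v in B' | r u v]|.
pose d' v := #|[set u in B | r u v]|.
pose D := [set u in B | d u == 1%N].
pose D' := [set v in B' | d' v == 1%N].
have cardE : #|[set x in setX B B' | r x.1 x.2]| = (\sum_(u in B) d u)%N.
  rewrite -sum1dep_card.
  rewrite (eq_bigl (fun x : V * V => (x.1 \in B) && ((x.2 \in B') && r x.1 x.2))).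
    rewrite -(pair_big_dep (mem B) (fun u v => (v \in B') && r u v) (fun _ _ => 1%N)) /=.
    by apply: eq_bigr => u _; rewrite /d -sum1dep_card.
  by move=> x; rewrite !inE andbA.
have cardE' : #|[set x in setX B B' | r x.1 x.2]| = (\sum_(v in B') d' v)%N.
  rewrite cardE /d (eq_bigr (fun u => \sum_(v in B' | r u v) 1)%N); last first.
    by move=> u _; rewrite sum1dep_card.
  rewrite (exchange_big_dep (mem B')) /=; last by move=> u v _ /andP[].
  by apply: eq_bigr => v vB'; rewrite /d' -sum1dep_card; apply: eq_bigl => u; rewrite vB'.
have d1 v : d' v = 1%N -> forall u w, u \in B -> w \in B -> r u v -> r w v -> w = u.
  move=> /eqP/cards1P[x xE] u w uB wB ru rw.
  have : u \in [set x] by rewrite -xE inE uB.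
  have : w \in [set x] by rewrite -xE inE wB.
  by rewrite !inE => /eqP -> /eqP ->.
have e1 u : d u = 1%N -> forall v w, v \in B' -> w \in B' -> r u v -> r u w -> w = v.
  move=> /eqP/cards1P[x xE] v w vB wB rv rw.
  have : v \in [set x] by rewrite -xE inE vB.
  have : w \in [set x] by rewrite -xE inE wB.
  by rewrite !inE => /eqP -> /eqP ->.
have dpos u : u \in B -> (0 < d u)%N.
  by move=> /nB[v vB' ruv]; rewrite card_gt0; apply/set0Pn; exists v; rewrite inE vB'.
have dpos' v : v \in B' -> (0 < d' v)%N.
  by move=> /nB'[u uB ruv]; rewrite card_gt0; apply/set0Pn; exists u; rewrite inE uB.
(* Sending a leaf in [B'] to its neighbour is injective, as no vertex of [B] carries two leaves, and
   misses [D], as no component is a single edge. *)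
have DD' : (#|D'| + #|D| <= #|B|)%N.
  pose f v := odflt v [pick u in B | r u v].
  have fP v : v \in B' -> f v \in B /\ r (f v) v.
    move=> /nB'[u uB ruv]; rewrite /f; case: pickP => [w /andP[]|/(_ u)] //=.
    by rewrite uB ruv.
  have finj : {in D' &, injective f}.
    move=> v1 v2; rewrite !inE => /andP[v1B /eqP dv1] /andP[v2B /eqP dv2] fE.
    have [f1 r1] := fP _ v1B; have [f2 r2] := fP _ v2B.
    apply: (nocherry (f v1)) => //; first by rewrite fE.
      by move=> w wB rw; apply: (d1 _ dv1).
    by move=> w wB rw; apply: (d1 _ dv2) => //; rewrite fE.
  rewrite -(card_in_imset finj) -(cardsID D B).
  have -> : B :&: D = D by apply/setIidPr; apply/subsetP => u; rewrite inE => /andP[].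
  rewrite addnC leq_add2l; apply: subset_leq_card; apply/subsetP => _ /imsetP[v vD' ->].
  move: vD'; rewrite inE => /andP[vB' /eqP dv]; have [fB rf] := fP _ vB'.
  rewrite !inE fB andbT /=; apply/negP => /eqP df.
  apply: (noedge (f v) v) => // w wB rw; first exact: (e1 _ df).
  exact: (d1 _ dv).
have s1 : (2 * #|B| <= \sum_(u in B) d u + #|D|)%N.
  have -> : #|D| = (\sum_(u in B) (d u == 1))%N.
    by rewrite -sum1dep_card big_mkcondr; apply: eq_bigr => u _; case: eqP.
  rewrite -big_split /= mulnC -sum_nat_const; apply: leq_sum => u /dpos.
  by case: (d u) => [|[|m]].
have s2 : (2 * #|B'| <= \sum_(v in B') d' v + #|D'|)%N.
  have -> : #|D'| = (\sum_(u in B') (d' u == 1))%N.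
    by rewrite -sum1dep_card big_mkcondr; apply: eq_bigr => u _; case: eqP.
  rewrite -big_split /= mulnC -sum_nat_const; apply: leq_sum => u /dpos'.
  by case: (d' u) => [|[|m]].
move: s1 s2 DD'; rewrite -cardE -cardE' -cBB'; lia.
Qed.

(** * Edge sets *)

Section EdgeSets.
Variable n : nat.
Implicit Types (S T U A B : {set 'I_n}) (u v w : 'I_n).

Definition inner S : {set edge n} := [set e : edge n | val e \subset S].

Definition cross A B : {set edge n} :=
  [set e : edge n | [exists u in A, [exists v in B, val e == [set u; v]]]].

Lemma crossP A B (e : edge n) :
  reflect (exists u v, [/\ u \in A, v \in B & val e = [set u; v]]) (e \in cross A B).
Proof.
rewrite inE; apply: (iffP exists_inP).
  by move=> [u uA /exists_inP[v vB /eqP eE]]; exists u, v.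
by move=> [u [v [uA vB eE]]]; exists u => //; apply/exists_inP; exists v; rewrite ?eE.
Qed.

Lemma card_edges (P : pred {set 'I_n}) :
  #|[set e : edge n | P (val e)]| = #|[set f : {set 'I_n} | P f & #|f| == 2%N]|.
Proof.
rewrite -(card_imset _ val_inj); apply: eq_card => f; rewrite !inE.
apply/imsetP/andP => [[e]|[Pf f2]].
  by rewrite inE => Pe ->; split => //; exact: (valP e).
by exists (Sub f f2); rewrite ?inE ?SubK.
Qed.

Lemma card_inner S : #|inner S| = 'C(#|S|, 2).
Proof. by rewrite (card_edges (fun f => f \subset S)) cards_draws. Qed.

Lemma set2_inj_disjoint A B u v u' v' : [disjoint A & B] ->
  u \in A -> u' \in A -> v \in B -> v' \in B ->
  [set u; v] = [set u'; v'] -> (u, v) = (u', v').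
Proof.
move=> AB uA u'A vB v'B E.
have : u \in [set u'; v'] by rewrite -E !inE eqxx.
have : v \in [set u'; v'] by rewrite -E !inE eqxx orbT.
rewrite !inE => /orP[/eqP ev|/eqP ->].
  by rewrite -ev in u'A; rewrite (disjointFr AB u'A) in vB.
move=> /orP[/eqP ->//|/eqP eu].
by rewrite -eu in v'B; rewrite (disjointFr AB uA) in v'B.
Qed.

Lemma card_cross_rel (r : rel 'I_n) A B (G : graph n) : [disjoint A & B] ->
  {in A & B, forall u v, r u v = [exists e in G, val e == [set u; v]]} ->
  #|cross A B :&: G| = #|[set x in setX A B | r x.1 x.2]|.
Proof.
move=> AB rE; rewrite -(card_imset _ val_inj).
have inj : {in [set x in setX A B | r x.1 x.2] &,
    injective (fun x : 'I_n * 'I_n => [set x.1; x.2])}.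
  move=> [u v] [u' v']; rewrite !inE /= => /andP[/andP[uA vB] _] /andP[/andP[u'A v'B] _].
  exact: (set2_inj_disjoint AB).
rewrite -(card_in_imset inj); apply: eq_card => f.
apply/imsetP/imsetP => [[e]|[[u v]]].
  rewrite inE => /andP[/crossP[u [v [uA vB eE]]] eG] ->.
  exists (u, v) => //=; rewrite !inE /= uA vB rE //=.
  by apply/exists_inP; exists e; rewrite ?eE.
rewrite !inE /= => /andP[/andP[uA vB]]; rewrite rE // => /exists_inP[e eG /eqP eE] ->.
by exists e => //; rewrite inE eG andbT; apply/crossP; exists u, v.
Qed.

Lemma card_cross A B : [disjoint A & B] -> #|cross A B| = (#|A| * #|B|)%N.
Proof.
move=> AB; rewrite -[cross A B]setIT (@card_cross_rel (fun _ _ => true)) //.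
  by rewrite -cardsX; apply: eq_card => x; rewrite inE andbT.
move=> u v uA vB; apply/esym/exists_inP.
have uv2 : #|[set u; v]| == 2%N.
  by rewrite cards2 (_ : u != v) //; apply: contraTneq uA => ->; rewrite (disjointFl AB vB).
by exists (Sub [set u; v] uv2); rewrite ?inE ?SubK.
Qed.

Lemma inner_setI S T : inner (S :&: T) = inner S :&: inner T.
Proof. by apply/setP => e; rewrite !inE subsetI. Qed.

Lemma subset_cross A B A' B' : A \subset A' -> B \subset B' ->
  cross A B \subset cross A' B'.
Proof.
move=> /subsetP AA' /subsetP BB'; apply/subsetP => e /crossP[u [v [uA vB eE]]].
by apply/crossP; exists u, v; rewrite AA' ?BB'.
Qed.

Lemma cross_inner A B : cross A B \subset inner (A :|: B).
Proof.
apply/subsetP => e /crossP[u [v [uA vB eE]]]; rewrite inE eE.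
by apply/subsetP => w; rewrite !inE => /orP[] /eqP ->; rewrite ?uA ?vB ?orbT.
Qed.

Lemma disjoint_inner_cross U A B : [disjoint A & U] ->
  [disjoint inner U & cross A B].
Proof.
move=> AU; rewrite disjoint_sym disjoint_subset; apply/subsetP => e.
move=> /crossP[u [v [uA vB eE]]]; rewrite !inE eE; apply/negP => /subsetP/(_ u).
by rewrite !inE eqxx (disjointFr AU uA) => /(_ isT).
Qed.

Lemma disjoint_stars U v v' S S' : v != v' -> v \notin U -> v' \notin U ->
  S \subset U -> S' \subset U -> [disjoint cross [set v] S & cross [set v'] S'].
Proof.
move=> vv' vU v'U /subsetP SU /subsetP S'U.
rewrite disjoint_subset; apply/subsetP => e /crossP[_ [u [/set1P -> uS eE]]].
rewrite inE; apply/negP => /crossP[_ [u' [/set1P -> u'S eE']]].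
have : v \in [set v'; u'] by rewrite -eE' eE !inE eqxx.
rewrite !inE (negPf vv') /= => /eqP vu'.
by move: vU; rewrite vu' S'U.
Qed.

Lemma disjoint_star v S T : v \notin S -> [disjoint S & T] ->
  [disjoint cross [set v] S & cross [set v] T].
Proof.
move=> vS ST; rewrite disjoint_subset; apply/subsetP => e.
move=> /crossP[_ [u [/set1P -> uS eE]]]; rewrite inE.
apply/negP => /crossP[_ [w [/set1P -> wT eE']]].
have : u \in [set v; w] by rewrite -eE' eE !inE eqxx orbT.
rewrite !inE => /orP[/eqP uv|/eqP uw]; first by rewrite -uv uS in vS.
by rewrite -uw (disjointFr ST uS) in wT.
Qed.

Definition adj (G : graph n) : rel 'I_n :=
  fun u v => [exists e in G, val e == [set u; v]].

Lemma adjC G u v : adj G u v = adj G v u.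
Proof. by rewrite /adj setUC. Qed.

Lemma disjoint_crossP (G : graph n) A B :
  reflect {in A & B, forall u v, ~~ adj G u v} [disjoint cross A B & G].
Proof.
apply: (iffP idP) => [dG u v uA vB|nadj].
  apply/negP => /exists_inP[e eG /eqP eE].
  have eC : e \in cross A B by apply/crossP; exists u, v.
  by rewrite (disjointFr dG eC) in eG.
rewrite disjoint_subset; apply/subsetP => e /crossP[u [v [uA vB eE]]].
rewrite inE; apply/negP => eG; move/negP: (nadj u v uA vB); apply.
by apply/exists_inP; exists e; rewrite ?eE.
Qed.

Lemma cross1_subset (G : graph n) u v : u != v ->
  (cross [set u] [set v] \subset G) = adj G u v.
Proof.
move=> uv; apply/subsetP/exists_inP => [sG|[e eG /eqP eE] f].
  have uv2 : #|[set u; v]| == 2%N by rewrite cards2 uv.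
  exists (Sub [set u; v] uv2); rewrite ?SubK //.
  by apply: sG; apply/crossP; exists u, v; rewrite !inE SubK.
move=> /crossP[_ [_ [/set1P -> /set1P -> fE]]].
by have -> : f = e by apply: val_inj; rewrite fE eE.
Qed.

Lemma independentE (G : graph n) S : independent G S = [disjoint inner S & G].
Proof.
apply/forall_inP/idP => [iG|dG e eG].
  rewrite disjoint_sym disjoint_subset; apply/subsetP => e eG.
  by rewrite !inE; exact: iG.
by apply/negP => eS; have := disjointFl dG eG; rewrite inE eS.
Qed.

Lemma independentP (G : graph n) S :
  reflect {in S &, forall u v, u != v -> ~~ adj G u v} (independent G S).
Proof.
apply: (iffP forall_inP) => [iG u v uS vS uv|nadj e eG].
  apply/negP => /exists_inP[e eG /eqP eE]; move/negP: (iG e eG); apply.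
  by rewrite eE; apply/subsetP => w; rewrite !inE => /orP[] /eqP ->.
have /cards2P[u [v [uv eE]]] := valP e.
apply/negP => /subsetP eS; have := nadj u v; rewrite !eS ?eE ?inE ?eqxx ?orbT //.
move=> /(_ isT isT uv) /negP; apply.
by apply/exists_inP; exists e; rewrite ?eE.
Qed.

End EdgeSets.

(** * Locally minimal independent sets *)

Section Events.
Variable n : nat.
Implicit Types (S T U : {set 'I_n}) (u v w : 'I_n) (G : graph n).

Definition lone v u S G :=
  (cross [set v] [set u] \subset G) && [disjoint cross [set v] (S :\ u) & G].

(* [lone v u S G] says that u is the only neighbour of v in S (for v outside S);
   if moreover v < u, replacing u by v lowers the label sum of S. *)
Definition bad v S G := [disjoint cross [set v] S & G] ||
  [exists u in S, (v < u)%N && lone v u S G].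

Definition weak S G := independent G S && [forall v in ~: S, ~~ bad v S G].

Definition cherry S G := [exists u in S, [exists v1 in ~: S, [exists v2 in ~: S,
  [&& v1 != v2, lone v1 u S G & lone v2 u S G]]]].

Definition strong S G := weak S G && ~~ cherry S G.

Lemma loneP v u S G : u \in S -> v \notin S ->
  reflect (adj G v u /\ {in S, forall w, adj G v w -> w = u}) (lone v u S G).
Proof.
move=> uS vS; have vu : v != u by apply: contraNneq vS => ->.
rewrite /lone cross1_subset //; apply: (iffP andP) => -[vuG].
  move=> /disjoint_crossP dG; split=> // w wS vwG; apply/eqP/negP => /negP wu.
  by have := dG v w (set11 v); rewrite !inE wu wS vwG => /(_ isT).
move=> uniq_u; split=> //; apply/disjoint_crossP => _ w /set1P -> .
by rewrite !inE => /andP[wu wS]; apply: contra wu => /(uniq_u w wS) ->.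
Qed.

(* Take a maximum independent set of minimal label sum. *)
Lemma weak_exists G : exists2 S : {set 'I_n}, #|S| = indep_number G & weak S G.
Proof.
have [S0 S0i S0E] : {S : {set 'I_n} | S \in [pred S : {set 'I_n} | independent G S] & indep_number G = #|S|}.
  apply: eq_bigmax_cond; apply/card_gt0P; exists set0.
  by rewrite inE; apply/independentP => u v; rewrite inE.
pose Q S := independent G S && (#|S| == indep_number G).
have QS0 : Q S0 by rewrite /Q S0E eqxx andbT.
case: (arg_minnP (fun S : {set 'I_n} => \sum_(u in S) (u : nat))%N QS0) => S /andP[iS /eqP cS] minS.
exists S => //; rewrite /weak iS /=; apply/forall_inP => v; rewrite inE => vS.
move/independentP: iS => iS.
rewrite negb_or; apply/andP; split.
  apply/negP => /disjoint_crossP nv.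
  have : (#|v |: S| <= indep_number G)%N.
    apply: (@leq_bigmax_cond _ (fun S => independent G S) (fun S : {set 'I_n} => #|S|)).
    apply/independentP => u w; rewrite !inE.
    move=> /orP[/eqP ->|uS] /orP[/eqP ->|wS]; first by rewrite eqxx.
    - by move=> _; apply: nv; rewrite ?set11.
    - by move=> _; rewrite adjC; apply: nv; rewrite ?set11.
    - exact: iS.
  by rewrite cardsU1 vS cS ltnn.
apply/negP => /exists_inP[u uS /andP[vu /(loneP G uS vS)[vuG vuniq]]].
have vu' : v != u by apply: contraNneq vS => ->.
have /minS : Q (v |: S :\ u).
  rewrite /Q; apply/andP; split; last first.
    by rewrite cardsU1 !inE (negPf vS) andbF /= -cS [in X in _ == X](cardsD1 u S) uS.
  apply/independentP => x y; rewrite !inE.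
  move=> /orP[/eqP ->|/andP[xu xS]] /orP[/eqP ->|/andP[yu yS]]; first by rewrite eqxx.
  - by move=> _; apply: contra yu => /(vuniq _ yS) ->.
  - by move=> _; rewrite adjC; apply: contra xu => /(vuniq _ xS) ->.
  - exact: iS.
rewrite big_setU1 ?inE ?(negPf vS) ?andbF //= (big_setD1 u uS) /=.
by rewrite leq_add2r leqNgt vu.
Qed.

Lemma strong_pair_cross G S S' : #|S| = #|S'| -> strong S G -> strong S' G ->
  (3 * #|S :\: S'| <= 2 * #|cross (S :\: S') (S' :\: S) :&: G|)%N.
Proof.
move=> cSS' /andP[/andP[iS wS] cS] /andP[/andP[iS' wS'] _].
move/independentP: iS => iS; move/independentP: iS' => iS'.
have nbr T T' v : {in T' &, forall u v, u != v -> ~~ adj G u v} ->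
    [forall v in ~: T, ~~ bad v T G] -> v \in T' :\: T ->
    exists2 u, u \in T :\: T' & adj G v u.
  move=> iT' /forall_inP wT; rewrite inE => /andP[vT vT'].
  have := wT v; rewrite inE vT => /(_ isT); rewrite negb_or => /andP[+ _].
  move=> /negP nv; apply/exists_inP/contraT => /exists_inPn nex.
  case: nv; apply/disjoint_crossP => _ u /set1P -> uT; apply/negP => vu.
  suff : u \in T :\: T' by move=> /nex; rewrite vu.
  rewrite inE uT andbT; apply/negP => uT'; apply: (negP (iT' v u vT' uT' _) vu).
  by apply: contraNneq vT => ->.
have dBB' : [disjoint S :\: S' & S' :\: S].
  by rewrite -setI_eq0; apply/eqP/setP => u; rewrite !inE; case: (u \in S); rewrite ?andbF.
rewrite (card_cross_rel (r := adj G) dBB') //.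
have cBB' : #|S :\: S'| = #|S' :\: S|.
  by have := cardsID S' S; have := cardsID S S'; rewrite setIC; lia.
(* [v] has no neighbour in S :&: S' because [S'] is independent, so a neighbour that is unique in
   the difference is unique in all of [S]. *)
have loneB u v : u \in S :\: S' -> v \in S' :\: S -> adj G u v ->
    {in S :\: S', forall w, adj G w v -> w = u} -> lone v u S G.
  rewrite !inE => /andP[uS' uS] /andP[vS vS'] uv uniq_u.
  apply/loneP => //; split; first by rewrite adjC.
  move=> w wS2; rewrite adjC => wv; apply: uniq_u => //; rewrite inE wS2 andbT.
  apply/negP => wS'2; apply: (negP (iS' w v wS'2 vS' _) wv).
  by apply: contraNneq vS => <-.
have loneB' u v : u \in S :\: S' -> v \in S' :\: S -> adj G u v ->
    {in S' :\: S, forall w, adj G u w -> w = v} -> lone u v S' G.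
  rewrite !inE => /andP[uS' uS] /andP[vS vS'] uv uniq_u.
  apply/loneP => //; split=> // w wS'2 uw; apply: uniq_u => //; rewrite inE wS'2 andbT.
  apply/negP => wS2; apply: (negP (iS u w uS wS2 _) uw).
  by apply: contraNneq uS' => ->.
apply: bipartite_double_edge_count => //.
- by move=> u uB; exact: nbr iS wS' uB.
- move=> v vB'; have [u uB vu] := nbr _ _ _ iS' wS vB'.
  by exists u; rewrite // adjC.
- move=> u v uB vB' uv uniq_v uniq_u.
  have lu := loneB u v uB vB' uv uniq_u; have lv := loneB' u v uB vB' uv uniq_v.
  move: uB vB'; rewrite !inE => /andP[uS' uS] /andP[vS vS'].
  have : ~~ bad v S G by move/forall_inP: wS; apply; rewrite inE.
  rewrite negb_or => /andP[_ /exists_inPn/(_ u uS)]; rewrite lu andbT -leqNgt => le1.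
  have : ~~ bad u S' G by move/forall_inP: wS'; apply; rewrite inE.
  rewrite negb_or => /andP[_ /exists_inPn/(_ v vS')]; rewrite lv andbT -leqNgt => le2.
  have uvE : u = v by apply/val_inj/eqP; rewrite eqn_leq le1 le2.
  by rewrite uvE vS' in uS'.
- move=> u v1 v2 uB v1B' v2B' uv1 uv2 uniq1 uniq2; apply/eqP/negP => /negP v12.
  have l1 := loneB u v1 uB v1B' uv1 uniq1; have l2 := loneB u v2 uB v2B' uv2 uniq2.
  move/negP: cS; apply; apply/exists_inP; exists u.
    by move: uB; rewrite inE => /andP[].
  apply/exists_inP; exists v1; first by move: v1B'; rewrite !inE => /andP[].
  apply/exists_inP; exists v2; first by move: v2B'; rewrite !inE => /andP[].
  by rewrite v12 l1 l2.
Qed.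

End Events.

(** * Probabilities of the local conditions *)

Section EventProbabilities.
Variables (R : realType) (n : nat) (p : R).
Hypotheses (p0 : 0 <= p) (p1 : p <= 1).
Implicit Types (S T U : {set 'I_n}) (u v w : 'I_n) (G : graph n).
Let q := 1 - p.
Let q0 : 0 <= q. Proof. by rewrite subr_ge0. Qed.
Let q1 : q <= 1. Proof. by rewrite lerBlDr lerDl. Qed.
Local Notation Pr := (@gnp_prob R n p).

Lemma depends_on_avoid (F F' : {set edge n}) : F \subset F' ->
  depends_on F' (fun G => [disjoint F & G]).
Proof.
move=> /setIidPl FF' G.
by rewrite -!setI_eq0 [G :&: F']setIC setIA FF'.
Qed.

Lemma depends_on_contain (F F' : {set edge n}) : F \subset F' ->
  depends_on F' (fun G => F \subset G).
Proof. by move=> FF' G; rewrite subsetI FF' andbT. Qed.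

Lemma star_subset v S U : S \subset U -> cross [set v] S \subset cross [set v] U.
Proof. exact: subset_cross. Qed.

Lemma depends_on_lone v u S U : u \in S -> S \subset U ->
  depends_on (cross [set v] U) (lone v u S).
Proof.
move=> uS SU; apply: depends_on_and.
  by apply/depends_on_contain/star_subset; rewrite sub1set (subsetP SU).
by apply/depends_on_avoid/star_subset/(subset_trans _ SU)/subsetDl.
Qed.

Lemma depends_on_bad v S U : S \subset U -> depends_on (cross [set v] U) (bad v S).
Proof.
move=> SU G; rewrite /bad (depends_on_avoid (star_subset v SU)); congr (_ || _).
apply: eq_existsb => u; case: (boolP (u \in S)) => //= uS; congr (_ && _).
exact: depends_on_lone.
Qed.

Definition bad_prob v S : R :=
  q ^+ #|S| + #|[set u in S | (v < u)%N]|%:R * (p * q ^+ #|S|.-1).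

Lemma card_star v S : v \notin S -> #|cross [set v] S| = #|S|.
Proof. by move=> vS; rewrite card_cross ?cards1 ?mul1n // disjoints1. Qed.

Lemma Pr_lone v u S : u \in S -> v \notin S -> Pr (lone v u S) = p * q ^+ #|S|.-1.
Proof.
move=> uS vS; rewrite Pr_cylinder //.
  rewrite !card_star ?inE ?(negPf vS) ?andbF //; last by apply: contraNneq vS => ->.
  by rewrite cards1 expr1 [in RHS](cardsD1 u) uS.
apply: disjoint_star; first by rewrite inE; apply: contraNneq vS => ->.
by rewrite disjoints1 !inE eqxx.
Qed.

Lemma lone_uniq v u w S G : u \in S -> w \in S -> v \notin S ->
  lone v u S G -> lone v w S G -> u = w.
Proof. by move=> uS wS vS /(loneP G uS vS)[vu _] /(loneP G wS vS)[_]; apply. Qed.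

Lemma Pr_bad v S : v \notin S -> Pr (bad v S) = bad_prob v S.
Proof.
move=> vS; rewrite Pr_or_disj.
  rewrite Pr_avoid // card_star //; congr (_ + _).
  rewrite (eq_Pr p (B := fun G => [exists u in [set u in S | (v < u)%N], lone v u S G])).
    rewrite Pr_exists_uniq //.
      rewrite (eq_bigr (fun _ => p * q ^+ #|S|.-1)) ?sumr_const ?mulr_natl //.
      by move=> u; rewrite inE => /andP[uS _]; exact: Pr_lone.
    by move=> G u w; rewrite !inE => /andP[uS _] /andP[wS _]; exact: lone_uniq.
  by move=> G; apply: eq_existsb => u; rewrite inE andbA.
move=> G /disjoint_crossP nv; apply/exists_inP => -[u uS /andP[_ /(loneP G uS vS)[vu _]]].
by apply: (negP (nv v u _ uS) vu); rewrite inE.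
Qed.

Definition wt S : R := q ^+ 'C(#|S|, 2) * \prod_(v in ~: S) (1 - bad_prob v S).

Lemma depends_on_independent S U : S \subset U ->
  depends_on (inner U) (fun G => independent G S).
Proof.
move=> SU G; rewrite !independentE; apply: depends_on_avoid.
by apply/subsetP => e; rewrite !inE => eS; exact: subset_trans SU.
Qed.

(** The edges inside [U] and the stars from the outside vertices to [U] are pairwise disjoint edge
    sets. This is the source of all product formulas for weak sets. *)
Lemma Pr_star_family U (A0 : pred (graph n)) (A : 'I_n -> pred (graph n)) :
  depends_on (inner U) A0 ->
  (forall v, v \notin U -> depends_on (cross [set v] U) (A v)) ->
  Pr (fun G => A0 G && [forall v in ~: U, A v G]) =
  Pr A0 * \prod_(v in ~: U) Pr (A v).
Proof.
move=> dA0 dA; apply: (@Pr_indep_forall R n p _ _ (inner U) (fun v => cross [set v] U)) => //.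
- by move=> v w; rewrite !inE => vU wU vw; apply: disjoint_stars vw vU wU _ _.
- by move=> v; rewrite inE => vU; apply: disjoint_inner_cross; rewrite disjoints1.
- by move=> v; rewrite inE; exact: dA.
Qed.

Lemma Pr_independent S : Pr (fun G => independent G S) = q ^+ 'C(#|S|, 2).
Proof.
by rewrite (eq_Pr p (B := fun G => [disjoint inner S & G])) ?Pr_avoid ?card_inner // => G;
  exact: independentE.
Qed.

Lemma Pr_weak S : Pr (weak S) = wt S.
Proof.
rewrite /weak (Pr_star_family (A := fun v G => ~~ bad v S G)).
- rewrite Pr_independent; congr (_ * _); apply: eq_bigr => v; rewrite inE => vS.
  by rewrite Pr_compl // Pr_bad.
- exact: depends_on_independent.
- by move=> v vS G; rewrite depends_on_bad.
Qed.

Section Bounds.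
Variables (k : nat) (a : R).
Hypothesis a1 : a <= 1.
Hypothesis aE : a = (1 + k%:R * p) * q ^+ k.-1.

Let a0 : 0 <= a.
Proof.
rewrite aE; apply: mulr_ge0; last exact: exprn_ge0.
by apply: addr_ge0 => //; apply: mulr_ge0.
Qed.

Lemma bad_prob_ge0 v S : 0 <= bad_prob v S.
Proof. by rewrite addr_ge0 ?exprn_ge0 // !mulr_ge0 ?exprn_ge0. Qed.

(** [a] is a bound free of labels: all k vertices of [S] are counted as larger than [v], and q^k is
    relaxed to q^(k-1) to share a factor. *)
Lemma bad_prob_le v S : #|S| = k -> bad_prob v S <= a.
Proof.
move=> cS; rewrite /bad_prob cS aE mulrDl mul1r; apply: lerD.
  by case: (k) => [|k'] //=; rewrite exprS ler_piMl ?exprn_ge0.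
rewrite -mulrA; apply: ler_wpM2r; first by rewrite mulr_ge0 ?exprn_ge0.
by rewrite ler_nat -cS subset_leq_card //; apply/subsetP => u; rewrite inE => /andP[].
Qed.

Lemma wt_ge0 S : #|S| = k -> 0 <= wt S.
Proof.
move=> cS; rewrite mulr_ge0 ?exprn_ge0 // prodr_ge0 // => v _.
by rewrite subr_ge0 (le_trans (bad_prob_le _ cS)).
Qed.

Lemma wt_ge S : #|S| = k -> q ^+ 'C(k, 2) * (1 - a) ^+ n <= wt S.
Proof.
move=> cS; rewrite /wt cS; apply: ler_wpM2l; first exact: exprn_ge0.
have -> : (1 - a) ^+ n = (1 - a) ^+ #|S| * \prod_(v in ~: S) (1 - a).
  by rewrite prodr_const -exprD cardsC card_ord.
apply: (@le_trans _ _ (\prod_(v in ~: S) (1 - a))).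
  apply: ler_piMl; first by apply: prodr_ge0 => v _; rewrite subr_ge0.
  by apply: exprn_ile1; rewrite ?subr_ge0 // gerBl.
apply: ler_prod => v _; rewrite subr_ge0 a1 /= lerD2l lerN2.
exact: bad_prob_le.
Qed.

(** Ignoring the vertices of U :\: S costs at most a factor 1 - a each. This makes room for a second
    set inside [U], whose edges to [S] are treated separately. *)
Lemma prod_fine_le S U : #|S| = k -> S \subset U ->
  (1 - a) ^+ #|U :\: S| * \prod_(v in ~: U) (1 - bad_prob v S) <=
  \prod_(v in ~: S) (1 - bad_prob v S).
Proof.
move=> cS SU.
have -> : \prod_(v in ~: S) (1 - bad_prob v S) =
    \prod_(v in U :\: S) (1 - bad_prob v S) * \prod_(v in ~: U) (1 - bad_prob v S).
  rewrite (bigID (fun v => v \in U)) /=; congr (_ * _); apply: eq_bigl => v; rewrite !inE //.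
  by case: (boolP (v \in U)) => [_|vU]; rewrite ?andbF // andbT;
     apply: contra vU => /(subsetP SU).
apply: ler_wpM2r.
  by apply: prodr_ge0 => v _; rewrite subr_ge0 (le_trans (bad_prob_le _ cS)).
rewrite -prodr_const.
apply: ler_prod => v _; rewrite subr_ge0 a1 /= lerD2l lerN2.
exact: bad_prob_le.
Qed.

(** For each of at most k n^2 triples (u, v1, v2), the factors 1 - bad_prob at v1 and v2 in [wt S],
    each at least 1 - a, are replaced by the probability p q^(k-1) that the vertex is lone at u. *)
Lemma Pr_weak_cherry S : #|S| = k ->
  (1 - a) ^+ 2 * Pr (fun G => weak S G && cherry S G) <=
  wt S * (k%:R * n%:R ^+ 2 * (p * q ^+ k.-1) ^+ 2).
Proof.
move=> cS.
pose D := [pred x : 'I_n * ('I_n * 'I_n) |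
  [&& x.1 \in S, x.2.1 \in ~: S, x.2.2 \in ~: S & x.2.1 != x.2.2]].
pose A (x : 'I_n * ('I_n * 'I_n)) v G :=
  if (v == x.2.1) || (v == x.2.2) then lone v x.1 S G else ~~ bad v S G.
pose E x G := independent G S && [forall v in ~: S, A x v G].
have PE x : x \in D -> (1 - a) ^+ 2 * Pr (E x) <= wt S * (p * q ^+ k.-1) ^+ 2.
  case: x => u [v1 v2]; rewrite !inE /= => /and4P[uS v1S v2S v12].
  rewrite Pr_star_family; first last.
  - move=> v vS; rewrite /A /=; case: (_ || _); first exact: depends_on_lone.
    by move=> G; rewrite depends_on_bad.
  - exact: depends_on_independent.
  have prodE (f : 'I_n -> R) : \prod_(v in ~: S) f v =
      f v1 * (f v2 * \prod_(v in ~: S | (v != v1) && (v != v2)) f v).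
    rewrite (bigD1 v1) ?inE //= (bigD1 v2) /=; last by rewrite inE v2S eq_sym.
    by congr (_ * (_ * _)); apply: eq_bigl => v; rewrite andbA.
  rewrite Pr_independent /wt !prodE.
  rewrite /A /= !eqxx orbT /= !Pr_lone // cS.
  set r1 := \prod_(_ | _) _; set r2 := \prod_(_ | _) _.
  have -> : r1 = r2.
    apply: eq_bigr => v; rewrite inE => /and3P[vS /negPf v1' /negPf v2'].
    rewrite -(Pr_bad vS) -Pr_compl //; apply: eq_Pr => G.
    by rewrite v1' v2'.
  have r20 : 0 <= r2.
    by apply: prodr_ge0 => v _; rewrite subr_ge0 (le_trans (bad_prob_le _ cS)).
  set t := p * q ^+ k.-1; set Q := q ^+ _.
  have -> : (1 - a) ^+ 2 * (Q * (t * (t * r2))) = (1 - a) ^+ 2 * (Q * r2 * t ^+ 2) by ring.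
  have -> : Q * ((1 - bad_prob v1 S) * ((1 - bad_prob v2 S) * r2)) * t ^+ 2 =
     ((1 - bad_prob v1 S) * (1 - bad_prob v2 S)) * (Q * r2 * t ^+ 2) by ring.
  apply: ler_wpM2r; first by rewrite !mulr_ge0 ?sqr_ge0 ?exprn_ge0.
  by rewrite expr2; apply: ler_pM; rewrite ?subr_ge0 // lerD2l lerN2 bad_prob_le.
have le1 : Pr (fun G => weak S G && cherry S G) <= \sum_(x in D) Pr (E x).
  apply: le_trans (Pr_exists p0 p1 D E); apply: le_Pr => // G.
  move=> /andP[/andP[iS /forall_inP wS] /exists_inP[u uS]].
  move=> /exists_inP[v1 v1S /exists_inP[v2 v2S /and3P[v12 l1 l2]]].
  apply/exists_inP; exists (u, (v1, v2)); first by rewrite inE /= uS v1S v2S.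
  rewrite /E iS /=; apply/forall_inP => v vS; rewrite /A /=.
  case: eqP => [->|_] //=; case: eqP => [->|_] //=; exact: wS.
apply: le_trans (_ : _ <= \sum_(x in D) (wt S * (p * q ^+ k.-1) ^+ 2)) _.
  apply: le_trans (ler_wpM2l (sqr_ge0 _) le1) _.
  by rewrite mulr_sumr; apply: ler_sum => x; exact: PE.
rewrite sumr_const -[X in X <= _]mulr_natl.
rewrite [X in _ <= X](_ : _ = k%:R * n%:R ^+ 2 * (wt S * (p * q ^+ k.-1) ^+ 2)); last by ring.
apply: ler_wpM2r; first by rewrite mulr_ge0 ?wt_ge0 // sqr_ge0.
rewrite -natrX -natrM ler_nat -cS.
have -> : (#|S| * n ^ 2 = #|setX S [set: 'I_n * 'I_n]|)%N.
  by rewrite cardsX cardsT card_prod card_ord mulnn.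
by apply: subset_leq_card; apply/subsetP => x; rewrite !inE => /and4P[->].
Qed.

End Bounds.
End EventProbabilities.

(** * Joint probabilities for two sets *)

Section PairProbabilities.
Variables (R : realType) (n : nat) (p : R).
Hypotheses (p0 : 0 <= p) (p1 : p <= 1).
Implicit Types (S T U : {set 'I_n}) (u v w : 'I_n) (G : graph n).
Let q := 1 - p.
Let q0 : 0 <= q. Proof. by rewrite subr_ge0. Qed.
Let q1 : q <= 1. Proof. by rewrite lerBlDr lerDl. Qed.
Local Notation Pr := (@gnp_prob R n p).

Lemma crossC n' (A B : {set 'I_n'}) : cross A B = cross B A.
Proof.
by apply/setP => e; apply/crossP/crossP => -[u [v [uA vB ->]]]; exists v, u; rewrite setUC.
Qed.

Lemma Pr_many_edges (F : {set edge n}) m :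
  Pr (fun G => (m <= #|F :&: G|)%N) <= 'C(#|F|, m)%:R * p ^+ m.
Proof.
pose D := [pred X : {set edge n} | (X \subset F) && (#|X| == m)].
apply: (@le_trans _ _ (\sum_(X in D) Pr (fun G => X \subset G))).
  apply: le_trans (Pr_exists p0 p1 D (fun X G => X \subset G)); apply: le_Pr => // G.
  move=> /card_geqP[s [us sm sF]]; apply/exists_inP; exists [set x in s].
    rewrite inE; apply/andP; split.
      by apply/subsetP => e; rewrite inE => /sF; rewrite inE => /andP[].
    by rewrite cardsE (card_uniqP us) sm.
  by apply/subsetP => e; rewrite inE => /sF; rewrite inE => /andP[].
rewrite (eq_bigr (fun _ => p ^+ m)) => [|X /andP[_ /eqP <-]]; last by rewrite Pr_contain.
rewrite sumr_const -[X in X <= _]mulr_natl -cards_draws.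
by apply: ler_wpM2r; rewrite ?exprn_ge0 // ler_nat subset_leq_card //;
  apply/subsetP => X; rewrite !inE.
Qed.

Lemma card_innerU S T : #|S| = #|T| ->
  #|inner S :|: inner T| =
  ('C(#|S|, 2) + ('C(#|S|, 2) - 'C(#|S :&: T|, 2)))%N.
Proof.
move=> cST; rewrite cardsU -inner_setI !card_inner -cST addnBA //.
by rewrite leq_bin2l // subset_leq_card // subsetIl.
Qed.

Lemma disjoint_innerU_cross S T :
  [disjoint inner S :|: inner T & cross (S :\: T) (T :\: S)].
Proof.
have dD (A B : {set 'I_n}) : [disjoint A :\: B & B].
  by rewrite -setI_eq0; apply/eqP/setP => u; rewrite !inE; case: (u \in B); rewrite ?andbF.
rewrite -setI_eq0 setIUl setU_eq0 !setI_eq0 crossC disjoint_inner_cross //=.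
by rewrite crossC disjoint_inner_cross.
Qed.

Section Bounds.
Variables (k : nat) (a : R).
Hypothesis aE : a = (1 + k%:R * p) * q ^+ k.-1.

(** Of [weak S] only the independence of [S] and the conditions at vertices outside S :|: T are
    kept, and the former together with the independence of [T] and [H] concerns disjoint edge sets.
    The conditions dropped at T :\: S account for (1 - a)^k. *)
Lemma Pr_weak_pair_far S T (H : pred (graph n)) : a <= 1 ->
  #|S| = k -> #|T| = k ->
  depends_on (cross (S :\: T) (T :\: S)) H ->
  (1 - a) ^+ k * Pr (fun G => [&& weak S G, independent G T & H G]) <=
  wt p S * (q ^+ ('C(k, 2) - 'C(#|S :&: T|, 2)) * Pr H).
Proof.
move=> a1 cS cT dH.
pose U := S :|: T.
have SU : S \subset U by exact: subsetUl.
have TU : T \subset U by exact: subsetUr.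
pose A0 G := [disjoint inner S :|: inner T & G] && H G.
have le1 : Pr (fun G => [&& weak S G, independent G T & H G]) <=
    Pr (fun G => A0 G && [forall v in ~: U, ~~ bad v S G]).
  apply: le_Pr => // G /and3P[/andP[iS /forall_inP wS] iT HG].
  rewrite /A0 HG andbT -setI_eq0 setIUl setU_eq0 !setI_eq0 -!independentE iS iT /=.
  apply/forall_inP => v; rewrite !inE negb_or => /andP[vS _]; apply: wS; by rewrite inE.
have PA0 : Pr A0 = q ^+ 'C(k, 2) * (q ^+ ('C(k, 2) - 'C(#|S :&: T|, 2)) * Pr H).
  rewrite /A0 (Pr_indep p (F := inner S :|: inner T) (F' := cross (S :\: T) (T :\: S))) //.
  - by rewrite Pr_avoid // card_innerU ?cS // exprD mulrA.
  - exact: disjoint_innerU_cross.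
  - exact: depends_on_avoid.
have dA0 : depends_on (inner U) A0.
  apply: depends_on_and.
    apply: depends_on_avoid; apply/subsetP => e; rewrite !inE.
    by move=> /orP[] /subset_trans; apply.
  apply: sub_depends_on dH; apply: (subset_trans (cross_inner _ _)).
  apply/subsetP => e; rewrite !inE => /subset_trans; apply.
  by rewrite subUset; apply/andP; split; apply: (subset_trans (subsetDl _ _)).
rewrite (Pr_star_family p (A := fun v G => ~~ bad v S G)) // in le1; last first.
  by move=> v vU G; rewrite depends_on_bad.
rewrite (eq_bigr (fun v => 1 - bad_prob p v S)) in le1; last first.
  move=> v; rewrite !inE negb_or => /andP[vS _].
  by rewrite Pr_compl // Pr_bad.
rewrite PA0 in le1.
have Q0 : 0 <= 1 - a by rewrite subr_ge0.
apply: le_trans (ler_wpM2l (exprn_ge0 _ Q0) le1) _.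
have := prod_fine_le p0 p1 a1 aE cS SU.
set P1 := \prod_(_ in _) _; set P2 := \prod_(_ in _) _; move=> leP.
set C := q ^+ ('C(k, 2) - _) * _.
have C0 : 0 <= q ^+ 'C(k, 2) * C by rewrite /C !mulr_ge0 ?exprn_ge0 ?Pr_ge0.
rewrite /wt cS -/P2.
rewrite [X in X <= _](_ : _ = ((1 - a) ^+ k * P1) * (q ^+ 'C(k, 2) * C)); last by ring.
rewrite [X in _ <= X](_ : _ = P2 * (q ^+ 'C(k, 2) * C)); last by ring.
apply: ler_wpM2r => //; apply: le_trans leP; apply: ler_wpM2r.
  apply: prodr_ge0 => v _; rewrite subr_ge0 (le_trans _ a1) //.
  exact: (bad_prob_le _ _ aE).
apply: ler_wiXn2l => //.
  by rewrite gerBl aE mulr_ge0 ?exprn_ge0 // addr_ge0 // mulr_ge0.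
by rewrite setDUl setDv set0U -cT subset_leq_card // subsetDl.
Qed.

(** Here [H] asks for [m] edges between the two differences. The slack [+ 1] admits the rounded-up
    value of 3j/2: 2m <= 3j + 1 and 3j <= 2y force m <= y for integers. *)
Lemma Pr_strong_pair S T m : a <= 1 -> #|S| = k -> #|T| = k ->
  (2 * m <= 3 * #|S :\: T| + 1)%N ->
  (1 - a) ^+ k * Pr (fun G => strong S G && strong T G) <=
  wt p S * (q ^+ ('C(k, 2) - 'C(#|S :&: T|, 2)) * ('C(#|S :\: T| ^ 2, m)%:R * p ^+ m)).
Proof.
move=> a1 cS cT mj.
pose H G := (m <= #|cross (S :\: T) (T :\: S) :&: G|)%N.
have dH : depends_on (cross (S :\: T) (T :\: S)) H.
  by move=> G; rewrite /H [G :&: _]setIC setIA setIid.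
have cD : #|T :\: S| = #|S :\: T|.
  by have := cardsID S T; have := cardsID T S; rewrite setIC; lia.
have dD : [disjoint S :\: T & T :\: S].
  by rewrite -setI_eq0; apply/eqP/setP => u; rewrite !inE; case: (u \in S); rewrite ?andbF.
have := Pr_many_edges (cross (S :\: T) (T :\: S)) m.
rewrite card_cross // cD mulnn => PH.
have : Pr (fun G => strong S G && strong T G) <=
    Pr (fun G => [&& weak S G, independent G T & H G]).
  apply: le_Pr => // G /andP[sS sT].
  have := strong_pair_cross (etrans cS (esym cT)) sS sT.
  move: sS sT => /andP[-> _] /andP[/andP[-> _] _] /=; rewrite /H.
  move: mj; set x := #|S :\: T|; set y := #|_ :&: G|; move: x y => x y; lia.
have Q0 : 0 <= 1 - a by rewrite subr_ge0.
move=> /(ler_wpM2l (exprn_ge0 k Q0)) /le_trans; apply.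
apply: le_trans (Pr_weak_pair_far a1 cS cT dH) _.
apply: ler_wpM2l; first exact: (wt_ge0 p0 p1 a1 aE cS).
by apply: ler_wpM2l => //; exact: exprn_ge0.
Qed.

(** A vertex bad for [T] has at most one neighbour in B = T :\: S, whatever the labels. This weaker
    event [X] uses edges disjoint from those deciding [bad v S]. *)
Lemma Pr_bad_pair v S T : v \notin S :|: T -> #|S| = k -> #|T| = k ->
  Pr (fun G => bad v S G && bad v T G) <=
  bad_prob p v S * ((1 + k%:R * p) * q ^+ (k - #|S :&: T|).-1).
Proof.
rewrite inE negb_or => /andP[vS vT] cS cT.
pose B := T :\: S.
have cB : #|B| = (k - #|S :&: T|)%N by rewrite cardsD cT setIC.
have vB : v \notin B by rewrite inE (negPf vT) andbF.
have BT : B \subset T by exact: subsetDl.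
pose X G := [disjoint cross [set v] B & G] || [exists u in B, lone v u B G].
have badX G : bad v T G -> X G.
  rewrite /X => /orP[dG|/exists_inP[u uT /andP[_ /(loneP G uT vT)[vu uniq_u]]]].
    by apply/orP; left; apply: disjointWl dG; exact: subset_cross.
  case: (boolP (u \in B)) => uB; apply/orP; [right|left].
    apply/exists_inP; exists u => //; apply/loneP => //; split=> // w wB vw.
    by apply: uniq_u => //; exact: (subsetP BT).
  apply/disjoint_crossP => _ w /set1P -> wB; apply: contra uB => vw.
  by rewrite -(uniq_u w _ vw) // (subsetP BT).
apply: (@le_trans _ _ (Pr (fun G => bad v S G && X G))).
  by apply: le_Pr => // G /andP[-> /badX].
rewrite (Pr_indep p (F := cross [set v] S) (F' := cross [set v] B)); first last.
- move=> G; rewrite /X (depends_on_avoid (subxx _)); congr (_ || _).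
  apply: eq_existsb => u; case: (boolP (u \in B)) => //= uB.
  exact: (@depends_on_lone _ v u B B).
- exact: depends_on_bad.
- apply: disjoint_star => //; rewrite -setI_eq0; apply/eqP/setP => u.
  by rewrite !inE; case: (u \in S).
rewrite Pr_bad //; apply: ler_wpM2l; first exact: bad_prob_ge0.
apply: le_trans (Pr_or p0 p1 _ _) _.
rewrite Pr_avoid // card_star // mulrDl mul1r cB; apply: lerD.
  by case: (k - _)%N => [|k'] //=; rewrite exprS ler_piMl ?exprn_ge0.
apply: le_trans (Pr_exists p0 p1 _ _) _.
rewrite (eq_bigr (fun _ => p * q ^+ (k - #|S :&: T|).-1)); last first.
  by move=> u uB; rewrite Pr_lone // cB.
rewrite sumr_const -[X in X <= _]mulr_natl -mulrA; apply: ler_wpM2r.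
  by rewrite mulr_ge0 ?exprn_ge0.
by rewrite ler_nat cB leq_subr.
Qed.

(** Three corrections separate the joint law from the product: the pairs inside S :&: T, counted
    twice in the product, give q^C(i,2); the outside vertices lying in the other set give (1 -
    a)^(2k); the correlation of badness at the remaining vertices gives (1 + 4ac)^n. *)
Lemma Pr_weak_pair_near_indep S T c : a <= 1 / 2 -> #|S| = k -> #|T| = k ->
  c = (1 + k%:R * p) * q ^+ (k - #|S :&: T|).-1 ->
  (1 - a) ^+ (2 * k) * Pr (fun G => weak S G && weak T G) * q ^+ 'C(#|S :&: T|, 2) <=
  wt p S * wt p T * (1 + 4 * a * c) ^+ n.
Proof.
move=> a2 cS cT cE.
have a1 : a <= 1 by lra.
have a0 : 0 <= a by rewrite aE mulr_ge0 ?exprn_ge0 // addr_ge0 // mulr_ge0.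
have c0 : 0 <= c by rewrite cE mulr_ge0 ?exprn_ge0 // addr_ge0 // mulr_ge0.
pose U := S :|: T.
have SU : S \subset U by exact: subsetUl.
have TU : T \subset U by exact: subsetUr.
pose A0 G := [disjoint inner S :|: inner T & G].
have le1 : Pr (fun G => weak S G && weak T G) <=
    Pr (fun G => A0 G && [forall v in ~: U, ~~ bad v S G && ~~ bad v T G]).
  apply: le_Pr => // G /andP[/andP[iS /forall_inP wS] /andP[iT /forall_inP wT]].
  rewrite /A0 -setI_eq0 setIUl setU_eq0 !setI_eq0 -!independentE iS iT /=.
  apply/forall_inP => v; rewrite !inE negb_or => /andP[vS vT].
  by rewrite wS ?inE // wT ?inE.
rewrite (Pr_star_family p (A := fun v G => ~~ bad v S G && ~~ bad v T G)) in le1; first last.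
- by move=> v vU G; rewrite !depends_on_bad.
- apply: depends_on_avoid; apply/subsetP => e; rewrite !inE.
  by move=> /orP[] /subset_trans; apply.
have fine v : v \in ~: U -> Pr (fun G => ~~ bad v S G && ~~ bad v T G) <=
    (1 - bad_prob p v S) * (1 - bad_prob p v T) * (1 + 4 * a * c).
  rewrite in_setC => vU; have := vU; rewrite inE negb_or => /andP[vS vT].
  have -> : Pr (fun G => ~~ bad v S G && ~~ bad v T G) =
      1 - bad_prob p v S - bad_prob p v T + Pr (fun G => bad v S G && bad v T G).
    rewrite -(Pr_bad p vS) -(Pr_bad p vT) -(Pr_true n p) !Pr_sumE -!sumrB -big_split /=.
    by apply: eq_bigr => G _; case: (bad v S G); case: (bad v T G) => /=; ring.
  have := Pr_bad_pair vU cS cT; rewrite -cE.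
  have := bad_prob_le p0 p1 aE v cS; have := bad_prob_le p0 p1 aE v cT.
  have := bad_prob_ge0 p0 p1 v S; have := bad_prob_ge0 p0 p1 v T.
  set x := bad_prob p v S; set y := bad_prob p v T; set z := Pr _.
  move=> y0 x0 ya xa zx.
  have zac : z <= a * c by apply: le_trans zx _; exact: ler_wpM2r.
  have ac0 : 0 <= a * c by exact: mulr_ge0.
  (* Since 1 - x - y + z = (1 - x)(1 - y) - xy + z with z <= ac, this lower bound absorbs z into the
     factor 1 + 4ac. *)
  have xy : 1 / 4 <= (1 - x) * (1 - y).
    have -> : 1 / 4 = (1 / 2) * (1 / 2) :> R by field.
    by apply: ler_pM => //; lra.
  have : 1 / 4 * (4 * a * c) <= (1 - x) * (1 - y) * (4 * a * c).
    by apply: ler_wpM2r => //; rewrite -mulrA mulr_ge0.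
  have := mulr_ge0 x0 y0.
  move: xy; set s := (1 - x) * (1 - y) => xy xy0 h.
  have sE : s = 1 - x - y + x * y by rewrite /s; ring.
  rewrite mulrDr mulr1; lra.
have PA0 : Pr A0 * q ^+ 'C(#|S :&: T|, 2) = q ^+ 'C(k, 2) * q ^+ 'C(k, 2).
  rewrite Pr_avoid // card_innerU ?cS // -!exprD; congr (_ ^+ _).
  by rewrite -addnA subnK // -cS leq_bin2l // subset_leq_card // subsetIl.
have A00 : 0 <= Pr A0 by exact: Pr_ge0.
set PS := \prod_(v in ~: U) (1 - bad_prob p v S).
set PT := \prod_(v in ~: U) (1 - bad_prob p v T).
have x1 v (X : {set 'I_n}) : #|X| = k -> 0 <= 1 - bad_prob p v X.
  by move=> cX; rewrite subr_ge0 (le_trans (bad_prob_le p0 p1 aE v cX)).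
have PS0 : 0 <= PS by apply: prodr_ge0 => v _; exact: x1.
have PT0 : 0 <= PT by apply: prodr_ge0 => v _; exact: x1.
have ac1 : 1 <= 1 + 4 * a * c by rewrite lerDl -mulrA mulr_ge0 // mulr_ge0.
have leprod : \prod_(v in ~: U) Pr (fun G => ~~ bad v S G && ~~ bad v T G) <=
    PS * PT * (1 + 4 * a * c) ^+ n.
  apply: (@le_trans _ _ (PS * PT * (1 + 4 * a * c) ^+ #|~: U|)).
    rewrite -prodr_const -!big_split /=; apply: ler_prod => v vU.
    by rewrite Pr_ge0 ?fine.
  apply: ler_wpM2l; first exact: mulr_ge0.
  by apply: ler_weXn2l => //; rewrite -[X in (_ <= X)%N]card_ord max_card.
have hS : (1 - a) ^+ k * PS <= \prod_(v in ~: S) (1 - bad_prob p v S).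
  apply: le_trans (prod_fine_le p0 p1 a1 aE cS SU); apply: ler_wpM2r => //.
  apply: ler_wiXn2l; [lra|lra|].
  by rewrite setDUl setDv set0U -cT subset_leq_card // subsetDl.
have hT : (1 - a) ^+ k * PT <= \prod_(v in ~: T) (1 - bad_prob p v T).
  apply: le_trans (prod_fine_le p0 p1 a1 aE cT TU); apply: ler_wpM2r => //.
  apply: ler_wiXn2l; [lra|lra|].
  by rewrite setDUl setDv setU0 -cS subset_leq_card // subsetDl.
have a10 m : 0 <= (1 - a) ^+ m by apply: exprn_ge0; rewrite subr_ge0.
set E := (1 + 4 * a * c) ^+ n in leprod *.
have E0 : 0 <= E by apply: exprn_ge0; lra.
apply: (@le_trans _ _ ((1 - a) ^+ (2 * k) * (Pr A0 * (PS * PT * E)) *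
    q ^+ 'C(#|S :&: T|, 2))).
  apply: ler_wpM2r; first exact: exprn_ge0.
  apply: ler_wpM2l => //; apply: le_trans le1 _; exact: ler_wpM2l.
have -> : (1 - a) ^+ (2 * k) * (Pr A0 * (PS * PT * E)) * q ^+ 'C(#|S :&: T|, 2) =
    ((1 - a) ^+ k * PS) * ((1 - a) ^+ k * PT) * (q ^+ 'C(k, 2) * q ^+ 'C(k, 2) * E).
  by rewrite mul2n -addnn exprD -PA0; ring.
rewrite /wt cS cT.
set WS := \prod_(v in ~: S) _; set WT := \prod_(v in ~: T) _.
have -> : q ^+ 'C(k, 2) * WS * (q ^+ 'C(k, 2) * WT) * E =
  WS * WT * (q ^+ 'C(k, 2) * q ^+ 'C(k, 2) * E) by ring.
apply: ler_wpM2r; first by rewrite mulr_ge0 // mulr_ge0 // exprn_ge0.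
by apply: ler_pM => //; rewrite mulr_ge0.
Qed.

End Bounds.
End PairProbabilities.

(** * Moments *)

Section Moments.
Variables (R : realType) (n : nat) (p : R).
Hypotheses (p0 : 0 <= p) (p1 : p <= 1).
Implicit Types (S T U : {set 'I_n}) (u v w : 'I_n) (G : graph n).
Let q := 1 - p.
Let q0 : 0 <= q. Proof. by rewrite subr_ge0. Qed.
Let q1 : q <= 1. Proof. by rewrite lerBlDr lerDl. Qed.
Local Notation Pr := (@gnp_prob R n p).

Definition wt_sum k : R := \sum_(S : {set 'I_n} | #|S| == k) wt p S.

(** Adding [u] costs q^(k+1) for independence and removes the factor of [u], at least 1 - a. Every
    other outside vertex satisfies bad_prob v S >= q * bad_prob v T, so its factor grows by at most
    1 + 2pa. *)
Lemma wt_add u T k a : #|T| = k.+1 -> u \notin T ->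
  a = (1 + k.+1%:R * p) * q ^+ k -> a <= 1 / 2 ->
  (1 - a) * wt p (u |: T) <= q ^+ k.+1 * (1 + 2 * p * a) ^+ n * wt p T.
Proof.
move=> cT uT aE a2.
have a1 : a <= 1 by lra.
have a0 : 0 <= a by rewrite aE mulr_ge0 ?exprn_ge0 // addr_ge0 // mulr_ge0.
pose S := u |: T; have TS : T \subset S by exact: subsetUr.
have cS : #|S| = k.+2 by rewrite cardsU1 uT cT.
have ba v : bad_prob p v T <= a by exact: (bad_prob_le p0 p1 aE).
have fine v : 1 - bad_prob p v S <= (1 - bad_prob p v T) * (1 + 2 * p * a).
  have b0 := bad_prob_ge0 p0 p1 v T.
  have : q * bad_prob p v T <= bad_prob p v S.
    rewrite /bad_prob cS cT /= !exprS.
    set mT := #|_|; set mS := #|_|; set t := q ^+ k.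
    have mm : mT%:R <= mS%:R :> R.
      rewrite ler_nat subset_leq_card //; apply/subsetP => w; rewrite !inE.
      by move=> /andP[-> ->]; rewrite orbT.
    rewrite -subr_ge0.
    have -> : q * (q * t) + mS%:R * (p * (q * t)) - q * (q * t + mT%:R * (p * t)) =
      (mS%:R - mT%:R) * (p * (q * t)) by ring.
    by rewrite mulr_ge0 ?subr_ge0 // mulr_ge0 // mulr_ge0 // exprn_ge0.
  move: (ba v) b0; set b := bad_prob p v T; set b' := bad_prob p v S => ba' b0 qb.
  have h1 : p * b <= p * a by exact: ler_wpM2l.
  have h2 : p * a * (1 / 2) <= p * a * (1 - b) by apply: ler_wpM2l; [exact: mulr_ge0|lra].
  have h3 : q * b = b - p * b by rewrite /q; ring.
  have -> : (1 - b) * (1 + 2 * p * a) = 1 - b + 2 * (p * a * (1 - b)) by ring.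
  lra.
have := prod_fine_le p0 p1 a1 (aE : a = (1 + k.+1%:R * p) * q ^+ k.+1.-1) cT TS.
have -> : #|S :\: T| = 1%N by rewrite cardsD (setIidPr TS) cS cT subSnn.
rewrite /wt -/S cS cT expr1; set P1 := \prod_(_ in _) _; set P2 := \prod_(_ in ~: T) _.
set P3 := \prod_(_ in _) _ => leP.
have x1 v : 0 <= 1 - bad_prob p v T by rewrite subr_ge0 (le_trans (ba v)).
set E := 1 + 2 * p * a.
have E1 : 1 <= E by rewrite lerDl -mulrA mulr_ge0 // mulr_ge0.
have leP31 : P3 <= P1 * E ^+ n.
  apply: (@le_trans _ _ (P1 * E ^+ #|~: S|)).
    rewrite -prodr_const -big_split /=; apply: ler_prod => v; rewrite in_setC => vS.
    by rewrite fine andbT subr_ge0 -Pr_bad // Pr_le1.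
  apply: ler_wpM2l; first by apply: prodr_ge0.
  by apply: ler_weXn2l => //; rewrite -[X in (_ <= X)%N]card_ord max_card.
have -> : 'C(k.+2, 2) = (k.+1 + 'C(k.+1, 2))%N by rewrite binS bin1 addnC.
rewrite exprD.
apply: (@le_trans _ _ ((1 - a) * (q ^+ k.+1 * q ^+ 'C(k.+1, 2) * (P1 * E ^+ n)))).
  apply: ler_wpM2l; first by rewrite subr_ge0.
  by apply: ler_wpM2l => //; rewrite mulr_ge0 ?exprn_ge0.
have -> : (1 - a) * (q ^+ k.+1 * q ^+ 'C(k.+1, 2) * (P1 * E ^+ n)) =
   ((1 - a) * P1) * (q ^+ k.+1 * q ^+ 'C(k.+1, 2) * E ^+ n) by ring.
have -> : q ^+ k.+1 * E ^+ n * (q ^+ 'C(k.+1, 2) * P2) =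
   P2 * (q ^+ k.+1 * q ^+ 'C(k.+1, 2) * E ^+ n) by ring.
apply: ler_wpM2r => //.
rewrite mulr_ge0 ?exprn_ge0 ?mulr_ge0 ?exprn_ge0 //; exact: le_trans E1.
Qed.

(** Double counting of the pairs (u, S) with u in S and |S| = k + 2, rewritten as pairs (u, T) with
    T = S :\ u. *)
Lemma wt_sum_ratio k a : a = (1 + k.+1%:R * p) * q ^+ k -> a <= 1 / 2 ->
  k.+2%:R * ((1 - a) * wt_sum k.+2) <=
  n%:R * (q ^+ k.+1 * (1 + 2 * p * a) ^+ n * wt_sum k.+1).
Proof.
move=> aE a2; set r := q ^+ k.+1 * _.
have a1 : a <= 1 by lra.
have -> : k.+2%:R * ((1 - a) * wt_sum k.+2) =
    \sum_(S : {set 'I_n} | #|S| == k.+2) \sum_(u in S) ((1 - a) * wt p S).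
  rewrite /wt_sum !mulr_sumr; apply: eq_bigr => S /eqP cS.
  by rewrite sumr_const cS mulr_natl.
rewrite (exchange_big_dep xpredT) //=.
have -> : n%:R * (r * wt_sum k.+1) = \sum_(u : 'I_n) (r * wt_sum k.+1).
  by rewrite sumr_const card_ord mulr_natl.
apply: ler_sum => u _.
rewrite (reindex_onto (fun T => u |: T) (fun S => S :\ u)) /=; last first.
  by move=> S /andP[_ uS]; rewrite setD1K.
rewrite /wt_sum mulr_sumr [X in _ <= X](bigID (fun T => u \notin T)) /=.
rewrite -[X in X <= _]addr0; apply: lerD; last first.
  apply: sumr_ge0 => T /andP[/eqP cT _].
  apply: mulr_ge0; last exact: (wt_ge0 p0 p1 a1 aE).
  apply: mulr_ge0; first exact: exprn_ge0.
  apply: exprn_ge0; rewrite addr_ge0 // !mulr_ge0 // aE mulr_ge0 ?exprn_ge0 //.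
  by rewrite addr_ge0 // mulr_ge0.
rewrite (eq_bigl (fun T : {set 'I_n} => (#|T| == k.+1) && (u \notin T))).
  apply: ler_sum => T /andP[/eqP cT uT]; exact: (wt_add cT uT aE a2).
move=> T; rewrite !inE eqxx /= andbT; case: (boolP (u \in T)) => uT /=.
  rewrite andbF; apply/negbTE; rewrite negb_and; apply/orP; right.
  by apply: contraTneq uT => <-; rewrite !inE eqxx.
by rewrite setU1K // eqxx cardsU1 uT !andbT eqSS.
Qed.

(** [T] is determined by S :&: T and T :\: S; that the latter avoids [S] is forgotten, whence n
    rather than n - |S|. *)
Lemma card_meeting S k i :
  (#|[set T : {set 'I_n} | (#|T| == k) && (#|S :&: T| == i)]| <=
   'C(#|S|, i) * 'C(n, k - i))%N.
Proof.
pose f T := (S :&: T, T :\: S).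
have finj : {in [set T : {set 'I_n} | (#|T| == k) && (#|S :&: T| == i)] &, injective f}.
  by move=> T T' _ _ [e1 e2]; rewrite -(setID T S) -(setID T' S) setIC e1 e2 setIC.
rewrite -(card_in_imset finj) -cards_draws -[in X in (_ <= _ * X)%N](card_ord n) -card_draws.
rewrite -cardsX; apply: subset_leq_card; apply/subsetP => _ /imsetP[T + ->].
rewrite !inE /= subsetIl => /andP[/eqP cT /eqP cST] /=.
by rewrite cST eqxx /= cardsD setIC cT cST.
Qed.

Lemma wt_sum_ge k a : a <= 1 -> a = (1 + k%:R * p) * q ^+ k.-1 ->
  'C(n, k)%:R * (q ^+ 'C(k, 2) * (1 - a) ^+ n) <= wt_sum k.
Proof.
move=> a1 aE; rewrite -[n in 'C(n, _)]card_ord -card_draws mulr_natl -sumr_const.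
rewrite (eq_bigl (fun S : {set 'I_n} => #|S| == k)) => [|S]; last by rewrite inE.
by apply: ler_sum => S /eqP cS; exact: (wt_ge p0 p1 a1 aE).
Qed.

Lemma Pr_indep_number_eq k : Pr (fun G => indep_number G == k) <= wt_sum k.
Proof.
pose D := [pred S : {set 'I_n} | #|S| == k].
rewrite /wt_sum (eq_bigr (fun S => Pr (weak S))) => [|S _]; last by rewrite Pr_weak.
apply: le_trans (Pr_exists p0 p1 D _); apply: le_Pr => // G /eqP aG.
have [S cS wS] := weak_exists G.
by apply/exists_inP; exists S; rewrite // inE cS aG.
Qed.

Lemma independentS G S T : S \subset T -> independent G T -> independent G S.
Proof.
move=> /subsetP ST /independentP iT; apply/independentP => u v uS vS.
by apply: iT; exact: ST.
Qed.

Lemma indep_number_geP G k :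
  reflect (exists2 S : {set 'I_n}, #|S| = k & independent G S) (k <= indep_number G)%N.
Proof.
apply: (iffP idP) => [|[S <- iS]]; last exact: (leq_bigmax_cond (F := fun S : {set 'I_n} => #|S|)).
have [S cS /andP[iS _]] := weak_exists G; rewrite -cS => /card_geqP[s [us sk sS]].
exists [set x in s]; first by rewrite cardsE (card_uniqP us).
by apply: independentS iS; apply/subsetP => x; rewrite inE => /sS.
Qed.

Lemma Pr_indep_number_ge k :
  Pr (fun G => (k <= indep_number G)%N) <= 'C(n, k)%:R * q ^+ 'C(k, 2).
Proof.
pose D := [pred S : {set 'I_n} | #|S| == k].
have -> : 'C(n, k)%:R * q ^+ 'C(k, 2) = \sum_(S in D) Pr (fun G => independent G S).
  rewrite (eq_bigr (fun _ => q ^+ 'C(k, 2))); last first.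
    by move=> S /eqP cS; rewrite Pr_independent cS.
  rewrite sumr_const -[RHS]mulr_natl -[n in 'C(n, _)]card_ord -card_draws; congr (_%:R * _).
  by apply: eq_card => S; rewrite !inE.
apply: le_trans (Pr_exists p0 p1 D _); apply: le_Pr => // G /indep_number_geP[S cS iS].
by apply/exists_inP; exists S; rewrite // inE cS.
Qed.

Lemma Pr_two_values_ge f :
  1 <= Pr (fun G => (f <= indep_number G <= f.+1)%N) +
    (Pr (fun G => (indep_number G < f)%N) + Pr (fun G => (f.+2 <= indep_number G)%N)).
Proof.
rewrite -(Pr_true n p); apply: le_trans (lerD (lexx _) (Pr_or p0 p1 _ _)).
apply: le_trans (Pr_or p0 p1 _ _); apply: le_Pr => // G _.
by case: (ltnP (indep_number G) f) => h; rewrite ?orbT //=; case: (leqP (indep_number G) f.+1).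
Qed.

End Moments.

(** * Second moment method over sets of a fixed size *)

Section SecondMoment.
Variables (R : realType) (n : nat) (p : R).
Hypotheses (p0 : 0 <= p) (p1 : p <= 1).
Implicit Types (S T U : {set 'I_n}) (u v w : 'I_n) (G : graph n).
Let q := 1 - p.
Let q0 : 0 <= q. Proof. by rewrite subr_ge0. Qed.
Local Notation Pr := (@gnp_prob R n p).

Lemma Pr_second_moment_sized (A : {set 'I_n} -> pred (graph n)) k :
  Pr (fun G => ~~ [exists S : {set 'I_n}, (#|S| == k) && A S G]) *
    (\sum_(S : {set 'I_n} | #|S| == k) Pr (A S)) ^+ 2 <=
  \sum_(S : {set 'I_n} | #|S| == k) \sum_(T : {set 'I_n} | #|T| == k)
    Pr (fun G => A S G && A T G)
  - (\sum_(S : {set 'I_n} | #|S| == k) Pr (A S)) ^+ 2.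
Proof.
have Pr0 (B : pred (graph n)) : B =1 pred0 -> Pr B = 0.
  by move=> B0; rewrite (eq_Pr p B0) /gnp_prob big_pred0.
have := Pr_second_moment p0 p1 (fun (S : {set 'I_n}) G => (#|S| == k) && A S G).
have -> : \sum_(S : {set 'I_n}) Pr (fun G => (#|S| == k) && A S G) =
    \sum_(S : {set 'I_n} | #|S| == k) Pr (A S).
  rewrite [RHS]big_mkcond; apply: eq_bigr => S _.
  by case: (#|S| == k) => //=; rewrite Pr0.
congr (_ <= _ - _); rewrite [RHS]big_mkcond; apply: eq_bigr => S _.
case: (#|S| == k) => /=; last by rewrite big1 // => T _; rewrite Pr0.
rewrite [RHS]big_mkcond; apply: eq_bigr => T _.
by case: (#|T| == k) => //=; rewrite Pr0 // => G; rewrite andbF.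
Qed.

Lemma sum_by_meeting (f : nat -> R) (D : pred nat) S k : #|S| = k ->
  (forall i, 0 <= f i) ->
  \sum_(T : {set 'I_n} | (#|T| == k) && D #|S :&: T|) f #|S :&: T| <=
  \sum_(i < k.+1 | D i) 'C(k, i)%:R * 'C(n, k - i)%:R * f i.
Proof.
move=> cS f0.
rewrite (partition_big (fun T => inord #|S :&: T| : 'I_k.+1) (fun i : 'I_k.+1 => D i)) /=.
  apply: ler_sum => i Di.
  have iE T : (inord #|S :&: T| == i) = (#|S :&: T| == i).
    by rewrite -val_eqE /= inordK // ltnS -cS subset_leq_card // subsetIl.
  rewrite (eq_bigl (fun T => T \in [set T : {set 'I_n} | (#|T| == k) && (#|S :&: T| == i)])).
    rewrite (eq_bigr (fun _ => f i)); last by move=> T; rewrite inE => /andP[_ /eqP ->].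
    rewrite sumr_const -[X in X <= _]mulr_natl -natrM ler_wpM2r // ler_nat.
    by have := card_meeting S k i; rewrite cS.
  move=> T; rewrite inE iE; case: (#|T| == k) => //=.
  by case: eqP => [->|]; rewrite ?Di ?andbF.
by move=> T /andP[_ DT]; rewrite inordK // ltnS -cS subset_leq_card // subsetIl.
Qed.

(** Chebyshev for the number of strong k-sets. [D] selects the intersection sizes at which pairs are
    nearly independent; [b] bounds the conditional cost of the others, and the 4 in the last
    hypothesis leaves room for sets close to [S], including [S] itself. The cherry hypothesis makes
    the mean at least (1 - d) M. *)
Lemma Pr_indep_number_lt k a d (D : pred nat) (b : nat -> R) :
  a = (1 + k%:R * p) * q ^+ k.-1 -> a <= 1 / 2 -> 0 <= d -> d <= 1 / 4 ->
  0 < wt_sum n p k -> (forall i, 0 <= b i) ->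
  k%:R * n%:R ^+ 2 * (p * q ^+ k.-1) ^+ 2 <= d * (1 - a) ^+ 2 ->
  (forall S T, #|S| = k -> #|T| = k -> D #|S :&: T| ->
     Pr (fun G => weak S G && weak T G) <= (1 + d) * (wt p S * wt p T)) ->
  (forall S T, #|S| = k -> #|T| = k -> ~~ D #|S :&: T| ->
     Pr (fun G => strong S G && strong T G) <= wt p S * b #|S :&: T|) ->
  \sum_(i < k.+1 | ~~ D i) 'C(k, i)%:R * 'C(n, k - i)%:R * b i <=
    4 + d * wt_sum n p k ->
  Pr (fun G => (indep_number G < k)%N) <= 8 * d + 8 / wt_sum n p k.
Proof.
move=> aE a2 d0 d4 M0 b0 hcherry hclose hfar hsum.
set M := wt_sum n p k in M0 hsum *.
have a1 : a <= 1 by lra.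
have w0 S : #|S| = k -> 0 <= wt p S by move=> cS; exact: (wt_ge0 p0 p1 a1 aE cS).
pose mu := \sum_(S : {set 'I_n} | #|S| == k) Pr (strong S).
have Ps S : #|S| = k -> (1 - d) * wt p S <= Pr (strong S).
  move=> cS; have := Pr_weak_cherry p0 p1 a1 aE cS.
  have -> : Pr (strong S) = wt p S - Pr (fun G => weak S G && cherry S G).
    rewrite -Pr_weak // !Pr_sumE -sumrB; apply: eq_bigr => G _; rewrite -mulrBl.
    congr (_ * _); rewrite /strong.
    by case: (weak S G); case: (cherry S G); rewrite ?subrr ?subr0.
  move=> /le_trans/(_ (ler_wpM2l (w0 S cS) hcherry)).
  set x := Pr _; rewrite mulrCA mulrA [_ * x]mulrC ler_pM2r; last first.
    by rewrite exprn_gt0 //; lra.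
  lra.
have muM : (1 - d) * M <= mu.
  by rewrite /M /wt_sum mulr_sumr; apply: ler_sum => S /eqP; exact: Ps.
have M2 : \sum_(S : {set 'I_n} | #|S| == k) \sum_(T : {set 'I_n} | #|T| == k)
    Pr (fun G => strong S G && strong T G) <= (1 + d) * M ^+ 2 + M * (4 + d * M).
  have -> : (1 + d) * M ^+ 2 + M * (4 + d * M) = \sum_(S : {set 'I_n} | #|S| == k)
      (wt p S * ((1 + d) * M) + wt p S * (4 + d * M)).
    by rewrite big_split /= -!mulr_suml -/(wt_sum n p k) -/M; ring.
  apply: ler_sum => S /eqP cS.
  rewrite (bigID (fun T => D #|S :&: T|)) /=; apply: lerD.
    apply: (@le_trans _ _ (\sum_(T : {set 'I_n} | (#|T| == k) && D #|S :&: T|)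
        (1 + d) * (wt p S * wt p T))).
      apply: ler_sum => T /andP[/eqP cT DT]; apply: le_trans (hclose S T cS cT DT).
      apply: le_Pr => // G /andP[/andP[-> _] /andP[-> _]] //.
    rewrite -mulr_sumr mulrCA -mulr_sumr; apply: ler_wpM2l; first lra.
    apply: ler_wpM2l; first exact: w0.
    rewrite /M /wt_sum [X in _ <= X](bigID (fun T => D #|S :&: T|)) /= lerDl.
    by apply: sumr_ge0 => T /andP[/eqP cT _]; exact: w0.
  apply: (@le_trans _ _ (\sum_(T : {set 'I_n} | (#|T| == k) && ~~ D #|S :&: T|)
        wt p S * b #|S :&: T|)).
    by apply: ler_sum => T /andP[/eqP cT DT]; exact: hfar.
  rewrite -mulr_sumr; apply: ler_wpM2l; first exact: w0.
  apply: le_trans hsum; exact: (sum_by_meeting (fun i => ~~ D i) cS b0).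
have := Pr_second_moment_sized (fun S => strong S) k.
set P := Pr _; rewrite -/mu => hP.
have PP : Pr (fun G => (indep_number G < k)%N) <= P.
  apply: le_Pr => // G; rewrite ltnNge => nge; apply: contra nge.
  move=> /existsP[S /andP[/eqP cS /andP[/andP[iS _] _]]].
  by apply/indep_number_geP; exists S.
apply: le_trans PP _.
have P0 : 0 <= P by exact: Pr_ge0.
have mu0 : 0 <= (1 - d) * M by rewrite mulr_ge0 ?ltW //; lra.
have h1 : ((1 - d) * M) ^+ 2 <= mu ^+ 2 by rewrite ler_sqr ?nnegrE // (le_trans mu0).
have h2 : P * ((1 - d) * M) ^+ 2 <= (4 * d + 4 / M) * M ^+ 2.
  apply: le_trans (ler_wpM2l P0 h1) _; apply: le_trans hP _.
  (* This difference is 4 d M^2 + 4 M - d^2 M^2. Dividing later by (1 - d)^2 >= 1/2 doubles both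
     error terms. *)
  apply: (@le_trans _ _ ((1 + d) * M ^+ 2 + M * (4 + d * M) - ((1 - d) * M) ^+ 2)).
    by apply: lerB.
  have -> : (4 * d + 4 / M) * M ^+ 2 = 4 * d * M ^+ 2 + 4 * M by field; rewrite gt_eqF.
  have : 0 <= d ^+ 2 * M ^+ 2 by rewrite mulr_ge0 ?sqr_ge0.
  have -> : ((1 - d) * M) ^+ 2 = M ^+ 2 - 2 * d * M ^+ 2 + d ^+ 2 * M ^+ 2 by ring.
  set x := M ^+ 2; set y := d ^+ 2 * x.
  have -> : M * (4 + d * M) = 4 * M + d * x by rewrite /x; ring.
  have : 0 <= d * x by rewrite mulr_ge0 ?sqr_ge0.
  lra.
have M20 : 0 < M ^+ 2 by exact: exprn_gt0.
move: h2; rewrite exprMn mulrA ler_pM2r //.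
have h3 : P * (1 / 2) <= P * (1 - d) ^+ 2.
  apply: ler_wpM2l => //; have -> : (1 - d) ^+ 2 = 1 - 2 * d + d ^+ 2 by ring.
  have := sqr_ge0 d; lra.
have -> : 8 / M = 2 * (4 / M) by rewrite mulrA; congr (_ / _); ring.
lra.
Qed.

End SecondMoment.

(** * Elementary estimates *)

Section Estimates.
Variable R : realType.
Implicit Types (x y lam : R) (i j k m n : nat).
Local Notation E := (expR 1 : R).

Lemma bin2_double n : (2 * 'C(n, 2) = n * n.-1)%N.
Proof. by rewrite mulnC (bin_ffact n 2) !ffactnS ffactn0 muln1. Qed.

Lemma bin2_diff i k : (i <= k)%N ->
  (2 * ('C(k, 2) - 'C(i, 2)) = (k - i) * (k + i).-1)%N.
Proof.
move=> ik; rewrite mulnBr !bin2_double -(subnKC ik); move: (k - i)%N => d.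
rewrite addKn; case: i {ik} => [|i]; first by rewrite !add0n mul0n subn0 addn0.
rewrite !addSn /=; apply/eqP; rewrite -(eqn_add2r (i.+1 * i)) subnK; nia.
Qed.

(** A weak Stirling bound; the induction step is (1 + 1/m)^m <= e. *)
Lemma expn_le_fact i : (i%:R : R) ^+ i <= i`!%:R * E ^+ i.
Proof.
elim: i => [|i IH]; first by rewrite !expr0 fact0 mulr1.
case: i IH => [|i] IH.
  by rewrite factS fact0 muln1 !expr1 mul1r; apply: le_trans (expR_ge1Dx 1); rewrite lerDl.
set m := i.+1 in IH *; have m0 : (0 : R) < m%:R by rewrite ltr0n.
have h : (m.+1%:R : R) ^+ m <= m%:R ^+ m * E.
  have -> : (m.+1%:R : R) = m%:R * (1 + m%:R^-1).
    by rewrite mulrDr mulr1 divff ?gt_eqF // -natr1.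
  rewrite exprMn ler_pM2l ?exprn_gt0 //.
  have -> : E = expR (m%:R^-1) ^+ m :> R.
    by rewrite -expRM_natl divff ?gt_eqF.
  by apply: lerXn2r; rewrite ?nnegrE ?expR_ge0 ?expR_ge1Dx ?addr_ge0 ?invr_ge0.
rewrite factS natrM !(exprS _ m) -mulrA ler_pM2l ?ltr0n //.
apply: le_trans h _; rewrite [E * _]mulrC mulrA; exact: ler_wpM2r.
Qed.

Lemma ffact_le_expn m i : (m ^_ i <= m ^ i)%N.
Proof.
elim: i m => [|i IH] m; first by rewrite ffactn0.
rewrite ffactnS expnS; apply: leq_mul => //; apply: leq_trans (IH _) _.
by case: i {IH} => [|i] //; rewrite leq_exp2r ?leq_pred.
Qed.

Lemma bin_le_expn m i : ('C(m, i) <= m ^ i)%N.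
Proof. by apply: leq_trans (ffact_le_expn m i); rewrite -bin_ffact leq_pmulr ?fact_gt0. Qed.

Lemma bin_le_pow m i : ('C(m, i)%:R : R) * i%:R ^+ i <= (E * m%:R) ^+ i.
Proof.
apply: (@le_trans _ _ ('C(m, i)%:R * (i`!%:R * E ^+ i))).
  by apply: ler_wpM2l; rewrite ?expn_le_fact.
rewrite mulrA -natrM bin_ffact exprMn mulrC; apply: ler_wpM2l; first by rewrite exprn_ge0 ?expR_ge0.
by rewrite -natrX ler_nat ffact_le_expn.
Qed.

(** Factor by factor, n/k <= (n - i)/(k - i) for i < k. *)
Lemma pow_le_bin n k : (k <= n)%N -> (n%:R : R) ^+ k <= 'C(n, k)%:R * k%:R ^+ k.
Proof.
move=> kn; rewrite -!natrX -natrM ler_nat.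
rewrite -(leq_pmul2r (fact_gt0 k)) mulnAC bin_ffact -ffactnn !ffact_prod.
rewrite -[k in (n ^ k)%N]card_ord -[k in (k ^ k)%N]card_ord.
rewrite -!prod_nat_const -!big_split /=; apply: leq_prod => i _; rewrite card_ord.
by move: (ltn_ord i) kn; move: (i : nat) => j; nia.
Qed.

(** With j = k - i, the bounds C(m, j) <= (e m / j)^j and C(k,2) - C(i,2) = j (k + i - 1) / 2 make
    the term at most the j-th power of (e^2 k n / j^2) q^((k+i-1)/2) g^(1/2). The last hypothesis
    says that the square of this base is at most lam^-2. *)
Lemma near_bound (q lam s g : R) (n k i : nat) : 0 <= q -> q <= 1 -> 0 < lam ->
  (i < k)%N -> 0 <= s -> 0 <= g -> s ^+ 2 <= g ^+ (k - i) ->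
  lam ^+ 2 * (E ^+ 2 * k%:R * n%:R) ^+ 2 * q ^+ (k + i).-1 * g <= (k - i)%:R ^+ 4 ->
  'C(k, i)%:R * 'C(n, k - i)%:R * (q ^+ ('C(k, 2) - 'C(i, 2)) * s) <= lam^-1 ^+ (k - i).
Proof.
move=> q0 q1 lam0 ik s0 g0 sg; rewrite -bin_sub ?(ltnW ik) //.
set j := (k - i)%N in sg *; have j0 : (0 < j)%N by rewrite subn_gt0.
set e := (_ - _)%N => base.
have jR : (0 : R) < j%:R by rewrite ltr0n.
set t := _ * (q ^+ e * s).
have t0 : 0 <= t by rewrite !mulr_ge0 ?exprn_ge0.
have li : 0 <= lam^-1 by rewrite invr_ge0 ltW.
rewrite -(ler_pXn2r (n := 2)) ?nnegrE ?exprn_ge0 //.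
have E0 : 0 <= E by exact: expR_ge0.
have h1 : t * (j%:R ^+ j * j%:R ^+ j) <= (E ^+ 2 * k%:R * n%:R) ^+ j * (q ^+ e * s).
  rewrite /t (_ : _ * _ = ('C(k, j)%:R * j%:R ^+ j) * ('C(n, j)%:R * j%:R ^+ j) * (q ^+ e * s)).
    apply: ler_wpM2r; first by rewrite mulr_ge0 ?exprn_ge0.
    rewrite (_ : E ^+ 2 * _ * _ = (E * k%:R) * (E * n%:R)); last by ring.
    rewrite exprMn; apply: ler_pM; rewrite ?mulr_ge0 ?exprn_ge0 ?bin_le_pow //.
  by ring.
have h2 : t ^+ 2 * (j%:R ^+ 4) ^+ j <=
    ((E ^+ 2 * k%:R * n%:R) ^+ 2 * q ^+ (k + i).-1 * g) ^+ j.
  have : (t * (j%:R ^+ j * j%:R ^+ j)) ^+ 2 <=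
      ((E ^+ 2 * k%:R * n%:R) ^+ j * (q ^+ e * s)) ^+ 2.
    apply: lerXn2r => //; rewrite nnegrE ?mulr_ge0 ?exprn_ge0 ?mulr_ge0 ?exprn_ge0 //.
  have -> : (t * (j%:R ^+ j * j%:R ^+ j)) ^+ 2 = t ^+ 2 * (j%:R ^+ 4) ^+ j.
    by rewrite exprMn -exprD -!exprM addnn -mul2n mulnAC.
  move=> /le_trans; apply.
  have hQ : (q ^+ e) ^+ 2 = (q ^+ (k + i).-1) ^+ j.
    by rewrite -!exprM mulnC /e bin2_diff ?(ltnW ik) // mulnC.
  set A := E ^+ 2 * _ * _; set Q := q ^+ (k + i).-1 in hQ *.
  rewrite [X in X <= _]exprMn [(q ^+ e * s) ^+ 2]exprMn hQ exprAC mulrA -exprMn.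
  rewrite [X in _ <= X]exprMn.
  apply: ler_wpM2l => //; apply: exprn_ge0; apply: mulr_ge0; first exact: sqr_ge0.
  exact: exprn_ge0.
have j40 : (0 : R) < (j%:R ^+ 4) ^+ j by rewrite !exprn_gt0.
rewrite -(ler_pM2r j40); apply: (le_trans h2).
move: base; set b := (_ * n%:R) ^+ 2 * _.
have b0 : 0 <= b by apply: mulr_ge0; [exact: sqr_ge0|exact: exprn_ge0].
have -> : lam ^+ 2 * (E ^+ 2 * k%:R * n%:R) ^+ 2 * q ^+ (k + i).-1 * g =
  lam ^+ 2 * (b * g) by rewrite /b; ring.
rewrite -ler_pdivlMl ?exprn_gt0 // => base.
rewrite [X in _ <= X * _]exprAC -exprMn exprVn; apply: lerXn2r => //; rewrite nnegrE.
  exact: mulr_ge0.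
by rewrite mulr_ge0 ?invr_ge0 ?exprn_ge0 // ltW.
Qed.

(** Lowering the index of a binomial coefficient below k <= n/2 by one multiplies it by at most
    2k/n. *)
Lemma bin_shift (n k i : nat) : (i <= k)%N -> (2 * k <= n)%N ->
  'C(n, k - i)%:R * (n%:R / 2) ^+ i <= 'C(n, k)%:R * k%:R ^+ i :> R.
Proof.
move=> ik kn; elim: i ik => [|i IH] ik; first by rewrite subn0 !expr0.
have iki : (k - i = (k - i.+1).+1)%N by lia.
rewrite [in X in _ <= X]exprS [X in _ <= X]mulrCA.
apply: (@le_trans _ _ (k%:R * ('C(n, k - i)%:R * (n%:R / 2) ^+ i))); last first.
  by apply: ler_wpM2l => //; apply: IH; exact: ltnW.
rewrite exprS !mulrA; apply: ler_wpM2r; first by rewrite exprn_ge0 // divr_ge0.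
rewrite ler_pdivrMr // -!natrM ler_nat.
have := mul_bin_left n (k - i.+1); rewrite -iki => h.
have h1 : ((k - i) * 'C(n, k - i) <= k * 'C(n, k - i))%N by rewrite leq_mul2r leq_subr orbT.
have h2 : ('C(n, k - i.+1) * n <= 2 * ((n - (k - i.+1)) * 'C(n, k - i.+1)))%N.
  by rewrite mulnC mulnA leq_mul2r; apply/orP; right; lia.
by apply: leq_trans h2 _; rewrite -h mulnC; apply: leq_mul.
Qed.

(** For small intersections the term is compared with the mean [M]: by [bin_shift] it is at most
    C(n,k) q^C(k,2) times (2 e k^2 / (n i))^i q^(-C(i,2)). Passing from C(n,k) q^C(k,2) to [M] loses
    (1 - a)^(-n) <= e^i, and q^(-C(i,2)) is at most q^(-i^2/2), so everything is an i-th power. *)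
Lemma middle_bound (q a lam M : R) (n k i : nat) : 0 <= q -> q <= 1 -> 0 < lam ->
  a <= 1 -> (0 < i <= k)%N -> (2 * k <= n)%N ->
  'C(n, k)%:R * (q ^+ 'C(k, 2) * (1 - a) ^+ n) <= M ->
  1 <= (1 - a) ^+ n * E ^+ i ->
  (E ^+ 2 * k%:R ^+ 2 * lam) ^+ 2 <= (n%:R / 2 * i%:R) ^+ 2 * q ^+ i ->
  'C(k, i)%:R * 'C(n, k - i)%:R * q ^+ ('C(k, 2) - 'C(i, 2)) <= M * lam^-1 ^+ i.
Proof.
move=> q0 q1 lam0 a1 /andP[i0 ik] kn hM ha base.
have iR : (0 : R) < i%:R by rewrite ltr0n.
have kR : (0 : R) < k%:R by rewrite ltr0n (leq_trans i0).
set t := 'C(k, i)%:R * _ * _.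
have t0 : 0 <= t by rewrite !mulr_ge0 ?exprn_ge0.
have E0 : 0 <= E by exact: expR_ge0.
have Egt0 : 0 < E by exact: expR_gt0.
pose D := n%:R / 2 * i%:R : R.
pose W := E ^+ 2 * k%:R ^+ 2 : R.
have W0 : 0 < W by rewrite /W mulr_gt0 ?exprn_gt0.
have D0 : 0 <= D by rewrite /D !mulr_ge0 // invr_ge0.
have h1 : t * D ^+ i * q ^+ 'C(i, 2) <= M * W ^+ i.
  have e1 : q ^+ ('C(k, 2) - 'C(i, 2)) * q ^+ 'C(i, 2) = q ^+ 'C(k, 2).
    by rewrite -exprD subnK // leq_bin2l.
  have -> : t * D ^+ i * q ^+ 'C(i, 2) =
      ('C(k, i)%:R * i%:R ^+ i) * ('C(n, k - i)%:R * (n%:R / 2) ^+ i) * q ^+ 'C(k, 2).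
    by rewrite -e1 /t /D exprMn; ring.
  apply: (@le_trans _ _ ((E * k%:R) ^+ i * ('C(n, k)%:R * k%:R ^+ i) * q ^+ 'C(k, 2))).
    apply: ler_wpM2r; first exact: exprn_ge0.
    apply: ler_pM; rewrite ?bin_le_pow ?bin_shift //; apply: mulr_ge0 => //;
      by rewrite exprn_ge0 // divr_ge0.
  have -> : W ^+ i = (E * k%:R) ^+ i * k%:R ^+ i * E ^+ i.
    by rewrite -!exprMn; congr (_ ^+ _); rewrite /W; ring.
  have X0 : 0 <= 'C(n, k)%:R * q ^+ 'C(k, 2) by rewrite mulr_ge0 ?exprn_ge0.
  have Y0 : 0 <= (E * k%:R) ^+ i * k%:R ^+ i by rewrite mulr_ge0 ?exprn_ge0 ?mulr_ge0.
  have -> : (E * k%:R) ^+ i * ('C(n, k)%:R * k%:R ^+ i) * q ^+ 'C(k, 2) =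
    ((E * k%:R) ^+ i * k%:R ^+ i) * ('C(n, k)%:R * q ^+ 'C(k, 2)) by ring.
  have -> : M * ((E * k%:R) ^+ i * k%:R ^+ i * E ^+ i) =
    ((E * k%:R) ^+ i * k%:R ^+ i) * (M * E ^+ i) by ring.
  apply: ler_wpM2l => //.
  apply: (@le_trans _ _ ('C(n, k)%:R * (q ^+ 'C(k, 2) * (1 - a) ^+ n) * E ^+ i)).
    by rewrite mulrA -mulrA ler_peMr.
  by apply: ler_wpM2r => //; rewrite exprn_ge0.
have h2 : (W * lam) ^+ i <= D ^+ i * q ^+ 'C(i, 2).
  have A0 : 0 <= (W * lam) ^+ i by apply: exprn_ge0; rewrite ltW // mulr_gt0.
  have B0 : 0 <= D ^+ i * q ^+ 'C(i, 2) by rewrite mulr_ge0 ?exprn_ge0.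
  rewrite -(ler_pXn2r (n := 2)) ?nnegrE //.
  rewrite [X in X <= _]exprAC [X in _ <= X]exprMn [(D ^+ i) ^+ 2]exprAC.
  have e2 : (q ^+ i) ^+ i <= (q ^+ 'C(i, 2)) ^+ 2.
    rewrite -!exprM [X in _ <= q ^+ X]mulnC bin2_double.
    by apply: ler_wiXn2l => //; rewrite leq_mul2l leq_pred orbT.
  apply: le_trans (ler_wpM2l _ e2); last by rewrite exprn_ge0 // sqr_ge0.
  rewrite -exprMn; apply: lerXn2r; rewrite ?nnegrE ?sqr_ge0 //.
  by rewrite mulr_ge0 ?sqr_ge0 ?exprn_ge0.
have h3 : t * (W * lam) ^+ i <= M * W ^+ i.
  by apply: le_trans h1; rewrite -mulrA; exact: ler_wpM2l.
rewrite exprMn mulrA mulrAC ler_pM2r ?exprn_gt0 // in h3.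
by rewrite exprVn ler_pdivlMr ?exprn_gt0.
Qed.

Lemma bernoulli_le x m : 0 <= x -> x <= 1 -> 1 - m%:R * x <= (1 - x) ^+ m.
Proof.
move=> x0 x1; elim: m => [|m IH]; first by rewrite mul0r subr0.
rewrite exprS -natr1; apply: (@le_trans _ _ ((1 - x) * (1 - m%:R * x))).
  have : 0 <= m%:R * x ^+ 2 by rewrite mulr_ge0 ?sqr_ge0.
  by rewrite expr2; lra.
by apply: ler_wpM2l => //; rewrite subr_ge0.
Qed.

(** Bernoulli for (1 - x)^m combined with (1 + x)(1 - x) <= 1; if x > 1 and m > 0, the second factor
    is not positive. *)
Lemma pow1D_le x m : 0 <= x -> (1 + x) ^+ m * (1 - m%:R * x) <= 1.
Proof.
move=> x0; case: m => [|m]; first by rewrite mul0r subr0 expr0 mulr1.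
have X0 : 0 <= (1 + x) ^+ m.+1 by rewrite exprn_ge0 // addr_ge0.
have [x1|x1] := leP x 1; last first.
  apply: (@le_trans _ _ 0) => //; apply: mulr_ge0_le0 => //; rewrite subr_le0.
  by apply: (@le_trans _ _ (1 * x)); [lra|rewrite ler_wpM2r // ler1n].
apply: (le_trans (ler_wpM2l X0 (bernoulli_le m.+1 x0 x1))).
by rewrite -exprMn exprn_ile1 //; have := sqr_ge0 x; rewrite expr2; nra.
Qed.

Lemma pow_1B_expR (a : R) m i : 0 <= a -> a <= 1 / 2 -> 2 * (a * m%:R) <= i%:R ->
  1 <= (1 - a) ^+ m * E ^+ i.
Proof.
move=> a0 a2 ami.
have a1 : 0 < 1 - a by lra.
have ha : expR (- (2 * a)) <= 1 - a.
  rewrite expRN invf_ple ?posrE ?expR_gt0 //.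
  apply: le_trans (expR_ge1Dx _); rewrite -div1r ler_pdivrMr //.
  have -> : (1 + 2 * a) * (1 - a) = 1 + a * (1 - 2 * a) by ring.
  by rewrite lerDl mulr_ge0 //; lra.
apply: (@le_trans _ _ (expR (- (2 * a)) ^+ m * E ^+ i)); last first.
  apply: ler_wpM2r; first by rewrite exprn_ge0 // expR_ge0.
  by apply: lerXn2r; rewrite ?nnegrE ?expR_ge0 // ltW.
rewrite -!expRM_natr -expRD -[X in X <= _]expR0 ler_expR mul1r mulNr.
by rewrite addrC subr_ge0 -mulrA.
Qed.

Lemma geometric_sum_le x (f : nat -> R) k : 0 <= x -> x <= 1 / 2 ->
  (forall i, (i < k)%N -> f i <= x ^+ i.+1) -> \sum_(i < k) f i <= 2 * x.
Proof.
move=> x0 x2 fx; apply: (@le_trans _ _ (\sum_(i < k) x ^+ i.+1)).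
  by apply: ler_sum => i _; exact: fx.
(* The subtracted remainder makes the induction go through. *)
suff : \sum_(i < k) x ^+ i.+1 <= 2 * x - x ^+ k * (2 * x).
  move=> /le_trans; apply; rewrite gerBl; apply: mulr_ge0; first exact: exprn_ge0.
  by apply: mulr_ge0.
elim: k {fx f} => [|k IH]; first by rewrite big_ord0 expr0 mul1r subrr.
rewrite big_ord_recr /=; have := exprn_ge0 k x0.
rewrite !exprS; set y := x ^+ k in IH * => y0.
have : 0 <= x * y * (1 - 2 * x) by rewrite !mulr_ge0 //; lra.
lra.
Qed.

End Estimates.

(** * Bounds for pairs *)

Lemma double_uphalf_le m : (2 * uphalf m <= m + 1)%N.
Proof. by have := odd_double_half m; rewrite uphalf_half; case: (odd m) => /=; lia. Qed.

Lemma double_uphalf_ge m : (m <= (uphalf m).*2)%N.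
Proof. by have := odd_double_half m; rewrite uphalf_half; case: (odd m) => /=; lia. Qed.

Section PairBounds.
Variables (R : realType) (n k : nat) (p a u : R).
Hypotheses (p0 : 0 <= p) (p1 : p <= 1).
Hypothesis aE : a = (1 + k%:R * p) * (1 - p) ^+ k.-1.
Hypothesis a_half : a <= 1 / 2.
Let q := 1 - p.
Let q_ge0 : 0 <= q. Proof. by rewrite subr_ge0. Qed.
Let q_le1 : q <= 1. Proof. by rewrite gerBl. Qed.
Let a0 : 0 <= a.
Proof. by rewrite aE mulr_ge0 ?exprn_ge0 // addr_ge0 // mulr_ge0. Qed.
Let a1 : a <= 1. Proof. by apply: le_trans a_half _; lra. Qed.

(** Each of the three corrections in [Pr_weak_pair_near_indep] is at least 1 - u once moved to the
    left-hand side, and (1 + 4u)(1 - u)^3 >= 1 for u <= 1/64. *)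
Lemma Pr_weak_pair_close (S T : {set 'I_n}) : #|S| = k -> #|T| = k ->
  0 <= u -> u <= 1 / 64 -> 1 <= k%:R * p -> 2 * (k%:R * a) <= u ->
  8 * (n%:R * a ^+ 2) <= u -> #|S :&: T|%:R ^+ 2 * p <= u ->
  gnp_prob p (fun G : graph n => weak S G && weak T G) <=
  (1 + 4 * u) * (wt p S * wt p T).
Proof.
move=> cS cT u0 u64 kp kau nau; set i := #|S :&: T| => iu.
have ipu : i%:R * p <= u.
  apply: le_trans iu; apply: ler_wpM2r => //.
  by rewrite -natrX ler_nat; case: (i) => // i'; rewrite -mulnn leq_pmulr.
have ik : (i < k)%N.
  rewrite ltnNge; apply/negP => ki.
  have : k%:R * p <= i%:R * p by apply: ler_wpM2r => //; rewrite ler_nat.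
  lra.
set c := (1 + k%:R * p) * q ^+ (k - i).-1.
have c0 : 0 <= c by rewrite mulr_ge0 ?exprn_ge0 // addr_ge0 // mulr_ge0.
(* Indeed a = c q^i, and q^i >= 1 - ip >= 1/2. *)
have c2a : c <= 2 * a.
  have qi : 1 / 2 <= q ^+ i by apply: le_trans (bernoulli_le i p0 p1); lra.
  have h : a = c * q ^+ i.
    rewrite /c -mulrA -exprD aE; congr (_ * _ ^+ _).
    by rewrite -subnS -[in LHS](subnK ik) addnS.
  have := ler_wpM2l c0 qi; rewrite -h; lra.
have := Pr_weak_pair_near_indep p0 p1 aE a_half cS cT (erefl c).
rewrite -/i -/q; set P := gnp_prob _ _; set W := wt p S * wt p T.
set X := (1 - a) ^+ (2 * k); set Y := q ^+ 'C(i, 2); set V := (1 + 4 * a * c) ^+ n.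
move=> main.
have P0 : 0 <= P by exact: Pr_ge0.
have W0 : 0 <= W.
  by rewrite mulr_ge0 // (wt_ge0 p0 p1 a1 aE).
have ac0 : 0 <= 4 * a * c by rewrite mulr_ge0 // mulr_ge0.
have hX : 1 - u <= X.
  apply: le_trans (bernoulli_le (2 * k) a0 a1).
  by rewrite lerD2l lerN2 natrM -mulrA.
have hY : 1 - u <= Y.
  apply: le_trans (bernoulli_le _ p0 p1); rewrite lerD2l lerN2; apply: le_trans iu.
  apply: ler_wpM2r => //; rewrite -natrX ler_nat.
  apply: leq_trans (_ : 2 * 'C(i, 2) <= _)%N; first by rewrite leq_pmull.
  by rewrite bin2_double -mulnn leq_mul2l leq_pred orbT.
have hZ : 1 - u <= 1 - n%:R * (4 * a * c).
  rewrite lerD2l lerN2; apply: le_trans nau.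
  have -> : 8 * (n%:R * a ^+ 2) = n%:R * (4 * a * (2 * a)) by ring.
  by apply: ler_wpM2l => //; apply: ler_wpM2l => //; rewrite mulr_ge0.
set Z := 1 - n%:R * _ in hZ.
have hVZ : V * Z <= 1 by exact: pow1D_le.
have u1 : 0 <= 1 - u by lra.
have Z0 : 0 <= Z by exact: le_trans hZ.
have hXYZ : 1 <= (1 + 4 * u) * (X * Y * Z).
  apply: (@le_trans _ _ ((1 + 4 * u) * ((1 - u) * (1 - u) * (1 - u)))).
    have h1 : 0 <= u * (1 - 9 * u) by rewrite mulr_ge0 //; lra.
    have h2 : 0 <= u ^+ 3 * (11 - 4 * u) by rewrite mulr_ge0 ?exprn_ge0 //; lra.
    have -> : (1 + 4 * u) * ((1 - u) * (1 - u) * (1 - u)) =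
      1 + u * (1 - 9 * u) + u ^+ 3 * (11 - 4 * u) by ring.
    lra.
  apply: ler_wpM2l; first lra.
  by apply: ler_pM => //; rewrite ?mulr_ge0 //; apply: ler_pM.
apply: (@le_trans _ _ (P * ((1 + 4 * u) * (X * Y * Z)))); first by rewrite ler_peMr.
have -> : P * ((1 + 4 * u) * (X * Y * Z)) = (1 + 4 * u) * (X * P * Y * Z) by ring.
apply: ler_wpM2l; first lra.
apply: le_trans (ler_wpM2r Z0 main) _; rewrite -mulrA.
by rewrite ler_piMr.
Qed.

(* The bound on the probability that S \ T and T \ S, of size j, span at least
   3j/2 edges; it is only used when j is small. *)
Definition edge_factor (near : pred nat) j : R :=
  if near j then 'C(j ^ 2, uphalf (3 * j))%:R * p ^+ uphalf (3 * j) else 1.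

Lemma edge_factor_ge0 near j : 0 <= edge_factor near j.
Proof. by rewrite /edge_factor; case: ifP => // _; rewrite mulr_ge0 ?exprn_ge0. Qed.

(** The leading 2 pays for (1 - a)^(-k), which is at most 2 when 2ka <= 1. *)
Definition far_factor near i : R :=
  2 * (q ^+ ('C(k, 2) - 'C(i, 2)) * edge_factor near (k - i)).

Lemma far_factor_ge0 near i : 0 <= far_factor near i.
Proof. by rewrite mulr_ge0 // mulr_ge0 ?exprn_ge0 ?edge_factor_ge0. Qed.

Lemma Pr_strong_pair_far near (S T : {set 'I_n}) : #|S| = k -> #|T| = k ->
  2 * (k%:R * a) <= 1 ->
  gnp_prob p (fun G : graph n => strong S G && strong T G) <=
  wt p S * far_factor near #|S :&: T|.
Proof.
move=> cS cT ka; set i := #|S :&: T|.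
have jE : #|S :\: T| = (k - i)%N by rewrite cardsD cS.
have hX : 1 / 2 <= (1 - a) ^+ k.
  by apply: le_trans (bernoulli_le k a0 a1); lra.
set P := gnp_prob _ _.
have P0 : 0 <= P by exact: Pr_ge0.
suff main : (1 - a) ^+ k * P <=
    wt p S * (q ^+ ('C(k, 2) - 'C(i, 2)) * edge_factor near (k - i)).
  apply: (@le_trans _ _ (2 * ((1 - a) ^+ k * P))); last first.
    by rewrite /far_factor [X in _ <= X]mulrCA; apply: ler_wpM2l.
  by have := ler_wpM2r P0 hX; lra.
rewrite /edge_factor; case: ifP => _.
  have := @Pr_strong_pair R n p p0 p1 k a aE S T (uphalf (3 * (k - i))) a1 cS cT.
  rewrite jE; apply; exact: double_uphalf_le.
have := @Pr_weak_pair_far R n p p0 p1 k a aE S T predT a1 cS cT (fun _ => erefl).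
rewrite Pr_true; apply: le_trans; apply: ler_wpM2l; first by rewrite exprn_ge0 // subr_ge0.
by apply: le_Pr => // G /andP[/andP[-> _] /andP[/andP[-> _] _]].
Qed.

End PairBounds.

(** * Sparse regime *)

Lemma ltn_sub_shift f x m : (f.+2 <= x -> x < m -> x - f.+2 < m - f.+1)%N.
Proof. lia. Qed.

Section SparseRegime.
Variables (R : realType) (n T A C : nat) (p lam : R).
Local Notation E := (expR 1 : R).
Hypotheses (p_gt0 : 0 < p) (T10 : (10 <= T)%N) (A100 : (100 <= A)%N) (C64 : (64 <= C)%N).
(* lam is a tiny power of n that absorbs constants and logarithms; the exponents
   below are generous rather than optimal.  A and C stand for 100 and 64 and are
   kept abstract so that unification does not unfold them. *)
Hypothesis lamC : C%:R * E ^+ 8 * T%:R ^+ 4 <= lam.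
Hypothesis nE : n%:R = lam ^+ (T * 30).
Hypothesis p_small : p * lam ^+ A <= 1.
Hypothesis p_large : lam ^+ A <= n%:R ^+ 2 * p ^+ 3.
Hypothesis lamE : lam ^+ (T * 60 + 20) <= expR lam.
Let q := 1 - p.
Let N := n%:R * p.

Let E2 : 2 <= E. Proof. by have := expR_ge1Dx (1 : R); rewrite -natr1. Qed.

Let E1 : 1 <= E. Proof. by apply: le_trans E2; rewrite ler1n. Qed.

Let EX_ge0 m : 0 <= E ^+ m. Proof. by apply: exprn_ge0; exact: expR_ge0. Qed.

Let T0 : (0 < T)%N. Proof. exact: leq_trans T10. Qed.

Let T1 : 1 <= T%:R :> R. Proof. by rewrite ler1n (leq_trans _ T10). Qed.

Let lamC3 m c : (m <= 8)%N -> (c <= 64)%N -> c%:R * E ^+ m * T%:R ^+ 4 <= lam.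
Proof.
move=> m8 c0; apply: le_trans lamC; apply: ler_wpM2r; first exact: exprn_ge0.
apply: ler_pM => //; last exact: ler_weXn2l.
by rewrite ler_nat (leq_trans c0).
Qed.

Let lamC2 m c : (m <= 8)%N -> (c <= 64)%N -> c%:R * E ^+ m <= lam.
Proof.
move=> m8 c1; apply: le_trans (lamC3 m8 c1); rewrite ler_peMr ?exprn_ege1 //.
Qed.

Let lam_nat c : (c <= 64)%N -> c%:R <= lam.
Proof. by move=> c64; rewrite -[X in X <= _]mulr1 -(expr0 E) lamC2. Qed.

Let lam1 : 1 <= lam. Proof. exact: (lam_nat (c := 1)). Qed.
Let lam_gt0 : 0 < lam. Proof. exact: lt_le_trans lam1. Qed.
Let lam_ge0 : 0 <= lam. Proof. exact: ltW. Qed.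
Let lamX_gt0 m : 0 < lam ^+ m. Proof. exact: exprn_gt0. Qed.
Let lamX_ge0 m : 0 <= lam ^+ m. Proof. exact: exprn_ge0. Qed.
Let lamX_ge1 m : 1 <= lam ^+ m. Proof. exact: exprn_ege1. Qed.

Let lamX m m' : (m <= m')%N -> lam ^+ m <= lam ^+ m'.
Proof. exact: ler_weXn2l. Qed.

Let absorb c m : c <= lam -> c * lam ^+ m <= lam ^+ m.+1.
Proof. by move=> cl; rewrite exprS ler_pM2r. Qed.

(** Smallness is always recorded as x * lam^r <= 1. It is obtained by multiplying x with a quantity
    known to exceed a high power of [lam], such as N or n^2 p^3. *)
Let cancel x m r : x * lam ^+ (m + r) <= lam ^+ m -> x * lam ^+ r <= 1.
Proof. by rewrite exprD mulrCA -[X in _ <= X -> _]mulr1 ler_pM2l. Qed.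

Let decay x m r : 0 <= x -> (r <= m)%N -> x * lam ^+ m <= 1 -> x * lam ^+ r <= 1.
Proof. by move=> x0 rm; apply: le_trans; rewrite ler_wpM2l ?lamX. Qed.

Let small x m : 0 <= x -> (0 < m)%N -> x * lam ^+ m <= 1 -> x <= 1 / 8.
Proof.
move=> x0 m0 /(decay x0 m0); rewrite expr1 => h.
by rewrite ler_pdivlMr //; apply: le_trans h; rewrite ler_wpM2l // lam_nat.
Qed.

Let p_ge0 : 0 <= p. Proof. exact: ltW. Qed.

Let p_le : p <= 1 / 8. Proof. by apply: small p_small; rewrite ?(leq_trans _ A100). Qed.

Let q_ge : 1 / 2 <= q. Proof. by rewrite /q; have := p_le; lra. Qed.
Let q_gt0 : 0 < q. Proof. by have := q_ge; lra. Qed.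
Let q_le1 : q <= 1. Proof. by rewrite /q gerBl ltW. Qed.
Let p_le1 : p <= 1. Proof. by have := p_le; lra. Qed.

(** N^3 = n * (n^2 p^3) >= n, hence N >= n^(1/3). *)
Let N_ge : lam ^+ (T * 10) <= N.
Proof.
have N0 : 0 <= N by rewrite mulr_ge0 // ltW.
rewrite -(ler_pXn2r (n := 3)) ?nnegrE ?lamX_ge0 //.
have -> : N ^+ 3 = n%:R * (n%:R ^+ 2 * p ^+ 3) by rewrite /N; ring.
have -> : (lam ^+ (T * 10)) ^+ 3 = n%:R by rewrite nE -exprM -mulnA.
rewrite ler_peMr //; exact: le_trans (lamX_ge1 A) p_large.
Qed.

Let N_ge100 : lam ^+ 100 <= N.
Proof. by apply: le_trans N_ge; apply: lamX; rewrite -[100%N]/(10 * 10)%N leq_mul2r T10. Qed.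

Let N_gt0 : 0 < N. Proof. by apply: lt_le_trans N_ge100. Qed.

Let n_gt0 : 0 < n%:R :> R. Proof. by rewrite nE. Qed.

Let N_le : N <= lam ^+ (T * 30).
Proof. by rewrite -nE /N ler_piMr. Qed.

Let N_ge0 : 0 <= N. Proof. exact: ltW. Qed.

Let sqr_le (x z : R) : 0 <= x -> x <= z -> x ^+ 2 <= z ^+ 2.
Proof. by move=> x0 xz; apply: lerXn2r => //; rewrite nnegrE (le_trans x0). Qed.

Let N2_ge : lam ^+ (T * 20) <= N ^+ 2.
Proof.
have -> : lam ^+ (T * 20) = (lam ^+ (T * 10)) ^+ 2 by rewrite -exprM -mulnA.
exact: sqr_le.
Qed.

Let N2_ge200 : lam ^+ 200 <= N ^+ 2.
Proof.
have -> : lam ^+ 200 = (lam ^+ 100) ^+ 2 by rewrite -exprM.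
exact: sqr_le.
Qed.

Let N2_le : N ^+ 2 <= lam ^+ (T * 60).
Proof.
have -> : lam ^+ (T * 60) = (lam ^+ (T * 30)) ^+ 2 by rewrite -exprM -mulnA.
exact: sqr_le.
Qed.

Let qX_ge0 m : 0 <= q ^+ m. Proof. by apply: exprn_ge0; exact: ltW. Qed.

Let qX_lower m : expR (- (2 * p * m%:R)) <= q ^+ m.
Proof.
rewrite -mulNr expRM_natr; apply: lerXn2r; rewrite ?nnegrE ?expR_ge0 ?(ltW q_gt0) //.
rewrite expRN invf_ple ?posrE ?expR_gt0 //.
apply: le_trans (expR_ge1Dx _); rewrite -div1r ler_pdivrMr //.
have -> : (1 + 2 * p) * q = 1 + p * (1 - 2 * p) by rewrite /q; ring.
rewrite lerDl mulr_ge0 ?(ltW p_gt0) //; have := p_le; lra.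
Qed.

Let qX_upper m : q ^+ m <= expR (- (p * m%:R)).
Proof.
rewrite -mulNr expRM_natr; apply: lerXn2r; rewrite ?nnegrE ?expR_ge0 ?(ltW q_gt0) //.
by have := expR_ge1Dx (- p); rewrite /q.
Qed.

(* For k in the window q^k is within a factor lam^6 of (np)^-2, as it is at the
   independence number. *)
Section Window.
Variable k : nat.
Let y := q ^+ k.
Hypothesis w_upper : y * N ^+ 2 <= lam ^+ 6.
Hypothesis w_lower : 1 <= lam ^+ 6 * (y * N ^+ 2).

Let y_gt0 : 0 < y. Proof. exact: exprn_gt0. Qed.

(** Otherwise q^k >= e^-2 would be of constant order, while N^2 >= lam^200 and q^k N^2 <= lam^6. *)
Lemma window_kp_ge1 : 1 <= k%:R * p.
Proof.
rewrite leNgt; apply/negP => kp.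
have h1 : expR (- 2) <= y.
  by apply: le_trans (qX_lower k); rewrite ler_expR lerN2; lra.
have h2 : 1 <= y * E ^+ 2.
  rewrite -expRM_natl -ler_pdivrMr ?expR_gt0 // div1r -expRN; apply: le_trans h1.
  by rewrite ler_expR mulr1.
have h3 : lam ^+ 200 <= lam ^+ 7.
  apply: (le_trans N2_ge200).
  apply: (@le_trans _ _ (y * E ^+ 2 * N ^+ 2)); first by rewrite ler_peMl ?sqr_ge0.
  rewrite mulrAC; apply: le_trans (ler_wpM2r _ w_upper) _; first by rewrite exprn_ge0 // ltW // expR_gt0.
  by rewrite mulrC absorb // -[X in X <= _]mul1r (lamC2 (c := 1)).
have : lam ^+ 7 < lam ^+ 200.
  by rewrite ltr_eXn2l //; apply: lt_le_trans (lam_nat (c := 2) _); rewrite ?ltr1n.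
by rewrite ltNge h3.
Qed.

(** kp is logarithmic in n: e^(kp) <= q^(-k) <= lam^6 N^2 <= lam^(60T+6), and e^lam exceeds that
    power. *)
Lemma window_kp_le : k%:R * p <= lam.
Proof.
have h1 : 1 <= lam ^+ 6 * (expR (- (p * k%:R)) * N ^+ 2).
  apply: (le_trans w_lower); rewrite ler_pM2l // ler_wpM2r ?sqr_ge0 //; exact: qX_upper.
rewrite -ler_expR; apply: le_trans lamE.
rewrite mulrC -[X in X <= _]mul1r; apply: le_trans (ler_wpM2r (expR_ge0 _) h1) _.
have -> : lam ^+ 6 * (expR (- (p * k%:R)) * N ^+ 2) * expR (p * k%:R) = lam ^+ 6 * N ^+ 2.
  by rewrite expRN; field; rewrite gt_eqF // expR_gt0.
apply: le_trans (ler_wpM2l (lamX_ge0 6) N2_le) _.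
by rewrite -exprD; apply: lamX; rewrite addnC leq_add2l.
Qed.

Let k_ge : lam ^+ 100 <= k%:R.
Proof.
apply: (@le_trans _ _ (lam ^+ A)); first exact: lamX.
have h := ler_wpM2l (ler0n R k) p_small.
rewrite mulrA mulr1 in h; apply: le_trans h; rewrite ler_peMl //.
exact: window_kp_ge1.
Qed.

Let k_gt0 : (0 < k)%N.
Proof. by rewrite -(ltr0n R); apply: lt_le_trans k_ge. Qed.

Let qk1 : q ^+ k.-1 <= 2 * y.
Proof.
rewrite /y -[in X in _ <= X](prednK k_gt0) exprS mulrA ler_peMl ?qX_ge0 //.
by have := q_ge; lra.
Qed.

(** [T] is the scale at which q^(k/T) becomes a fixed power of [lam]. Taking T-th powers, q^(iT) >=
    q^k >= lam^(-6) N^(-2) >= lam^(-6-60T), and 66 = 6 + 60. *)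
Lemma window_qX_lower i : (i * T <= k)%N -> 1 <= q ^+ i * lam ^+ 66.
Proof.
move=> iT.
rewrite -(ler_pXn2r T0) ?nnegrE ?mulr_ge0 ?qX_ge0 ?lam_ge0 //.
rewrite expr1n exprMn -!exprM.
have h1 : y <= q ^+ (i * T) by apply: ler_wiXn2l => //; exact: ltW.
apply: (le_trans w_lower); rewrite mulrCA; apply: ler_pM => //.
- exact: ltW.
- by rewrite mulr_ge0 ?sqr_ge0 // ltW.
- apply: le_trans (ler_wpM2l (lamX_ge0 6) N2_le) _.
  rewrite -exprD; apply: lamX; rewrite [(66 * T)%N]mulnC.
  by rewrite -[66%N]/(6 + 60)%N mulnDr leq_add2r leq_pmull.
Qed.

(** The reverse comparison: q^(iT) <= lam^6 N^(-2) <= lam^(6-20T), and 14 = 20 - 6. *)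
Lemma window_qX_upper i : (k <= i * T)%N -> q ^+ i * lam ^+ 14 <= 1.
Proof.
move=> iT.
rewrite -(ler_pXn2r T0) ?nnegrE ?mulr_ge0 ?qX_ge0 ?lam_ge0 //.
rewrite expr1n exprMn -!exprM.
have h1 : q ^+ (i * T) <= y by apply: ler_wiXn2l => //; exact: ltW.
apply: (@cancel _ 6).
apply: le_trans w_upper; apply: ler_pM; [exact: qX_ge0|exact: lamX_ge0|exact: h1|].
apply: le_trans N2_ge; apply: lamX.
by rewrite [(14 * T)%N]mulnC -[20%N]/(6 + 14)%N mulnDr leq_add2r leq_pmull.
Qed.

Definition window_a := (1 + k%:R * p) * q ^+ k.-1.
Local Notation a := window_a.

Let a_ge0 : 0 <= a.
Proof.
by rewrite /window_a mulr_ge0 ?qX_ge0 // addr_ge0 // mulr_ge0.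
Qed.

Let a_bound : a * N ^+ 2 <= lam ^+ 8.
Proof.
have h1 : 1 + k%:R * p <= 2 * lam by rewrite mulr2n mulrDl mul1r lerD // window_kp_le.
have h2 : a <= 2 * lam * (2 * y).
  by apply: ler_pM; [rewrite addr_ge0 // mulr_ge0|exact: qX_ge0|exact: h1|exact: qk1].
apply: le_trans (ler_wpM2r (sqr_ge0 _) h2) _.
have -> : 2 * lam * (2 * y) * N ^+ 2 = 4 * lam * (y * N ^+ 2) by ring.
have h3 : 4 * lam * (y * N ^+ 2) <= 4 * lam * lam ^+ 6 by rewrite ler_pM2l // mulr_gt0.
apply: le_trans h3 _; rewrite -mulrA -exprS absorb //; exact: (lam_nat (c := 4)).
Qed.

Let a_small : a * lam ^+ 192 <= 1.
Proof.
apply: (@cancel _ 8); apply: le_trans a_bound; apply: ler_wpM2l; first exact: a_ge0.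
exact: N2_ge200.
Qed.

Let a_half : a <= 1 / 8. Proof. exact: small a_small. Qed.

(** Here and in the next two bounds the hypothesis n^2 p^3 >= lam^A enters: k a, n a^2 and the
    expected number of cherries become fixed powers of [lam] after multiplication by n^2 p^3 (by N
    n^2 p^3 for the second). *)
Let ka_small : k%:R * a * lam ^+ 80 <= 1.
Proof.
apply: (@cancel _ 9).
have h : k%:R * a * (n%:R ^+ 2 * p ^+ 3) <= lam ^+ 9.
  have -> : k%:R * a * (n%:R ^+ 2 * p ^+ 3) = (k%:R * p) * (a * N ^+ 2) by rewrite /N; ring.
  rewrite (exprS lam 8); apply: ler_pM;
    [exact: mulr_ge0|by rewrite mulr_ge0 ?sqr_ge0|exact: window_kp_le|exact: a_bound].
apply: le_trans h; apply: ler_wpM2l; first by rewrite mulr_ge0.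
by apply: le_trans p_large; apply: lamX; apply: leq_trans A100.
Qed.

Let na2_small : n%:R * a ^+ 2 * lam ^+ 80 <= 1.
Proof.
apply: (@cancel _ 16).
have h : n%:R * a ^+ 2 * (N * (n%:R ^+ 2 * p ^+ 3)) <= lam ^+ 16.
  have -> : n%:R * a ^+ 2 * (N * (n%:R ^+ 2 * p ^+ 3)) = (a * N ^+ 2) ^+ 2.
    by rewrite /N; ring.
  by rewrite -[16%N]/(8 * 2)%N exprM; apply: sqr_le; [rewrite mulr_ge0 ?sqr_ge0|exact: a_bound].
apply: le_trans h; apply: ler_wpM2l; first by rewrite mulr_ge0 ?sqr_ge0.
apply: (@le_trans _ _ (1 * lam ^+ 100)); first by rewrite mul1r lamX.
apply: ler_pM => //; first exact: le_trans (lamX_ge1 _) N_ge100.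
by apply: le_trans p_large; apply: lamX.
Qed.

Let cherry_small :
  k%:R * n%:R ^+ 2 * (p * q ^+ k.-1) ^+ 2 * lam ^+ 80 <= 1.
Proof.
apply: (@cancel _ 14).
have h : k%:R * n%:R ^+ 2 * (p * q ^+ k.-1) ^+ 2 * (n%:R ^+ 2 * p ^+ 3) <= lam ^+ 14.
  have -> : k%:R * n%:R ^+ 2 * (p * q ^+ k.-1) ^+ 2 * (n%:R ^+ 2 * p ^+ 3) =
      (k%:R * p) * (q ^+ k.-1 * N ^+ 2) ^+ 2 by rewrite /N; ring.
  have h1 : q ^+ k.-1 * N ^+ 2 <= 2 * lam ^+ 6.
    apply: le_trans (ler_wpM2r (sqr_ge0 _) qk1) _.
    by rewrite -mulrA ler_pM2l.
  apply: (@le_trans _ _ (lam * (2 * lam ^+ 6) ^+ 2)).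
    apply: ler_pM => //; [by rewrite mulr_ge0|exact: sqr_ge0|exact: window_kp_le|].
    by apply: sqr_le => //; rewrite mulr_ge0 ?sqr_ge0 ?qX_ge0.
  have -> : lam * (2 * lam ^+ 6) ^+ 2 = 4 * lam ^+ 13 by ring.
  by rewrite absorb //; exact: (lam_nat (c := 4)).
apply: le_trans h; apply: ler_wpM2l.
  by rewrite !mulr_ge0 ?sqr_ge0.
by apply: le_trans p_large; apply: lamX; apply: leq_trans A100.
Qed.

Local Notation u := (lam^-1).

Let u_ge0 : 0 <= u. Proof. by rewrite invr_ge0. Qed.

Let u_small : u <= 1 / 64.
Proof. by rewrite div1r lef_pV2 ?posrE // lam_nat. Qed.

Let le_u x c : 0 <= x -> (c <= 64)%N -> x * lam ^+ 2 <= 1 -> c%:R * x <= u.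
Proof.
move=> x0 c64 h; rewrite -[u]mul1r ler_pdivlMr //.
apply: le_trans h; rewrite expr2 mulrA; apply: ler_wpM2r => //.
by rewrite mulrC; apply: ler_wpM2l => //; exact: lam_nat.
Qed.

Let q_le k' m : (k' <= m)%N -> q ^+ m <= q ^+ k'.
Proof. by move=> km; apply: ler_wiXn2l => //; exact: ltW. Qed.

Let kny : k%:R * n%:R * y * (n%:R * p ^+ 3) <= lam ^+ 7.
Proof.
have -> : k%:R * n%:R * y * (n%:R * p ^+ 3) = (k%:R * p) * (y * N ^+ 2) by rewrite /N; ring.
rewrite (exprS lam 6); apply: ler_pM;
  [exact: mulr_ge0|by rewrite mulr_ge0 ?sqr_ge0 // ltW|exact: window_kp_le|exact: w_upper].
Qed.

Let kny_ge0 : 0 <= k%:R * n%:R * y.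
Proof. by rewrite !mulr_ge0 // ltW. Qed.

Let np3_ge0 : 0 <= n%:R * p ^+ 3.
Proof. by rewrite mulr_ge0 // exprn_ge0. Qed.

Let q_split i : q ^+ (k + i).-1 <= 2 * (y * q ^+ i).
Proof.
have -> : (k + i).-1 = (k.-1 + i)%N by case: (k) k_gt0.
by rewrite exprD mulrA; apply: ler_wpM2r.
Qed.

(* Below this threshold on j = |S \ T| the first moment alone would fail. *)
Definition near_overlap j : bool := j%:R ^+ 2 * (n%:R * p ^+ 3) <= lam ^+ 50.

(** For such i the C(i,2) pairs shared by [S] and [T] are all non-edges with probability close to 1,
    so sharing them hardly correlates the two sets. *)
Definition small_meeting i : bool := i%:R ^+ 2 * p * lam ^+ 2 <= 1.

(** The forced edges are decisive here. For small j the number of edges has a bound (e j p)^(3j/2),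
    entered into [near_bound] through g = (e j p)^3. Moreover q^j >= 1/2, so q^i is comparable to
    q^k. *)
Lemma near_term i : (i < k)%N -> near_overlap (k - i) ->
  'C(k, i)%:R * 'C(n, k - i)%:R *
    (q ^+ ('C(k, 2) - 'C(i, 2)) *
     ('C((k - i) ^ 2, uphalf (3 * (k - i)))%:R * p ^+ uphalf (3 * (k - i)))) <=
  u ^+ (k - i).
Proof.
move=> ik; set j := (k - i)%N => nj.
have j0 : (0 < j)%N by rewrite subn_gt0.
have jR : (0 : R) < j%:R by rewrite ltr0n.
have jp0 : 0 <= j%:R * p by rewrite mulr_ge0.
have jp_small : j%:R * p * lam ^+ 25 <= 1.
  rewrite -(ler_pXn2r (n := 2)) ?nnegrE ?mulr_ge0 // expr1n exprMn -exprM.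
  apply: (@cancel _ 50).
  apply: (@le_trans _ _ ((j%:R * p) ^+ 2 * N)); first by rewrite ler_wpM2l ?sqr_ge0.
  by have -> : (j%:R * p) ^+ 2 * N = j%:R ^+ 2 * (n%:R * p ^+ 3) by rewrite /N; ring.
set b := E * j%:R * p.
have b0 : 0 <= b by rewrite /b -mulrA mulr_ge0 // expR_ge0.
have b1 : b <= 1.
  rewrite /b -mulrA; apply: le_trans (decay (m := 25) (r := 1) jp0 isT jp_small).
  rewrite expr1 mulrC; apply: ler_wpM2l => //.
  by have := @lamC2 1 1 isT isT; rewrite mul1r expr1.
set m := uphalf (3 * j).
have m3 : (3 * j <= 2 * m)%N by rewrite mul2n; exact: double_uphalf_ge.
have jm : (j <= m)%N.
  by rewrite -(leq_pmul2l (isT : 0 < 2)%N); apply: leq_trans m3; rewrite leq_mul2r orbT.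
apply: (near_bound (g := b ^+ 3)) => //.
- exact: ltW.
- by rewrite mulr_ge0 // exprn_ge0.
- by rewrite exprn_ge0.
(* C(j^2, m) <= (e j^2 / m)^m <= (e j)^m because m >= j. *)
- have sb : 'C(j ^ 2, m)%:R * p ^+ m <= b ^+ m.
    rewrite /b exprMn; apply: ler_wpM2r; first exact: exprn_ge0.
    have jm0 : (0 : R) < j%:R ^+ m by rewrite exprn_gt0.
    rewrite -(ler_pM2r jm0) -exprMn.
    apply: le_trans (_ : 'C(j ^ 2, m)%:R * m%:R ^+ m <= _).
      by apply: ler_wpM2l => //; apply: lerXn2r; rewrite ?nnegrE // ler_nat.
    by apply: le_trans (bin_le_pow _ _ _) _; rewrite natrX expr2 mulrA.
  apply: le_trans (sqr_le _ sb) _; first by rewrite mulr_ge0 // exprn_ge0.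
  by rewrite -!exprM [(m * 2)%N]mulnC; apply: ler_wiXn2l.
have qj : 1 / 2 <= q ^+ j.
  apply: le_trans (bernoulli_le j p_ge0 p_le1).
  by have := small (m := 25) jp0 isT jp_small; lra.
have qi : q ^+ i <= 2 * y.
  have -> : y = q ^+ j * q ^+ i by rewrite /y -exprD subnK // ltnW.
  have := ler_wpM2r (qX_ge0 i) qj; lra.
have h1 : q ^+ (k + i).-1 <= 4 * y ^+ 2.
  apply: le_trans (q_split i) _.
  have -> : 4 * y ^+ 2 = 2 * (y * (2 * y)) by ring.
  by apply: ler_wpM2l => //; apply: ler_wpM2l => //; exact: ltW.
set L := lam ^+ 2 * _ ^+ 2.
have L0 : 0 <= L by rewrite mulr_ge0 ?sqr_ge0.
have b30 : 0 <= b ^+ 3 by exact: exprn_ge0.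
apply: (@le_trans _ _ (L * (4 * y ^+ 2) * b ^+ 3)).
  by apply: ler_wpM2r => //; apply: ler_wpM2l.
pose Z := 4 * E ^+ 7 * lam ^+ 2 * ((k%:R * n%:R * y) ^+ 2 * p ^+ 3).
have -> : L * (4 * y ^+ 2) * b ^+ 3 = Z * j%:R ^+ 3 by rewrite /L /b /Z; ring.
have Z0 : 0 <= Z.
  apply: mulr_ge0; first by apply: mulr_ge0 => //; exact: mulr_ge0.
  by apply: mulr_ge0; [exact: sqr_ge0|exact: exprn_ge0].
(* Multiplied by n^2 p^3, the factor (k n y)^2 p^3 becomes the square of the quantity bounded by
   lam^7 in [kny]; the product stays below lam^17, against lam^A for n^2 p^3. *)
have Z1 : Z <= 1.
  suff h : Z * lam ^+ A <= lam ^+ A by rewrite -(ler_pM2r (lamX_gt0 A)) mul1r.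
  apply: le_trans (ler_wpM2l Z0 p_large) _.
  have -> : Z * (n%:R ^+ 2 * p ^+ 3) = 4 * E ^+ 7 * lam ^+ 2 *
      (k%:R * n%:R * y * (n%:R * p ^+ 3)) ^+ 2 by rewrite /Z; ring.
  apply: (@le_trans _ _ (lam * lam ^+ 2 * (lam ^+ 7) ^+ 2)).
    apply: ler_pM.
    - by rewrite mulr_ge0 // mulr_ge0.
    - exact: sqr_ge0.
    - by apply: ler_wpM2r => //; exact: lamC2.
    - by apply: sqr_le => //; exact: mulr_ge0.
  by rewrite -exprS -exprM -exprD; apply: lamX; apply: leq_trans A100.
apply: (@le_trans _ _ (1 * j%:R ^+ 3)).
  by apply: ler_wpM2r => //; exact: exprn_ge0.
by rewrite mul1r; apply: ler_weXn2l => //; rewrite ler1n.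
Qed.

(** Since i <= k/T, q^(-i) is at most lam^66, while the failure of [small_meeting] makes D = i n p^2
    at least lam^49. D^2 outweighs q^(-i) and the remaining powers of [lam] in [middle_bound]. *)
Lemma mid_term i : (0 < i)%N -> (i * T <= k)%N -> ~~ small_meeting i ->
  'C(k, i)%:R * 'C(n, k - i)%:R * q ^+ ('C(k, 2) - 'C(i, 2)) <=
  wt_sum n p k * u ^+ i.
Proof.
move=> i0 iT; rewrite /small_meeting -ltNge => Di.
have a1 : a <= 1 by apply: le_trans a_half _; lra.
have ik : (i <= k)%N by apply: leq_trans iT; exact: leq_pmulr.
pose D := i%:R * (n%:R * p ^+ 2).
have D0 : 0 <= D by rewrite !mulr_ge0 // exprn_ge0.
have Dbig : lam ^+ 49 <= D.
  have h : lam ^+ 50 <= D * lam.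
    rewrite -(ler_pXn2r (n := 2)) ?nnegrE ?mulr_ge0 // -exprM.
    have -> : (D * lam) ^+ 2 = (i%:R ^+ 2 * p * lam ^+ 2) * (n%:R ^+ 2 * p ^+ 3).
      by rewrite /D; ring.
    apply: le_trans (_ : 1 * lam ^+ A <= _); first by rewrite mul1r; apply: lamX.
    by apply: ler_pM => //; exact: ltW.
  by rewrite -(ler_pM2r lam_gt0) -exprSr.
have np2_gt0 : 0 < n%:R * p ^+ 2 by rewrite mulr_gt0 // exprn_gt0.
have ani : 2 * (a * n%:R) <= i%:R.
  rewrite -(ler_pM2r np2_gt0) -/D; apply: le_trans Dbig.
  have -> : 2 * (a * n%:R) * (n%:R * p ^+ 2) = 2 * (a * N ^+ 2) by rewrite /N; ring.
  apply: (@le_trans _ _ (lam * lam ^+ 8)); last by rewrite -exprS; apply: lamX.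
  apply: ler_pM => //; [by rewrite mulr_ge0 ?sqr_ge0|exact: lam_nat].
apply: (middle_bound (a := a)) => //.
- exact: ltW.
- by rewrite i0.
- rewrite -(ler_nat R) natrM -(ler_pM2r p_gt0).
  apply: le_trans N_ge100; apply: le_trans (_ : lam ^+ 2 <= _); last exact: lamX.
  rewrite -mulrA expr2; apply: ler_pM => //;
    [exact: mulr_ge0|exact: lam_nat|exact: window_kp_le].
- exact: (@wt_sum_ge _ n p p_ge0 p_le1 k a a1 (erefl a)).
- by apply: pow_1B_expR => //; apply: le_trans a_half _; lra.
have q66 := window_qX_lower iT.
have p40 : 0 < p ^+ 4 by exact: exprn_gt0.
rewrite -(ler_pM2r p40).
apply: (@le_trans _ _ ((D / 2) ^+ 2 * q ^+ i)); last first.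
  by rewrite le_eqVlt; apply/orP; left; apply/eqP; rewrite /D; field.
have -> : (E ^+ 2 * k%:R ^+ 2 * lam) ^+ 2 * p ^+ 4 = E ^+ 4 * lam ^+ 2 * (k%:R * p) ^+ 4 by ring.
apply: (@le_trans _ _ (E ^+ 4 * lam ^+ 2 * lam ^+ 4)).
  apply: ler_wpM2l; first exact: mulr_ge0.
  by apply: lerXn2r; rewrite ?nnegrE ?mulr_ge0 // window_kp_le.
have lam66 := lamX_gt0 66.
rewrite -(ler_pM2r lam66) -[X in _ <= X]mulrA.
apply: (@le_trans _ _ ((D / 2) ^+ 2)); last first.
  by rewrite ler_peMr // sqr_ge0.
have -> : (D / 2) ^+ 2 = D ^+ 2 / 4 by field.
rewrite ler_pdivlMr //.
apply: (@le_trans _ _ ((lam ^+ 49) ^+ 2)); last by apply: sqr_le.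
have -> : E ^+ 4 * lam ^+ 2 * lam ^+ 4 * lam ^+ 66 * 4 =
  (4 * E ^+ 4) * (lam ^+ 2 * lam ^+ 4 * lam ^+ 66) by ring.
rewrite -!exprD -exprM; apply: le_trans (absorb _ (lamC2 _ _)) _ => //.
exact: lamX.
Qed.

(** No edge count is needed in this range; [near_bound] with g = 1 suffices, in two cases according
    to whether j exceeds k/T. *)
Lemma far_term i : (i < k)%N -> (k <= i * T)%N -> ~~ near_overlap (k - i) ->
  'C(k, i)%:R * 'C(n, k - i)%:R * (q ^+ ('C(k, 2) - 'C(i, 2)) * 1) <= u ^+ (k - i).
Proof.
move=> ik iT; set j := (k - i)%N => nj.
have j0 : (0 < j)%N by rewrite subn_gt0.
have jR : (0 : R) < j%:R by rewrite ltr0n.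
apply: (near_bound (g := 1)) => //; [exact: ltW|by rewrite !expr1n|].
rewrite mulr1; set L := lam ^+ 2 * _ ^+ 2.
have L0 : 0 <= L by rewrite mulr_ge0 ?sqr_ge0.
apply: le_trans (ler_wpM2l L0 (q_split i)) _.
have qi0 := qX_ge0 i.
case: (leqP (j * T) k) => jT; last first.
  (* For j > k/T, the denominator j^4 is within T^4 of k^4, and q^i <= lam^(-14) is enough. *)
  have T4 : 0 < T%:R ^+ 4 :> R by rewrite exprn_gt0 // ltr0n.
  rewrite -(ler_pM2r T4) -exprMn.
  apply: (@le_trans _ _ (k%:R ^+ 4)); last first.
    by apply: lerXn2r; rewrite ?nnegrE ?mulr_ge0 // -natrM ler_nat ltnW.
  have p20 : 0 < p ^+ 2 by exact: exprn_gt0.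
  rewrite -(ler_pM2r p20).
  have -> : L * (2 * (y * q ^+ i)) * T%:R ^+ 4 * p ^+ 2 =
      k%:R ^+ 2 * ((2 * E ^+ 4 * T%:R ^+ 4) * lam ^+ 2 * (y * N ^+ 2) * q ^+ i).
    by rewrite /L /N; ring.
  have -> : k%:R ^+ 4 * p ^+ 2 = k%:R ^+ 2 * (k%:R * p) ^+ 2 by ring.
  apply: ler_wpM2l; first exact: sqr_ge0.
  apply: (@le_trans _ _ 1); last by rewrite exprn_ege1 // window_kp_ge1.
  apply: le_trans (decay (m := 14) (r := 9) qi0 isT (window_qX_upper iT)).
  rewrite mulrC; apply: ler_wpM2l => //.
  rewrite -[9%N]/(1 + 2 + 6)%N !exprD expr1.
  apply: ler_pM.
  - by rewrite !mulr_ge0 ?exprn_ge0.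
  - by rewrite mulr_ge0 ?sqr_ge0 // ltW.
  - by apply: ler_wpM2r => //; exact: lamC3.
  - exact: w_upper.
(* For j <= k/T, q^i is within lam^66 of q^k; the square of j^2 n p^3 > lam^50 covers a total of
   lam^83. *)
have q66 := window_qX_lower jT.
have qi : q ^+ i <= y * lam ^+ 66.
  have -> : y = q ^+ i * q ^+ j by rewrite /y -exprD addnC subnK // ltnW.
  by rewrite -mulrA ler_peMr.
have np3 : 0 < n%:R * p ^+ 3 by rewrite mulr_gt0 // exprn_gt0.
have np32 : 0 < (n%:R * p ^+ 3) ^+ 2 by exact: exprn_gt0.
rewrite -(ler_pM2r np32).
have -> : j%:R ^+ 4 * (n%:R * p ^+ 3) ^+ 2 = (j%:R ^+ 2 * (n%:R * p ^+ 3)) ^+ 2 by ring.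
move: nj; rewrite /near_overlap -ltNge => /ltW nj.
apply: le_trans (sqr_le (lamX_ge0 50) nj).
apply: (@le_trans _ _ (L * (2 * (y * (y * lam ^+ 66))) * (n%:R * p ^+ 3) ^+ 2)).
  apply: ler_wpM2r; first exact: ltW.
  by apply: ler_wpM2l => //; apply: ler_wpM2l => //; apply: ler_wpM2l => //; exact: ltW.
have lam66 := lamX_ge0 66.
set l66 := lam ^+ 66 in lam66 *.
have -> : L * (2 * (y * (y * l66))) * (n%:R * p ^+ 3) ^+ 2 =
    (2 * E ^+ 4) * (lam ^+ 2 * l66) * (k%:R * n%:R * y * (n%:R * p ^+ 3)) ^+ 2.
  by rewrite /L; ring.
apply: (@le_trans _ _ (lam * (lam ^+ 2 * l66) * (lam ^+ 7) ^+ 2)).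
  apply: ler_pM.
  - by apply: mulr_ge0; rewrite ?mulr_ge0.
  - exact: sqr_ge0.
  - by apply: ler_wpM2r; [rewrite mulr_ge0|exact: lamC2].
  - by apply: sqr_le => //; exact: mulr_ge0.
by rewrite /l66 -exprD -exprS -!exprM -exprD; apply: lamX.
Qed.

(** The value 0 at i = 0, where [small_meeting] always holds, lets the second summand start its
    geometric series at u. *)
Lemma window_term i : (i < k)%N -> ~~ small_meeting i ->
  'C(k, i)%:R * 'C(n, k - i)%:R * far_factor k p near_overlap i <=
  2 * u ^+ (k - i) + 2 * wt_sum n p k * (if i == 0%N then 0 else u ^+ i).
Proof.
move=> ik ci.
have i0 : (0 < i)%N.
  by rewrite lt0n; apply: contraNneq ci => ->; rewrite /small_meeting expr0n /= !mul0r.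
rewrite gtn_eqF //.
have a1 : a <= 1 by apply: le_trans a_half _; lra.
have M0 : 0 <= wt_sum n p k.
  by apply: sumr_ge0 => S /eqP cS; exact: (wt_ge0 p_ge0 p_le1 a1 (erefl a)).
have h1 : 0 <= 2 * u ^+ (k - i) by rewrite mulr_ge0 ?exprn_ge0.
have h2 : 0 <= 2 * wt_sum n p k * u ^+ i by rewrite mulr_ge0 ?exprn_ge0 ?mulr_ge0.
have Q0 : 0 <= 'C(k, i)%:R * 'C(n, k - i)%:R :> R by exact: mulr_ge0.
rewrite /far_factor mulrCA /edge_factor; case: ifPn => nj.
  apply: (@le_trans _ _ (2 * u ^+ (k - i))); last by rewrite lerDl.
  by rewrite ler_wpM2l // near_term.
case: (leqP (i * T) k) => iT.
  apply: (@le_trans _ _ (2 * wt_sum n p k * u ^+ i)); last by rewrite lerDr.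
  by rewrite -mulrA ler_wpM2l // mulr1 mid_term.
apply: (@le_trans _ _ (2 * u ^+ (k - i))); last by rewrite lerDl.
by rewrite ler_wpM2l // far_term // ltnW.
Qed.

(** The term i = k, which is T = S, is split off and contributes at most 2; the others form two
    geometric series, one in k - i and one in i. *)
Lemma window_sum :
  \sum_(i < k.+1 | ~~ small_meeting i) 'C(k, i)%:R * 'C(n, k - i)%:R * far_factor k p near_overlap i <=
  4 + 4 * u * wt_sum n p k.
Proof.
set M := wt_sum n p k.
have a1 : a <= 1 by apply: le_trans a_half _; lra.
have M0 : 0 <= M.
  by apply: sumr_ge0 => S /eqP cS; exact: (wt_ge0 p_ge0 p_le1 a1 (erefl a)).
have u2 : u <= 1 / 2 by have := u_small; lra.
rewrite big_mkcond big_ord_recr /=.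
set last_term := (X in _ + X); set main := \sum_(_ < k) _.
have hlast : last_term <= 2.
  rewrite /last_term; case: ifP => // _.
  rewrite /far_factor /edge_factor !subnn binn bin0.
  by case: ifP => _; rewrite ?muln0 /= ?expr0 ?bin0 ?mulr1 ?mul1r.
pose g i : R := if i == 0%N then 0 else u ^+ i.
have hmain : main <= \sum_(i < k) (2 * u ^+ (k - i) + 2 * M * g i).
  apply: ler_sum => i _; case: ifPn => ci; first by apply: window_term.
  rewrite addr_ge0 ?mulr_ge0 ?exprn_ge0 // /g; case: ifP => // _; exact: exprn_ge0.
have s1 : \sum_(i < k) u ^+ (k - i) <= 2 * u.
  rewrite (reindex_inj rev_ord_inj) /=; apply: (@geometric_sum_le R u (fun i => u ^+ (k - (k - i.+1)))) => // i ik.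
  by rewrite subKn.
have s2 : \sum_(i < k) g i <= 2 * u.
  case: (k) => [|k']; first by rewrite big_ord0 mulr_ge0.
  by rewrite big_ord_recl /= add0r; exact: (@geometric_sum_le R u (fun i => u ^+ i.+1)).
have hs : \sum_(i < k) (2 * u ^+ (k - i) + 2 * M * g i) =
    2 * \sum_(i < k) u ^+ (k - i) + 2 * M * \sum_(i < k) g i.
  by rewrite big_split /= -!mulr_sumr.
have s3 : 2 * M * \sum_(i < k) g i <= 2 * M * (2 * u) by rewrite ler_wpM2l // mulr_ge0.
apply: (@le_trans _ _ (2 * (2 * u) + 2 * M * (2 * u) + 2)).
  apply: lerD => //; apply: le_trans hmain _; rewrite hs; apply: lerD => //.
  by rewrite ler_wpM2l.
have -> : 2 * M * (2 * u) = 4 * u * M by ring.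
lra.
Qed.

Lemma window_lower_tail : lam <= wt_sum n p k ->
  gnp_prob p (fun G : graph n => (indep_number G < k)%N) <= 40 * u.
Proof.
move=> Mlam; set M := wt_sum n p k in Mlam.
have a2 : a <= 1 / 2 by apply: le_trans a_half _; lra.
have M0 : 0 < M by exact: lt_le_trans Mlam.
have ka0 : 0 <= k%:R * a by exact: mulr_ge0.
have kau : 2 * (k%:R * a) <= u by apply: le_u => //; exact: decay ka_small.
have u1 : u <= 1 by have := u_small; lra.
apply: (@le_trans _ _ (8 * (4 * u) + 8 / M)); last first.
  have : M^-1 <= u by rewrite lef_pV2 ?posrE.
  lra.
apply: (@Pr_indep_number_lt R n p p_ge0 p_le1 k a (4 * u) small_meeting (far_factor k p near_overlap)) => //.
- by rewrite mulr_ge0.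
- by have := u_small; lra.
- by move=> i; apply: far_factor_ge0.
- apply: (@le_trans _ _ (1%:R * u)); last first.
    have : 1 / 4 <= (1 - a) ^+ 2.
      have -> : 1 / 4 = (1 / 2) ^+ 2 :> R by field.
      by apply: sqr_le; lra.
    move=> /(ler_wpM2l u_ge0); rewrite mul1r.
    have -> : 4 * u * (1 - a) ^+ 2 = 4 * (u * (1 - a) ^+ 2) by ring.
    lra.
  rewrite mul1r -[X in X <= _]mul1r; apply: (le_u (c := 1)) => //.
    by rewrite !mulr_ge0 ?sqr_ge0.
  by apply: decay cherry_small; rewrite // !mulr_ge0 ?sqr_ge0.
- move=> S U cS cU cl; apply: (Pr_weak_pair_close p_ge0 p_le1 (erefl a)) => //.
  + exact: window_kp_ge1.
  + apply: le_u => //; first by rewrite mulr_ge0 ?sqr_ge0.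
    by apply: decay na2_small; rewrite // mulr_ge0 ?sqr_ge0.
  + by rewrite -[X in X <= _]mul1r; apply: (le_u (c := 1)) => //; rewrite mulr_ge0 ?sqr_ge0.
- move=> S U cS cU _; apply: (Pr_strong_pair_far p_ge0 p_le1 (erefl a)) => //.
  exact: le_trans kau u1.
- exact: window_sum.
Qed.

(** The square of C(n,k) q^C(k,2) is at least (n^2 y / k^2)^k = (y N^2 / (kp)^2)^k >= lam^(3k),
    which exceeds (lam e^k)^2; the factor e^k then pays for (1 - a)^n. *)
Lemma window_start : lam ^+ 5 <= y * N ^+ 2 -> lam <= wt_sum n p k.
Proof.
move=> w5.
have a2 : a <= 1 / 2 by apply: le_trans a_half _; lra.
have a1 : a <= 1 by lra.
have np2_gt0 : 0 < n%:R * p ^+ 2 by rewrite mulr_gt0 // exprn_gt0.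
have ank : 2 * (a * n%:R) <= k%:R.
  rewrite -(ler_pM2r np2_gt0).
  have -> : 2 * (a * n%:R) * (n%:R * p ^+ 2) = 2 * (a * N ^+ 2) by rewrite /N; ring.
  have -> : k%:R * (n%:R * p ^+ 2) = (k%:R * p) * N by rewrite /N; ring.
  apply: (@le_trans _ _ (lam * lam ^+ 8)).
    by apply: ler_pM => //; [by rewrite mulr_ge0 ?sqr_ge0|exact: lam_nat].
  rewrite -exprS; apply: (@le_trans _ _ (lam ^+ 100)); first exact: lamX.
  by apply: le_trans N_ge100 _; rewrite ler_peMl // window_kp_ge1.
have kn : (k <= n)%N.
  rewrite -(ler_nat R) -(ler_pM2r p_gt0); apply: le_trans window_kp_le _.
  by apply: le_trans N_ge100; apply: (@lamX 1 100).
set s := 'C(n, k)%:R * q ^+ 'C(k, 2).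
have s0 : 0 <= s by rewrite mulr_ge0.
have kR : (0 : R) < k%:R by rewrite ltr0n.
have k2k : 0 < (k%:R ^+ 2 : R) ^+ k by rewrite !exprn_gt0.
have hs : (lam ^+ 3) ^+ k <= s ^+ 2.
  rewrite -(ler_pM2r k2k).
  apply: (@le_trans _ _ ((n%:R ^+ 2 * y) ^+ k)).
    have y0 : 0 <= y by exact: ltW.
    rewrite -exprMn; apply: lerXn2r;
      [by rewrite nnegrE mulr_ge0 ?sqr_ge0|by rewrite nnegrE mulr_ge0 ?sqr_ge0|].
    have p2 : 0 < p ^+ 2 by exact: exprn_gt0.
    rewrite -(ler_pM2r p2).
    have -> : n%:R ^+ 2 * y * p ^+ 2 = y * N ^+ 2 by rewrite /N; ring.
    apply: le_trans w5; rewrite -mulrA -exprMn -[5%N]/(3 + 2)%N exprD.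
    by apply: ler_wpM2l => //; apply: sqr_le; [exact: mulr_ge0|exact: window_kp_le].
  have -> : s ^+ 2 * (k%:R ^+ 2) ^+ k =
      ('C(n, k)%:R * k%:R ^+ k) ^+ 2 * (q ^+ (k * k.-1)).
    by rewrite -bin2_double mulnC exprM [(k%:R ^+ 2) ^+ k]exprAC /s; ring.
  rewrite exprMn; apply: ler_pM; [by rewrite exprn_ge0|by rewrite exprn_ge0 // ltW| |].
    by rewrite exprAC; apply: sqr_le; [exact: exprn_ge0|exact: pow_le_bin].
  by rewrite /y -exprM; apply: q_le; rewrite leq_mul2l leq_pred orbT.
have hs2 : lam * E ^+ k <= s.
  rewrite -(ler_pXn2r (n := 2)) ?nnegrE ?mulr_ge0 //; apply: le_trans hs.
  have -> : (lam ^+ 3) ^+ k = (lam ^+ 2) ^+ k * lam ^+ k by rewrite -exprMn -exprSr.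
  rewrite exprMn [(E ^+ k) ^+ 2]exprAC.
  apply: ler_pM; [exact: sqr_ge0|by apply: exprn_ge0; exact: sqr_ge0| |].
    by rewrite -exprM; apply: lamX; rewrite leq_pmulr.
  apply: lerXn2r; rewrite ?nnegrE ?sqr_ge0 //.
  by have := @lamC2 2 1 isT isT; rewrite mul1r.
apply: le_trans (@wt_sum_ge _ n p p_ge0 p_le1 k a a1 (erefl a)).
rewrite mulrA -/q -/s.
have X0 : 0 <= (1 - a) ^+ n by rewrite exprn_ge0 // subr_ge0.
apply: le_trans (ler_wpM2r X0 hs2).
rewrite -mulrA ler_peMr //.
by rewrite [E ^+ k * _]mulrC; exact: pow_1B_expR.
Qed.

(** The ratio is about n q^k / (k + 1) <= N q^k, using (k + 1) p >= 1, and N q^k <= lam^6 / N is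
    tiny. The factor [V] from the change of badness is at most 2 since aN is tiny. *)
Lemma window_ratio : wt_sum n p k.+1 <= u ^+ 2 * wt_sum n p k.
Proof.
set M' := wt_sum n p k.+1; set M := wt_sum n p k.
have a2 : a <= 1 / 2 by apply: le_trans a_half _; lra.
have a1 : a <= 1 by lra.
have aN0 : 0 <= a * N by exact: mulr_ge0.
have aN : 2 * (a * N) <= u.
  apply: le_u => //; apply: decay (_ : a * N * lam ^+ 92 <= 1) => //.
  apply: (@cancel _ 8); apply: le_trans a_bound; rewrite -mulrA expr2.
  by apply: ler_wpM2l => //; apply: ler_wpM2l.
have M0 : 0 <= M.
  by apply: sumr_ge0 => S /eqP cS; exact: (wt_ge0 p_ge0 p_le1 a1 (erefl a)).
have M'0 : 0 <= M'.
  apply: sumr_ge0 => S _; rewrite -Pr_weak //; exact: Pr_ge0.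
have := @wt_sum_ratio R n p p_ge0 p_le1 k.-1 a.
rewrite prednK // => /(_ (erefl a) a2); rewrite -/q -/y -/M -/M'.
set V := (1 + 2 * p * a) ^+ n => main.
have V2 : V <= 2.
  have := @pow1D_le R (2 * p * a) n; rewrite -/V => hV.
  have h1 : 1 / 2 <= 1 - n%:R * (2 * p * a).
    have -> : n%:R * (2 * p * a) = 2 * (a * N) by rewrite /N; ring.
    by have := u_small; lra.
  have pa0 : 0 <= 2 * p * a by apply: mulr_ge0 => //; exact: mulr_ge0.
  have V0 : 0 <= V by apply: exprn_ge0; apply: addr_ge0.
  have := ler_wpM2l V0 h1; have := hV pa0; lra.
have yN0 : 0 <= y * N by rewrite mulr_ge0 // ltW.
have yN : 4 * (y * N) <= u ^+ 2.
  have h : y * N * lam ^+ 94 <= 1.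
    apply: (@cancel _ 6); apply: le_trans w_upper; rewrite -mulrA expr2.
    by apply: ler_wpM2l; [exact: ltW|apply: ler_wpM2l].
  have h1 : 4 * (y * N * lam) <= u.
    apply: le_u => //; first by rewrite mulr_ge0.
    have -> : y * N * lam * lam ^+ 2 = y * N * lam ^+ 3 by ring.
    exact: decay h.
  have -> : 4 * (y * N) = 4 * (y * N * lam) * u by field; rewrite gt_eqF.
  by rewrite expr2 ler_wpM2r.
have kp1 : 1 <= k.+1%:R * p.
  by apply: le_trans window_kp_ge1 _; rewrite ler_wpM2r // ler_nat.
have h1 : (1 - a) * M' <= 2 * (y * N) * M.
  have a10 : 0 <= (1 - a) * M' by rewrite mulr_ge0 //; lra.
  apply: (@le_trans _ _ (k.+1%:R * p * ((1 - a) * M'))); first by rewrite ler_peMl.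
  rewrite mulrAC; apply: le_trans (ler_wpM2r p_ge0 main) _.
  have -> : n%:R * (y * V * M) * p = V * (y * N * M) by rewrite /N; ring.
  by rewrite -[X in _ <= X]mulrA; apply: ler_wpM2r => //; rewrite mulr_ge0.
have h2 : 1 / 2 * M' <= (1 - a) * M' by apply: ler_wpM2r => //; lra.
have h3 := ler_wpM2r M0 yN.
have h4 : 4 * (y * N) * M = 2 * (2 * (y * N) * M) by ring.
rewrite h4 in h3; lra.
Qed.

End Window.
Local Notation u := (lam^-1).

Let g k := q ^+ k * N ^+ 2.

Let g_ge0 k : 0 <= g k. Proof. by rewrite mulr_ge0 ?sqr_ge0. Qed.

Let g_anti k m : (k <= m)%N -> g m <= g k.
Proof. by move=> km; rewrite ler_wpM2r ?sqr_ge0 //; apply: ler_wiXn2l => //; exact: ltW. Qed.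

Let g_step k : g k <= 2 * g k.+1.
Proof.
have -> : g k.+1 = q * g k by rewrite /g (exprS q k) mulrA.
by have := ler_wpM2r (g_ge0 k) q_ge; lra.
Qed.

Let g0 : lam ^+ 200 <= g 0.
Proof. by rewrite /g expr0 mul1r. Qed.

Let g_end : lam ^+ 5 * g n < 1.
Proof.
have h1 : expR N * g n <= N ^+ 2.
  rewrite /g mulrA ler_piMl ?sqr_ge0 //.
  have := ler_wpM2l (expR_ge0 N) (qX_upper n).
  by rewrite [p * _]mulrC -/N expRN divff // gt_eqF // expR_gt0.
have h2 : lam ^+ (T * 60 + 20) <= expR N.
  apply: le_trans lamE _; rewrite ler_expR; apply: le_trans N_ge100.
  exact: (@lamX 1 100).
have h3 : g n * lam ^+ 20 <= 1.
  apply: (@cancel _ (T * 60)); rewrite mulrC; apply: le_trans N2_le.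
  by apply: le_trans h1; apply: ler_wpM2r.
rewrite mulrC; apply: lt_le_trans h3; rewrite ltr_pM2l.
  by rewrite ltr_eXn2l // (lt_le_trans _ (lam_nat (c := 2) _)) // ltr1n.
by rewrite mulr_gt0 ?exprn_gt0.
Qed.

(** [g] decreases from at least lam^200 to below lam^(-5), by a factor of at most 2 per step. [K1]
    is the last index before [g] falls under lam^5 and [K2] the first with lam^5 * g < 1; the factor
    2 is what lam^6 allows beyond lam^5. *)
Lemma exists_window : exists K1 K2 : nat, [/\ (K1 <= K2)%N,
  forall k, (K1 <= k <= K2)%N -> g k <= lam ^+ 6 /\ 1 <= lam ^+ 6 * g k,
  lam ^+ 5 <= g K1 & lam ^+ 5 * g K2 <= 1].
Proof.
have ex1 : exists k, g k < lam ^+ 5.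
  exists n; rewrite -(ltr_pM2l (lamX_gt0 5)); apply: lt_le_trans g_end _.
  by rewrite -exprD.
have ex2 : exists k, lam ^+ 5 * g k < 1 by exists n.
case: (ex_minnP ex1) => k1 hk1 min1; case: (ex_minnP ex2) => K2 hK2 min2.
have k1_gt0 : (0 < k1)%N.
  rewrite lt0n; apply: contraTneq hk1 => ->; rewrite -leNgt; apply: le_trans g0.
  exact: lamX.
have gK1 : lam ^+ 5 <= g k1.-1.
  by rewrite leNgt; apply/negP => /min1; rewrite leqNgt prednK // leqnn.
have K12 : (k1.-1 < K2)%N.
  rewrite ltnNge; apply/negP => /g_anti h.
  have h1 : 1 <= lam ^+ 5 * g K2.
    apply: le_trans (_ : lam ^+ 5 * lam ^+ 5 <= _); first by rewrite -exprD.
    by apply: ler_wpM2l => //; apply: le_trans h.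
  by move: hK2; rewrite ltNge h1.
have gK2 : 1 <= lam ^+ 5 * g K2.-1.
  rewrite leNgt; apply/negP => /min2; rewrite leqNgt prednK ?leqnn //.
  exact: leq_ltn_trans K12.
have two : 2 * lam ^+ 5 <= lam ^+ 6 by apply: absorb; exact: lam_nat.
exists k1.-1, K2; split=> //; [exact: ltnW| |exact: ltW].
move=> k /andP[K1k kK2]; split.
  apply: le_trans (g_anti K1k) _; apply: le_trans (g_step _) _; rewrite prednK //.
  by apply: le_trans two; rewrite ler_pM2l //; exact: ltW.
apply: (@le_trans _ _ (lam ^+ 6 * g K2)); last by rewrite ler_pM2l // g_anti.
apply: (@le_trans _ _ (2 * lam ^+ 5 * g K2)); last by rewrite ler_wpM2r.
apply: le_trans gK2 _; rewrite [2 * _]mulrC -[X in _ <= X]mulrA ler_pM2l //.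
by apply: le_trans (g_step _) _; rewrite prednK // (leq_ltn_trans _ K12).
Qed.

(** At the far end of the window the plain first moment is already small, which disposes of all
    larger values of the independence number at once. *)
Let window_end k : lam ^+ 5 * g k <= 1 -> 1 <= k%:R * p ->
  'C(n, k)%:R * q ^+ 'C(k, 2) <= u.
Proof.
move=> hg kp1.
have u0 : 0 <= u by rewrite invr_ge0.
have u1 : u <= 1 by rewrite invf_le1.
have k0 : (0 < k)%N by rewrite lt0n; apply: contraTneq kp1 => ->; rewrite mul0r -ltNge.
have kR : (0 : R) < k%:R by rewrite ltr0n.
have k2k : 0 < (k%:R ^+ 2 : R) ^+ k by rewrite !exprn_gt0.
set s := 'C(n, k)%:R * _.
have s0 : 0 <= s by rewrite mulr_ge0.
apply: (@le_trans _ _ (u ^+ k)); last by rewrite -[X in _ <= X]expr1; apply: ler_wiXn2l.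
rewrite -(ler_pXn2r (n := 2)) ?nnegrE ?exprn_ge0 // -(ler_pM2r k2k).
have -> : s ^+ 2 * (k%:R ^+ 2) ^+ k =
    ('C(n, k)%:R * k%:R ^+ k) ^+ 2 * (q ^+ k.-1) ^+ k.
  rewrite -[(q ^+ k.-1) ^+ k]exprM [(k.-1 * k)%N]mulnC -bin2_double mulnC exprM.
  by rewrite [(k%:R ^+ 2) ^+ k]exprAC /s; ring.
apply: (@le_trans _ _ (((E * n%:R) ^+ k) ^+ 2 * (q ^+ k.-1) ^+ k)).
  apply: ler_wpM2r; first exact: exprn_ge0.
  by apply: sqr_le; [rewrite mulr_ge0 ?exprn_ge0|exact: bin_le_pow].
rewrite exprAC -exprMn [X in _ <= X * _]exprAC -exprMn.
apply: lerXn2r;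
  [by rewrite nnegrE mulr_ge0 ?sqr_ge0|by rewrite nnegrE mulr_ge0 ?sqr_ge0|].
have p2 : 0 < p ^+ 2 by exact: exprn_gt0.
have l2 : 0 < lam ^+ 2 by exact: exprn_gt0.
rewrite -(ler_pM2r p2) -(ler_pM2r l2).
have -> : u ^+ 2 * k%:R ^+ 2 * p ^+ 2 * lam ^+ 2 = (k%:R * p) ^+ 2 by field; rewrite gt_eqF.
apply: (@le_trans _ _ 1); last by rewrite exprn_ege1.
apply: le_trans hg.
have hq : q ^+ k.-1 * N ^+ 2 <= 2 * g k.
  by have := g_step k.-1; rewrite prednK.
have -> : (E * n%:R) ^+ 2 * q ^+ k.-1 * p ^+ 2 * lam ^+ 2 =
    E ^+ 2 * lam ^+ 2 * (q ^+ k.-1 * N ^+ 2) by rewrite /N; ring.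
apply: (@le_trans _ _ (E ^+ 2 * lam ^+ 2 * (2 * g k))).
  by apply: ler_wpM2l => //; rewrite mulr_ge0.
have -> : E ^+ 2 * lam ^+ 2 * (2 * g k) = (2 * E ^+ 2) * lam ^+ 2 * g k by ring.
apply: ler_wpM2r; first exact: g_ge0.
apply: le_trans (absorb _ (lamC2 _ _)) _ => //.
exact: lamX.
Qed.

Lemma sparse_two_point : exists f : nat,
  1 - 64 * u <= gnp_prob p (fun G : graph n => (f <= indep_number G <= f.+1)%N).
Proof.
have u0 : 0 <= u by rewrite invr_ge0.
have u64 : u <= 1 / 64 by rewrite div1r lef_pV2 ?posrE // lam_nat.
have [K1 [K2 [K12 win start stop]]] := exists_window.
have winK1 := win K1; rewrite leqnn K12 /= in winK1.
have [wK1 wK1'] := winK1 isT.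
pose P f := (K1 <= f <= K2)%N && (lam <= wt_sum n p f).
have PK1 : exists f, P f by exists K1; rewrite /P leqnn K12 /= (window_start wK1 wK1').
have Pbound f : P f -> (f <= K2)%N by move=> /andP[/andP[]].
case: (ex_maxnP PK1 Pbound) => f /andP[fK lamf] fmax.
have [K1f fK2] := andP fK; have [wf wf'] := win f fK.
have lower := window_lower_tail wf wf' lamf.
(* Maximality of [f] starts the induction with wt_sum at f + 1 below [lam]; two steps past [f] the
   sum is thus at most 1/lam. *)
have ratio t : (f.+1 + t <= K2)%N -> wt_sum n p (f.+1 + t)%N <= lam * (u ^+ 2) ^+ t.
  elim: t => [|t IH] ht.
    rewrite addn0 in ht *; rewrite expr0 mulr1 leNgt; apply/negP => hl.
    have : P f.+1 by apply/andP; split; [rewrite ht (leq_trans K1f)|exact: ltW].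
    by move=> /fmax; rewrite ltnn.
  have ht' : (f.+1 + t <= K2)%N by apply: leq_trans ht; rewrite addnS.
  have [w1 w2] : g (f.+1 + t)%N <= lam ^+ 6 /\ 1 <= lam ^+ 6 * g (f.+1 + t)%N.
    by apply: win; rewrite ht' (leq_trans K1f) // addSnnS leq_addr.
  rewrite addnS exprS mulrCA; apply: le_trans (window_ratio w1 w2) _.
  by apply: ler_wpM2l (IH ht'); exact: sqr_ge0.
have kp2 : 1 <= K2%:R * p.
  by have [w1 w2] := win K2 (introT andP (conj K12 (leqnn K2))); exact: window_kp_ge1 w1.
have upper : gnp_prob p (fun G : graph n => (f.+2 <= indep_number G)%N) <= 3 * u.
  pose m := (K2 - f.+1)%N.
  pose B (t : 'I_m) (G : graph n) := indep_number G == (f.+2 + t)%N.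
  (* Values from f + 2 up to the window's end are treated one by one with weak sets, values from
     [K2] on by [window_end]. *)
  apply: le_trans (_ : gnp_prob p (fun G : graph n => (K2 <= indep_number G)%N ||
      [exists t in predT, B t G]) <= _).
    apply: le_Pr => // G h; case: (leqP K2 (indep_number G)) => //= h2.
    have tm : (indep_number G - f.+2 < m)%N by exact: ltn_sub_shift.
    by apply/exists_inP; exists (Ordinal tm) => //; rewrite /B /= subnKC.
  apply: le_trans (Pr_or p_ge0 p_le1 _ _) _.
  have -> : 3 * u = u + 2 * u by ring.
  apply: lerD.
    exact: le_trans (@Pr_indep_number_ge R n p p_ge0 p_le1 K2) (window_end stop kp2).
  apply: le_trans (Pr_exists p_ge0 p_le1 _ _) _.
  apply: (@le_trans _ _ (\sum_(t < m) lam * (u ^+ 2) ^+ t.+1)).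
    apply: ler_sum => t _; apply: le_trans (@Pr_indep_number_eq R n p p_ge0 p_le1 _) _.
    rewrite addSnnS; apply: ratio; rewrite -addSnnS.
    by have := ltn_ord t; rewrite /m ltn_subRL.
  rewrite -mulr_sumr.
  have u2 : u ^+ 2 <= 1 / 2.
    by rewrite expr2; have := ler_wpM2l u0 u64; lra.
  have := @geometric_sum_le R (u ^+ 2) (fun t => (u ^+ 2) ^+ t.+1) m (sqr_ge0 _) u2 (fun _ _ => lexx _).
  move=> /(ler_wpM2l lam_ge0) /le_trans; apply.
  by rewrite le_eqVlt; apply/orP; left; apply/eqP; field; rewrite gt_eqF.
exists f.
have tot := Pr_two_values_ge n p_ge0 p_le1 f.
lra.
Qed.

End SparseRegime.

(** * Dense regime *)

Section VanillaMoments.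
Variables (R : realType) (n k : nat) (p : R).
Hypotheses (p0 : 0 <= p) (p1 : p <= 1).
Let q := 1 - p.
Let q_ge0 : 0 <= q. Proof. by rewrite subr_ge0. Qed.

Lemma Pr_independent_pair (S T : {set 'I_n}) : #|S| = k -> #|T| = k ->
  gnp_prob p (fun G : graph n => independent G S && independent G T) =
  q ^+ 'C(k, 2) * q ^+ ('C(k, 2) - 'C(#|S :&: T|, 2)).
Proof.
move=> cS cT; rewrite -exprD -[in RHS]cS -card_innerU ?cS //.
rewrite -Pr_avoid //; apply: eq_Pr => G.
by rewrite !independentE -!setI_eq0 setIUl setU_eq0.
Qed.

(** Two sets meeting in at most one vertex share no pair, so their independence events are exactly
    independent; only larger intersections enter the hypothesis. *)
Lemma Pr_no_independent (e : R) : 0 <= e ->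
  let M := 'C(n, k)%:R * q ^+ 'C(k, 2) in 0 < M ->
  \sum_(i < k.+1 | ~~ (i <= 1)%N)
    'C(k, i)%:R * 'C(n, k - i)%:R * q ^+ ('C(k, 2) - 'C(i, 2)) <= 2 + e * M ->
  gnp_prob p (fun G : graph n => (indep_number G < k)%N) <= 2 / M + e.
Proof.
move=> e0 M M0 hsum.
have sumM : \sum_(S : {set 'I_n} | #|S| == k) gnp_prob p (fun G : graph n => independent G S) = M.
  rewrite (eq_bigr (fun _ => q ^+ 'C(k, 2))); last first.
    by move=> S /eqP cS; rewrite Pr_independent cS.
  rewrite sumr_const -[LHS]mulr_natl /M; congr (_%:R * _).
  rewrite -[n in RHS]card_ord -card_draws.
  by apply: eq_card => S; rewrite !inE.
have pairs : \sum_(S : {set 'I_n} | #|S| == k) \sum_(T : {set 'I_n} | #|T| == k)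
    gnp_prob p (fun G : graph n => independent G S && independent G T) <=
    M ^+ 2 + M * (2 + e * M).
  have -> : M ^+ 2 + M * (2 + e * M) = \sum_(S : {set 'I_n} | #|S| == k)
      (q ^+ 'C(k, 2) * M + q ^+ 'C(k, 2) * (2 + e * M)).
    rewrite big_split /= -!mulr_suml.
    have -> : \sum_(S : {set 'I_n} | #|S| == k) q ^+ 'C(k, 2) = M.
      by rewrite -sumM; apply: eq_bigr => S /eqP cS; rewrite Pr_independent cS.
    by rewrite expr2.
  apply: ler_sum => S /eqP cS.
  rewrite (eq_bigr (fun T => q ^+ 'C(k, 2) *
      q ^+ ('C(k, 2) - 'C(#|S :&: T|, 2)))); last first.
    by move=> T /eqP cT; exact: Pr_independent_pair.
  rewrite (bigID (fun T => (#|S :&: T| <= 1)%N)) /= -!mulr_sumr; apply: lerD.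
    apply: ler_wpM2l; first exact: exprn_ge0.
    rewrite -sumM [X in _ <= X](bigID (fun T => (#|S :&: T| <= 1)%N)) /=.
    rewrite -[X in X <= _]addr0; apply: lerD; last by apply: sumr_ge0 => T _; exact: Pr_ge0.
    apply: ler_sum => T /andP[/eqP cT iT]; rewrite Pr_independent cT.
    by move: iT; case: (#|_|) => [|[|i]] // _; rewrite subn0.
  apply: ler_wpM2l; first exact: exprn_ge0.
  apply: le_trans hsum.
  apply: (@sum_by_meeting R n (fun i => q ^+ ('C(k, 2) - 'C(i, 2))) (fun i => ~~ (i <= 1)%N)) => //.
  by move=> i; exact: exprn_ge0.
have := Pr_second_moment_sized p0 p1 (fun (S : {set 'I_n}) (G : graph n) => independent G S) k.
rewrite sumM; set P := gnp_prob _ _ => hP.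
have PP : gnp_prob p (fun G : graph n => (indep_number G < k)%N) <= P.
  apply: le_Pr => // G; rewrite ltnNge => nge; apply: contra nge.
  move=> /existsP[S /andP[/eqP cS iS]].
  by apply/indep_number_geP; exists S.
apply: le_trans PP _.
have M20 : 0 < M ^+ 2 by exact: exprn_gt0.
rewrite -(ler_pM2r M20); apply: le_trans hP _.
have -> : (2 / M + e) * M ^+ 2 = M * (2 + e * M) by field; rewrite gt_eqF.
by rewrite lerBlDl.
Qed.

End VanillaMoments.

(** With n^2 q^(k-1) >= 1 this yields (n^2 q^i)^3 >= n^2. Equality holds at i = 2, k = 4. *)
Lemma dense_small_exponent i k : (1 < i -> 2 * i <= k -> i * 3 <= k.-1 * 2)%N.
Proof. lia. Qed.

(** Yields (n^2 q^(k+i-1))^3 n^2 <= (n^2 q^k)^4, so that n^2 q^(k+i-1) is a negative power of n up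
    to powers of [lam]. Equality holds at i = 2, k = 3. *)
Lemma dense_large_exponent i k :
  (1 < i -> i < k -> k < 2 * i -> k * 4 <= (k + i).-1 * 3)%N.
Proof. lia. Qed.

Section DenseRegime.
Variables (R : realType) (n T A C : nat) (p lam : R).
Local Notation E := (expR 1 : R).
Hypotheses (p_gt0 : 0 < p) (p_le1 : p <= 1).
Hypotheses (T50 : (50 <= T)%N) (A100 : (A <= 100)%N) (C64 : (64 <= C)%N).
Hypothesis lamC : C%:R * E ^+ 8 <= lam.
Hypothesis nE : n%:R = lam ^+ (T * 30).
Hypothesis p_large : 1 <= p * lam ^+ A.
Hypothesis lamE : lam ^+ (T * 60) <= expR lam.
Let q := 1 - p.
Local Notation u := (lam^-1).

Let p_ge0 : 0 <= p. Proof. exact: ltW. Qed.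
Let E1 : 1 <= E.
Proof. by apply: le_trans (expR_ge1Dx 1); rewrite lerDl. Qed.
Let EX_ge0 m : 0 <= E ^+ m. Proof. by apply: exprn_ge0; exact: expR_ge0. Qed.
Let lamC2 m c : (m <= 8)%N -> (c <= 64)%N -> c%:R * E ^+ m <= lam.
Proof.
move=> m8 c0; apply: le_trans lamC; apply: ler_pM => //; last exact: ler_weXn2l.
by rewrite ler_nat (leq_trans c0).
Qed.
Let lam_nat c : (c <= 64)%N -> c%:R <= lam.
Proof. by move=> c64; rewrite -[X in X <= _]mulr1 -(expr0 E) lamC2. Qed.
Let lam1 : 1 <= lam. Proof. exact: (lam_nat (c := 1)). Qed.
Let lam_gt0 : 0 < lam. Proof. exact: lt_le_trans lam1. Qed.
Let lam_ge0 : 0 <= lam. Proof. exact: ltW. Qed.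
Let lamX_gt0 m : 0 < lam ^+ m. Proof. exact: exprn_gt0. Qed.
Let lamX_ge0 m : 0 <= lam ^+ m. Proof. exact: exprn_ge0. Qed.
Let lamX m m' : (m <= m')%N -> lam ^+ m <= lam ^+ m'.
Proof. exact: ler_weXn2l. Qed.
Let absorb c m : c <= lam -> c * lam ^+ m <= lam ^+ m.+1.
Proof. by move=> cl; rewrite exprS ler_pM2r. Qed.
Let q_ge0 : 0 <= q. Proof. by rewrite subr_ge0. Qed.
Let q_le1 : q <= 1. Proof. by rewrite gerBl. Qed.
Let qX_ge0 m : 0 <= q ^+ m. Proof. exact: exprn_ge0. Qed.
Let q_le k' m : (k' <= m)%N -> q ^+ m <= q ^+ k'.
Proof. by move=> km; apply: ler_wiXn2l. Qed.
Let u_ge0 : 0 <= u. Proof. by rewrite invr_ge0. Qed.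
Let n_ge m : (m <= 1500)%N -> lam ^+ m <= n%:R.
Proof. by move=> m1500; rewrite nE; apply/lamX/(leq_trans m1500)/(@leq_mul 50 30). Qed.
Let n_gt0 : 0 < n%:R :> R. Proof. by rewrite nE. Qed.

Let M k := 'C(n, k)%:R * q ^+ 'C(k, 2).

Let M_sqr k : M k ^+ 2 = 'C(n, k)%:R ^+ 2 * (q ^+ k.-1) ^+ k.
Proof. by rewrite /M exprMn -!exprM mulnC bin2_double mulnC. Qed.

Section Threshold.
Variable k : nat.
Hypotheses (k_gt0 : (0 < k)%N) (Mk : lam <= M k) (Mk1 : M k.+1 < lam).

Lemma dense_lower : 1 <= n%:R ^+ 2 * q ^+ k.-1.
Proof.
rewrite -(ler_pXn2r k_gt0) ?nnegrE ?mulr_ge0 ?sqr_ge0 // expr1n exprMn.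
apply: (@le_trans _ _ (M k ^+ 2)); first by rewrite exprn_ege1 // (le_trans lam1).
rewrite M_sqr; apply: ler_wpM2r; first exact: exprn_ge0.
rewrite exprAC; apply: lerXn2r; rewrite ?nnegrE ?exprn_ge0 //.
by rewrite -natrX ler_nat bin_le_expn.
Qed.

(** e^(p(k-1)) <= q^(-(k-1)) <= n^2 = lam^(60T) <= e^lam, and 1/p is at most lam^100. *)
Lemma dense_k_le : k.+1%:R <= lam ^+ 102.
Proof.
have h : expR (p * k.-1%:R) <= expR lam.
  apply: le_trans lamE.
  have hn : n%:R ^+ 2 = lam ^+ (T * 60) by rewrite nE -exprM -mulnA.
  rewrite -hn -[X in X <= _]mulr1 -ler_pdivlMl ?expR_gt0 // -expRN mulrC.
  apply: le_trans dense_lower _; apply: ler_wpM2l; first exact: sqr_ge0.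
  rewrite -mulNr expRM_natr; apply: lerXn2r; rewrite ?nnegrE ?expR_ge0 //.
  by have := expR_ge1Dx (- p).
rewrite ler_expR in h.
have h1 : k.-1%:R <= lam ^+ 101.
  apply: (@le_trans _ _ (p * lam ^+ A * k.-1%:R)); first by rewrite ler_peMl.
  rewrite mulrAC; apply: le_trans (ler_wpM2r (lamX_ge0 A) h) _.
  rewrite -exprS; apply: lamX; exact: A100.
have -> : k.+1%:R = k.-1%:R + 2%:R :> R by rewrite -natrD addn2 prednK.
apply: (@le_trans _ _ (3%:R * lam ^+ 101)); last by apply: absorb; exact: lam_nat.
have : 1 <= lam ^+ 101 by exact: exprn_ege1.
lra.
Qed.

Let kn : (k.+1 <= n)%N.
Proof.
by rewrite -(ler_nat R); apply: le_trans dense_k_le (n_ge _).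
Qed.

Lemma dense_upper : n%:R ^+ 2 * q ^+ k <= lam ^+ 206.
Proof.
apply: (@le_trans _ _ (lam ^+ 2 * k.+1%:R ^+ 2)); last first.
  rewrite -[206%N]/(2 + 102 * 2)%N exprD exprM ler_pM2l //.
  by apply: lerXn2r; rewrite ?nnegrE // dense_k_le.
rewrite -(ler_pXn2r (ltn0Sn k)) ?nnegrE ?mulr_ge0 ?sqr_ge0 ?exprn_ge0 //.
rewrite exprMn [X in _ <= X]exprMn [(n%:R ^+ 2) ^+ k.+1]exprAC [(k.+1%:R ^+ 2) ^+ k.+1]exprAC.
have h : n%:R ^+ k.+1 <= 'C(n, k.+1)%:R * k.+1%:R ^+ k.+1 :> R by exact: pow_le_bin.
apply: (@le_trans _ _ (('C(n, k.+1)%:R * k.+1%:R ^+ k.+1) ^+ 2 * (q ^+ k) ^+ k.+1)).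
  by apply: ler_wpM2r; [exact: exprn_ge0|apply: lerXn2r; rewrite ?nnegrE ?mulr_ge0 ?exprn_ge0].
have -> : ('C(n, k.+1)%:R * k.+1%:R ^+ k.+1) ^+ 2 * (q ^+ k) ^+ k.+1 =
    M k.+1 ^+ 2 * (k.+1%:R ^+ k.+1) ^+ 2 by rewrite M_sqr /=; ring.
apply: ler_wpM2r; first exact: sqr_ge0.
apply: (@le_trans _ _ (lam ^+ 2)); last by rewrite -exprM; apply: lamX; rewrite mulnC leq_pmull.
by apply: lerXn2r; rewrite ?nnegrE ?mulr_ge0 ?exprn_ge0 // ltW.
Qed.

Let kL : k%:R <= lam ^+ 102.
Proof. by apply: le_trans dense_k_le; rewrite ler_nat. Qed.

(** [middle_bound] with a = 0, since no weakness condition is imposed. By the exponent inequality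
    n^2 q^i is at least n^(2/3), beyond any power of [lam] coming from k. *)
Lemma dense_small_term i : (1 < i)%N -> (2 * i <= k)%N ->
  'C(k, i)%:R * 'C(n, k - i)%:R * q ^+ ('C(k, 2) - 'C(i, 2)) <= M k * u ^+ i.
Proof.
move=> i1 ik.
apply: (@middle_bound R q 0) => //.
- by rewrite (ltnW i1) (leq_trans _ ik) // leq_pmull.
- rewrite -(ler_nat R) natrM; apply: le_trans (n_ge (isT : 103 <= 1500)%N).
  by rewrite (exprS lam 102); apply: ler_pM => //; exact: lam_nat.
- by rewrite subr0 expr1n mulr1.
- by rewrite subr0 expr1n mul1r exprn_ege1.
have qi : n%:R ^+ 2 <= (n%:R ^+ 2 * q ^+ i) ^+ 3.
  have -> : (n%:R ^+ 2 * q ^+ i) ^+ 3 = n%:R ^+ 2 * (n%:R ^+ 4 * (q ^+ i) ^+ 3) by ring.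
  rewrite ler_peMr ?sqr_ge0 //.
  apply: le_trans (_ : (n%:R ^+ 2 * q ^+ k.-1) ^+ 2 <= _); first by rewrite exprn_ege1 // dense_lower.
  have -> : (n%:R ^+ 2 * q ^+ k.-1) ^+ 2 = n%:R ^+ 4 * (q ^+ k.-1) ^+ 2 by ring.
  apply: ler_wpM2l; first exact: exprn_ge0.
  by rewrite -!exprM; apply: q_le; exact: dense_small_exponent.
have hX : (lam ^+ 413) ^+ 3 <= (n%:R ^+ 2 * q ^+ i) ^+ 3.
  apply: le_trans qi; apply: le_trans (_ : n%:R ^+ 1 <= _).
    by rewrite -exprM expr1; apply: n_ge.
  by apply: ler_weXn2l => //; rewrite ler1n -(ltr0n R).
rewrite ler_pXn2r ?nnegrE ?mulr_ge0 ?sqr_ge0 // in hX.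
apply: (@le_trans _ _ ((n%:R ^+ 2 * q ^+ i) * 1)); last first.
  have -> : (n%:R / 2 * i%:R) ^+ 2 * q ^+ i = (n%:R ^+ 2 * q ^+ i) * (i%:R / 2) ^+ 2 by field.
  apply: ler_wpM2l; first by rewrite mulr_ge0 ?sqr_ge0.
  by rewrite exprn_ege1 // ler_pdivlMr // mul1r ler_nat.
rewrite mulr1; apply: le_trans hX.
have -> : (E ^+ 2 * k%:R ^+ 2 * lam) ^+ 2 = E ^+ 4 * (lam ^+ 2 * (k%:R ^+ 2) ^+ 2) by ring.
apply: (@le_trans _ _ (lam * (lam ^+ 2 * (lam ^+ 102 ^+ 2) ^+ 2))).
  apply: ler_pM.
  - exact: EX_ge0.
  - by rewrite mulr_ge0 ?sqr_ge0.
  - by have := @lamC2 4 1 isT isT; rewrite mul1r.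
  - apply: ler_wpM2l => //; apply: lerXn2r; rewrite ?nnegrE ?sqr_ge0 //.
    by apply: lerXn2r; rewrite ?nnegrE.
by rewrite -!exprM -exprD -exprS; apply: lamX.
Qed.

Lemma dense_large_term i : (1 < i)%N -> (i < k)%N -> (k < 2 * i)%N ->
  'C(k, i)%:R * 'C(n, k - i)%:R * q ^+ ('C(k, 2) - 'C(i, 2)) <= u ^+ (k - i).
Proof.
move=> i1 ik ki.
rewrite -[q ^+ (_ - _)]mulr1.
have j0 : (0 < k - i)%N by rewrite subn_gt0.
apply: (near_bound (g := 1)) => //; first by rewrite !expr1n.
rewrite mulr1; apply: (@le_trans _ _ 1); last by rewrite exprn_ege1 // ler1n.
set X := n%:R ^+ 2 * q ^+ (k + i).-1.
have X0 : 0 <= X by rewrite mulr_ge0 ?sqr_ge0.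
have hX : X ^+ 3 * n%:R ^+ 2 <= lam ^+ 824.
  have -> : X ^+ 3 * n%:R ^+ 2 = n%:R ^+ 8 * (q ^+ (k + i).-1) ^+ 3 by rewrite /X; ring.
  apply: (@le_trans _ _ ((n%:R ^+ 2 * q ^+ k) ^+ 4)); last first.
    rewrite -[824%N]/(206 * 4)%N exprM; apply: lerXn2r; rewrite ?nnegrE ?mulr_ge0 ?sqr_ge0 //.
    exact: dense_upper.
  have -> : (n%:R ^+ 2 * q ^+ k) ^+ 4 = n%:R ^+ 8 * (q ^+ k) ^+ 4 by ring.
  apply: ler_wpM2l; first exact: exprn_ge0.
  by rewrite -!exprM; apply: q_le; exact: dense_large_exponent.
have -> : lam ^+ 2 * (E ^+ 2 * k%:R * n%:R) ^+ 2 * q ^+ (k + i).-1 =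
  E ^+ 4 * (lam ^+ 2 * k%:R ^+ 2) * X by rewrite /X; ring.
set W := E ^+ 4 * _.
have W0 : 0 <= W by rewrite !mulr_ge0 ?sqr_ge0.
have hW : W <= lam ^+ 207.
  rewrite (exprS lam 206); apply: ler_pM => //; first by rewrite mulr_ge0 ?sqr_ge0.
    by have := @lamC2 4 1 isT isT; rewrite mul1r.
  rewrite -[206%N]/(2 + 102 * 2)%N exprD exprM ler_pM2l //.
  by apply: lerXn2r; rewrite ?nnegrE.
have n2 : (0 : R) < n%:R ^+ 2 by exact: exprn_gt0.
rewrite -(ler_pXn2r (n := 3)) ?nnegrE ?mulr_ge0 // expr1n exprMn -(ler_pM2r n2) mul1r -mulrA.
apply: (@le_trans _ _ (lam ^+ 207 ^+ 3 * lam ^+ 824)).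
  apply: ler_pM => //; [exact: exprn_ge0|by rewrite mulr_ge0 ?exprn_ge0|].
  by apply: lerXn2r; rewrite ?nnegrE.
rewrite -exprM -exprD; apply: (@le_trans _ _ (lam ^+ 1500 ^+ 2)).
  by rewrite -exprM; apply: lamX.
by apply: lerXn2r; rewrite ?nnegrE // n_ge.
Qed.

Let u_half : u <= 1 / 2.
Proof. by rewrite div1r lef_pV2 ?posrE // lam_nat. Qed.

Let M_gt0 : 0 < M k. Proof. exact: lt_le_trans Mk. Qed.

Lemma dense_sum :
  \sum_(i < k.+1 | ~~ (i <= 1)%N)
    'C(k, i)%:R * 'C(n, k - i)%:R * q ^+ ('C(k, 2) - 'C(i, 2)) <= 2 + 2 * u * M k.
Proof.
have M0 : 0 <= M k by exact: ltW.
rewrite big_mkcond big_ord_recr /=.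
set last_term := (X in _ + X); set main := \sum_(_ < k) _.
have hlast : last_term <= 1.
  rewrite /last_term; case: ifP => // _.
  by rewrite !subnn binn bin0 expr0 !mul1r.
pose g i : R := if i == 0%N then 0 else u ^+ i.
have g_ge0 i : 0 <= g i by rewrite /g; case: ifP => // _; exact: exprn_ge0.
have hmain : main <= \sum_(i < k) (u ^+ (k - i) + M k * g i).
  apply: ler_sum => i _; case: ifPn => i1; last first.
    by apply: addr_ge0; [exact: exprn_ge0|exact: mulr_ge0].
  rewrite -ltnNge in i1; case: (leqP (2 * i) k) => ik.
    rewrite /g gtn_eqF ?(ltnW i1) //; apply: le_trans (dense_small_term i1 ik) _.
    by rewrite lerDr exprn_ge0.
  apply: le_trans (dense_large_term i1 (ltn_ord i) ik) _.
  by rewrite lerDl mulr_ge0.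
have s1 : \sum_(i < k) u ^+ (k - i) <= 2 * u.
  rewrite (reindex_inj rev_ord_inj) /=.
  apply: (@geometric_sum_le R u (fun i => u ^+ (k - (k - i.+1)))) => // i ik.
  by rewrite subKn.
have s2 : \sum_(i < k) g i <= 2 * u.
  case: (k) => [|k']; first by rewrite big_ord0 mulr_ge0.
  by rewrite big_ord_recl /= add0r; exact: (@geometric_sum_le R u (fun i => u ^+ i.+1)).
rewrite big_split /= -mulr_sumr in hmain.
have s3 : M k * \sum_(i < k) g i <= M k * (2 * u) by rewrite ler_wpM2l.
have -> : 2 * u * M k = M k * (2 * u) by ring.
have := u_half; lra.
Qed.

Lemma dense_lower_tail :
  gnp_prob p (fun G : graph n => (indep_number G < k)%N) <= 4 * u.
Proof.
have e0 : 0 <= 2 * u by rewrite mulr_ge0.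
apply: le_trans (Pr_no_independent p_ge0 p_le1 e0 M_gt0 dense_sum) _.
have : (M k)^-1 <= u by rewrite lef_pV2 ?posrE.
rewrite -/(M k); lra.
Qed.

(** M (k+2) <= n q^(k+1) M (k+1) with M (k+1) < lam, and n^2 q^k <= lam^206 makes this at most
    lam^207 / n. *)
Lemma dense_upper_tail :
  gnp_prob p (fun G : graph n => (k.+2 <= indep_number G)%N) <= u.
Proof.
apply: le_trans (@Pr_indep_number_ge R n p p_ge0 p_le1 k.+2) _.
have h1 : 'C(n, k.+2)%:R <= n%:R * 'C(n, k.+1)%:R :> R.
  rewrite -natrM ler_nat; apply: (@leq_trans (k.+2 * 'C(n, k.+2))); first by rewrite leq_pmull.
  by rewrite mul_bin_left leq_mul2r leq_subr orbT.
have -> : 'C(k.+2, 2) = (k.+1 + 'C(k.+1, 2))%N by rewrite binS bin1 addnC.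
rewrite exprD -/q; apply: le_trans (ler_wpM2r _ h1) _; first by rewrite mulr_ge0.
have -> : n%:R * 'C(n, k.+1)%:R * (q ^+ k.+1 * q ^+ 'C(k.+1, 2)) =
  n%:R * q ^+ k.+1 * M k.+1 by rewrite /M; ring.
have nq0 m : 0 <= n%:R * q ^+ m by rewrite mulr_ge0.
apply: (@le_trans _ _ (n%:R * q ^+ k * lam)).
  by apply: ler_pM; rewrite ?(ltW Mk1) ?mulr_ge0 //; apply: ler_wpM2l => //; apply: q_le.
rewrite -(ler_pM2r n_gt0) -(ler_pM2r lam_gt0).
have -> : n%:R * q ^+ k * lam * n%:R * lam = (n%:R ^+ 2 * q ^+ k) * lam ^+ 2 by ring.
have -> : u * n%:R * lam = n%:R by field; rewrite gt_eqF.
apply: le_trans (_ : lam ^+ 206 * lam ^+ 2 <= _).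
  by rewrite ler_pM2r // dense_upper.
by rewrite -exprD n_ge.
Qed.

End Threshold.

Lemma dense_two_point : exists f : nat,
  1 - 64 * u <= gnp_prob p (fun G : graph n => (f <= indep_number G <= f.+1)%N).
Proof.
pose P f := (0 < f)%N && (lam <= M f).
have P1 : exists f, P f.
  exists 1%N; rewrite /P /M bin1 bin_small // expr0 mulr1 /=.
  by have := @n_ge 1 isT; rewrite expr1.
have Pbound f : P f -> (f <= n)%N.
  move=> /andP[_]; apply: contraTT; rewrite -ltnNge => nf.
  by rewrite /M bin_small // mul0r -ltNge.
case: (ex_maxnP P1 Pbound) => f /andP[f0 lamf] fmax.
have lamf1 : M f.+1 < lam.
  rewrite ltNge; apply/negP => h.
  have /fmax : P f.+1 by rewrite /P h.
  by rewrite ltnn.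
have lower := dense_lower_tail f0 lamf lamf1.
have upper := dense_upper_tail f0 lamf lamf1.
exists f.
have tot := Pr_two_values_ge n p_ge0 p_le1 f.
have := u_ge0; lra.
Qed.

End DenseRegime.

(** * Two-point concentration *)

Lemma expn_le_expR (R : realType) (m : nat) (x : R) :
  (m.+1)`!%:R <= x -> x ^+ m <= expR x.
Proof.
move=> hx.
have f0 : (0 : R) < (m.+1)`!%:R by rewrite ltr0n fact_gt0.
have x0 : 0 <= x by rewrite (le_trans _ hx) // ltW.
apply: le_trans (expR_ge1Dxn m x0).
apply: (@le_trans _ _ (x ^+ m.+1 / (m.+1)`!%:R)); last by rewrite lerDr.
by rewrite ler_pdivlMr // exprSr ler_wpM2l // exprn_ge0.
Qed.

(** [T] and [X] depend on [eps] alone, so a sequence p(n) may alternate between the sparse and the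
    dense regime. *)
Lemma two_point_uniform (R : realType) (eps : R) : 0 < eps ->
  exists (T : nat) (X : R), (0 < T)%N /\
  forall (n : nat) (p lam : R), X <= lam -> 0 < lam -> n%:R = lam ^+ (T * 30) ->
    n%:R `^ (- (2 / 3) + eps) < p <= 1 ->
    exists f : nat,
      1 - 64 / lam <= gnp_prob p (fun G : graph n => (f <= indep_number G <= f.+1)%N).
Proof.
move=> eps0.
have [T [T50 Teps]] : exists T : nat, (50 <= T)%N /\ 2 <= T%:R * eps.
  exists (50 + (Num.truncn (2 / eps)).+1)%N; split; first exact: leq_addr.
  rewrite -ler_pdivrMr //; apply: ltW; apply: lt_le_trans (truncnS_gt _) _.
  by rewrite ler_nat leq_addl.
exists T.
pose X1 : R := 64%:R * expR 1 ^+ 8 * T%:R ^+ 4.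
have [X2 [X20 hX2]] : exists X2 : R, 0 <= X2 /\
    forall x, X2 <= x -> x ^+ (T * 60 + 20) <= expR x.
  by exists ((T * 60 + 20).+1)`!%:R; split=> [|x]; [exact: ler0n|exact: expn_le_expR].
exists (X1 + X2); split; first exact: leq_trans T50.
move=> n p lam hX lam0 nE /andP[pl p1].
have X10 : 0 <= X1 by rewrite !mulr_ge0 ?exprn_ge0 ?expR_ge0.
have lamC : X1 <= lam by apply: le_trans hX; rewrite lerDl.
have lamE : lam ^+ (T * 60 + 20) <= expR lam.
  by apply: hX2; apply: le_trans hX; rewrite lerDr.
have p0 : 0 < p by apply: le_lt_trans pl; exact: powR_ge0.
have E1 : 1 <= expR 1 :> R by apply: le_trans (expR_ge1Dx 1); rewrite lerDl.
have T1 : 1 <= T%:R ^+ 4 :> R by rewrite exprn_ege1 // ler1n (leq_trans _ T50).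
have lamC' : 64%:R * expR 1 ^+ 8 <= lam.
  by apply: le_trans lamC; rewrite /X1 ler_peMr // mulr_ge0 // exprn_ge0 // expR_ge0.
have lam1 : 1 <= lam.
  apply: le_trans lamC'; apply: (@le_trans _ _ (64%:R * 1)); first by rewrite mulr1 ler1n.
  by rewrite ler_pM2l // exprn_ege1.
have [small|large] := leP (p * lam ^+ 100) 1; last first.
  apply: (@dense_two_point R n T 100 64 p lam) => //; first exact: ltW.
  by apply: le_trans lamE; apply: ler_weXn2l => //; rewrite leq_addr.
apply: (@sparse_two_point R n T 100 64 p lam) => //; first exact: leq_trans T50.
have n0 : 0 < n%:R :> R by rewrite nE exprn_gt0.
apply: (@le_trans _ _ (n%:R ^+ 2 * (n%:R `^ (- (2 / 3) + eps)) ^+ 3)); last first.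
  apply: ler_wpM2l; first exact: exprn_ge0.
  by apply: lerXn2r; rewrite ?nnegrE ?powR_ge0 // ltW.
rewrite -!powR_mulrn ?powR_ge0 ?(ltW n0) ?(ltW lam0) // -powRrM -powRD; last first.
  by apply/implyP => _; rewrite gt_eqF.
(* n^2 p^3 >= n^(3 eps) = lam^(90 T eps) >= lam^180, by the choice of [T] with T * eps >= 2; the
   sparse regime asks for lam^100. *)
have -> : 2%:R + (- (2 / 3) + eps) * 3%:R = 3 * eps by field.
rewrite nE -powR_mulrn ?(ltW lam0) // -powRrM; apply: ler_powR => //.
have -> : (T * 30)%:R * (3 * eps) = 90 * (T%:R * eps) :> R by rewrite natrM; ring.
lra.
Qed.

Local Open Scope classical_set_scope.

Theorem theorem1 (R : realType) (eps : R) (p : nat -> R)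
    (eps_gt0 : 0 < eps)
    (p_bounds : \forall n \near \oo,
       (n%:R : R) `^ (- (2 / 3) + eps) < p n <= 1) :
  concentrated_on (fun=> 2%N) p
    (fun (n : nat) (G : graph n) => (indep_number G)%:Z).
Proof.
have [T [X [T0 main]]] := two_point_uniform eps_gt0.
pose lam (n : nat) : R := n%:R `^ (T * 30)%:R^-1.
have T30 : (0 < T * 30)%N by rewrite muln_gt0 T0.
have lamX n : lam n ^+ (T * 30) = n%:R.
  rewrite /lam -powR_mulrn ?powR_ge0 // -powRrM mulVf ?powRr1 //.
  by rewrite gt_eqF // ltr0n.
have lam_ge (Y : R) : \forall n \near \oo, Y <= lam n.
  apply: filterS (nbhs_infty_ger (`|Y| ^+ (T * 30))) => n; rewrite -lamX => h.
  apply: le_trans (ler_norm Y) _.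
  by rewrite -(ler_pXn2r T30) ?nnegrE ?powR_ge0.
(* The hypotheses on n are moved under the existential so that [choice] gives a total function; its
   value is 0 where they fail. *)
have good n : exists f : nat,
    X <= lam n -> 0 < lam n -> n%:R `^ (- (2 / 3) + eps) < p n <= 1 ->
    1 - 64 / lam n <=
      gnp_prob (p n) (fun G : graph n => (f <= indep_number G <= f.+1)%N).
  have [h|nh] := pselect (X <= lam n /\ 0 < lam n /\
      n%:R `^ (- (2 / 3) + eps) < p n <= 1); last first.
    by exists 0%N => h1 h2 h3; case: nh.
  by case: h => h1 [h2 h3]; have [f hf] := main n (p n) (lam n) h1 h2 (esym (lamX n)) h3; exists f.
have [F hF] := choice good.
exists (fun n => (F n)%:Z); apply/cvgrPdist_le => e e0.
near=> n.
have lam0 : 0 < lam n by apply: lt_le_trans (_ : 1 <= _); rewrite //; near: n; exact: lam_ge.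
have pn : n%:R `^ (- (2 / 3) + eps) < p n <= 1 by near: n.
have hX : X <= lam n by near: n; exact: lam_ge.
have he : 64 / e <= lam n by near: n; exact: lam_ge.
have h := hF n hX lam0 pn.
have p0 : 0 <= p n by case/andP: pn => pl _; rewrite ltW // (le_lt_trans _ pl) // powR_ge0.
have p1 : p n <= 1 by case/andP: pn.
set P := gnp_prob _ _.
have PE : P = gnp_prob (p n) (fun G : graph n => (F n <= indep_number G <= (F n).+1)%N).
  by apply: eq_Pr => G /=; lia.
have P1 : P <= 1 by exact: Pr_le1.
have he' : 64 / lam n <= e by rewrite ler_pdivrMr // mulrC -ler_pdivrMr.
rewrite ger0_norm ?subr_ge0 // PE; lra.
Unshelve. all: by end_near.
Qed.
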